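(* Let $k=s+\frac12$ with $s\in\mathbb Z$, and write $s=12a+b$ with $a\in\mathbb Z$ and $b\in\{6,8,9,10,11,12,13,14,15,16,17,19\}$. There are absolute positive constants $A\le 9$ and $B\le 109$ such that the following holds. Let $m$ be an integer with $m\ge A|a|+B$ and $m\equiv 0,(-1)^{s-1}\pmod 4$, and let $\{f_{2-k,i}\}$ be the canonical basis of $M^!_{2-k}$, indexed by the admissible indices $i$ for weight $2-k$ in increasing order. Then for any integer $M>3a+\frac{3m}4+\frac b2-C$, it is impossible that the Fourier coefficients of $q^m$ in each of the first $M$ basis elements $f_{2-k,i}$ with $i\not\equiv m\pmod 4$ simultaneously vanish.
   Context: Let $q=e^{2\pi i\tau}$ and $\vartheta(\tau)=\sum_{n\in\mathbb Z}q^{n^2}$. For a weight $\kappa=t+\frac12$, $t\in\mathbb Z$, $M^!_\kappa$ is the space of holomorphic functions on the upper half plane, possibly with poles at the cusps, transforming like $\vartheta^{2\kappa}$ under $\Gamma_0(4)$ and satisfying Kohnen's plus space condition (Fourier expansion $\sum_{(-1)^tn\equiv0,1\,(4)}a(n)q^n$). Write $t=6\ell+\frac{k'}2$ with $\ell\in\mathbb Z$, $k'\in\{0,4,6,8,10,14\}$; let $N_\kappa=2\ell$ if $\ell$ is even and $N_\kappa=2\ell-(-1)^t$ if $\ell$ is odd. An integer $i$ is an admissible index for weight $\kappa$ if $i\ge -N_\kappa$ and $(-1)^{t-1}i\equiv0,1\pmod4$; for each such $i$ the canonical basis element is $f_{\kappa,i}(\tau)=q^{-i}+\sum_{n>N_\kappa,\,(-1)^tn\equiv0,1\,(4)}a_\kappa(i,n)q^n\in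 M^!_\kappa$, and these form a basis of $M^!_\kappa$. The constant $C$ is: $C=1$ if $m$ and $b$ are even; $C=\frac32$ if $m$ is even and $b$ odd; $C=\frac34$ if $m$ is odd and $b\in\{6,8,9,10,11,13\}$; $C=\frac74$ if $m$ is odd and $b\in\{12,14,15,16,17,19\}$. *)

(* Defs.v *)
From Stdlib Require Import Reals ZArith List.
From Coquelicot Require Export Coquelicot.
Open Scope R_scope.

Definition Cexp (z : C) : C :=
  (exp (Re z) * cos (Im z), exp (Re z) * sin (Im z)).

Definition qpow (tau : C) (n : Z) : C :=
  Cexp (Cmult (Cmult (RtoC (2 * PI * IZR n)) Ci) tau).

(* theta(tau) = sum_{n in Z} q^{n^2} = 1 + 2 sum_{k >= 1} q^{k^2} *)
Definition theta (tau : C) : C :=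
  (1 + 2 * Series (fun k : nat => Re (qpow tau (Z.of_nat (S k) * Z.of_nat (S k)))),
   2 * Series (fun k : nat => Im (qpow tau (Z.of_nat (S k) * Z.of_nat (S k))))).

Definition Czpow (z : C) (n : Z) : C :=
  match n with
  | Z0 => RtoC 1
  | Zpos p => Cpow z (Pos.to_nat p)
  | Zneg p => Cinv (Cpow z (Pos.to_nat p))
  end.

Definition mobius (a b c d : Z) (tau : C) : C :=
  Cdiv (Cplus (Cmult (RtoC (IZR a)) tau) (RtoC (IZR b)))
       (Cplus (Cmult (RtoC (IZR c)) tau) (RtoC (IZR d))).

Definition in_Gamma0_4 (a b c d : Z) : Prop :=
  (a * d - b * c = 1)%Z /\ (4 | c)%Z.

(* Fourier coefficient of q^n of a 1-periodic function, computed on Im tau = 1 *)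
Definition fcoef (f : C -> C) (n : Z) : C :=
  RInt (V := C_R_CompleteNormedModule)
    (fun x : R => Cmult (f (x, 1)) (qpow (x, 1) (- n))) 0 1.

Definition plus_okb (t n : Z) : bool :=
  let r := ((if Z.even t then n else - n) mod 4)%Z in
  (Z.eqb r 0 || Z.eqb r 1)%bool.

(* weight kappa = t + 1/2 *)
Definition holo_on_H (f : C -> C) : Prop :=
  forall tau : C, 0 < Im tau -> ex_derive (K := C_AbsRing) (V := C_NormedModule) f tau.

Definition transforms_like_theta (t : Z) (f : C -> C) : Prop :=
  forall a b c d : Z, in_Gamma0_4 a b c d ->
  forall tau : C, 0 < Im tau ->
    f (mobius a b c d tau) =
    Cmult (Czpow (Cdiv (theta (mobius a b c d tau)) (theta tau)) (2 * t + 1)) (f tau).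

(* meromorphic (at worst poles) at every cusp: for every gamma in SL2(Z),
   |(c tau + d)^{-kappa} f(gamma tau)| = O(exp(N Im tau)) as Im tau -> oo *)
Definition poles_at_cusps (t : Z) (f : C -> C) : Prop :=
  forall a b c d : Z, (a * d - b * c = 1)%Z ->
  exists K N : R, forall tau : C, 1 <= Im tau ->
    Cmod (f (mobius a b c d tau)) <=
    K * exp (N * Im tau) *
    Rpower (Cmod (Cplus (Cmult (RtoC (IZR c)) tau) (RtoC (IZR d)))) (IZR t + / 2).

Definition plus_space (t : Z) (f : C -> C) : Prop :=
  forall n : Z, plus_okb t n = false -> fcoef f n = RtoC 0.

Definition in_Mshriek (t : Z) (f : C -> C) : Prop :=
  holo_on_H f /\ transforms_like_theta t f /\ poles_at_cusps t f /\ plus_space t f.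

(* t = 6 l + k'/2, k'/2 in {0,2,3,4,5,7} *)
Definition kp_half (t : Z) : Z :=
  match (t mod 6)%Z with
  | 1%Z => 7%Z
  | r => r
  end.
Definition ell (t : Z) : Z := ((t - kp_half t) / 6)%Z.
Definition Nk (t : Z) : Z :=
  if Z.even (ell t) then (2 * ell t)%Z
  else (2 * ell t - (if Z.even t then 1 else -1))%Z.

Definition admissibleb (t i : Z) : bool :=
  (Z.leb (- Nk t) i && plus_okb (t - 1) i)%bool.

Definition canonical (t i : Z) (f : C -> C) : Prop :=
  in_Mshriek t f /\ fcoef f (- i) = RtoC 1 /\
  forall n : Z, (n <= Nk t)%Z -> n <> (- i)%Z -> fcoef f n = RtoC 0.

Definition qualb (t m j : Z) : bool :=
  (admissibleb t j && negb (Z.eqb (j mod 4) (m mod 4)))%bool.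

(* number of qualifying indices strictly smaller than i (0-based position) *)
Definition rank (t m i : Z) : nat :=
  length (filter (fun k : nat => qualb t m (- Nk t + Z.of_nat k)%Z)
                 (seq 0 (Z.to_nat (i + Nk t)))).

Definition Cconst (m b : Z) : R :=
  if Z.even m then (if Z.even b then 1 else 3 / 2)
  else (if existsb (Z.eqb b) (6 :: 8 :: 9 :: 10 :: 11 :: 13 :: nil)%Z then 3 / 4 else 7 / 4).

Definition b_range : list Z := (6 :: 8 :: 9 :: 10 :: 11 :: 12 :: 13 :: 14 :: 15 :: 16 :: 17 :: 19 :: nil)%Z.

(* Main.v *)
Require Import Defs.
From Stdlib Require Import Reals ZArith List Lra Lia Classical ClassicalEpsilon.
From Coquelicot Require Import Coquelicot.
Open Scope R_scope.

(** Put [t = 1 - s]. A form [f] of weight [t + 1/2] in the plus space has two parts [h0], [h1],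
    supported on the two admissible residue classes of exponents modulo 4; as functions of [4 tau]
    they form a vector-valued form of level one. Hence the Wronskian [w = h0 h1' - h1 h0'] has
    weight [2 t + 3] for SL2(Z) up to a character, and comparing it with the nonvanishing form
    [D = x y (x^4 - y^4)] of weight 3, where [x] and [y] are the two parts of theta, shows that
    [f = 0] as soon as the orders [B0 / 4], [B1 / 4] of the two parts satisfy
    [3 (B0 + B1) > 2 t + 3]: the function [w^12 / D^(4 (2 t + 3))] then has weight 0 and vanishes
    at infinity, so it is zero.

    Suppose that the coefficients of [q^m] vanish. Among [L + 1] consecutive basis elements whose
    indices lie in one class different from that of [m], some nontrivial combination kills the first
    [L] coefficients above the gap in the class of [m]; when the next exponent is [m] itself, its
    coefficient vanishes for free. This one extra zero violates the estimate, so the combination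
    is zero, which is impossible. The lower bound on [m] only serves to make the indices
    used fall among the first [M].

    The transformation law of theta is Poisson summation for [e(s x^2)]; the modulus of the Gaussian
    integral [c(s)] comes from [2 c(s) c(-1/s) = 1], scaling and complex conjugation. *)

(** Half-integral weight is handled through absolute values: no branch of a square root is chosen,
    the factor of automorphy stays a power of a quotient of theta values, and only its modulus is
    computed. A descent of every point of the upper half plane into [Im z >= 3/4], with numerical
    bounds there, does the work of contour integration around a fundamental domain: it shows that
    [D] has no zeros and that a decaying invariant function is zero.

    Level one arises because the matrices [(1 0; 4 1)] at [(z - 1) / 4] and [(1 0; -4 1)] at
    [(z + 1) / 4] both induce [z -> -1/z]; they exchange the values of [f] at [(z + 1) / 4] and
    [(z - 1) / 4], which the plus condition expresses through the two parts. When [w = 0], its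
    lowest coefficient, a multiple of [A1 - A0] and of the leading coefficients of the parts,
    vanishes; since the lowest exponents [A0], [A1] lie in different classes modulo 4, a leading
    coefficient would be zero. A part that vanishes identically forces [f = 0], because the factors
    of the two matrices differ by [i] or [-i], not by 1. *)

(** * Elementary estimates for complex moduli *)

Lemma Cmod_minus_le (a b : C) : Cmod (a - b) <= Cmod a + Cmod b.
Proof.
  unfold Cminus. rewrite <- (Cmod_opp b). apply Cmod_triangle.
Qed.

Lemma Cmod_sub_rev (a b : C) : Cmod a - Cmod b <= Cmod (a - b).
Proof.
  assert (H := Cmod_triangle (a - b) b).
  replace (a - b + b)%C with a in H by ring. lra.
Qed.

Lemma Cmod_minus_sym (a b : C) : Cmod (a - b) = Cmod (b - a).
Proof. rewrite <- Cmod_opp. f_equal. ring. Qed.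

Lemma Cmod_small_0 (z : C) : (forall eps, 0 < eps -> Cmod z <= eps) -> z = RtoC 0.
Proof.
  intros H. apply Cmod_eq_0. apply Rle_antisym; [|apply Cmod_ge_0].
  apply Rnot_lt_le. intros h. specialize (H (Cmod z / 2)). lra.
Qed.

Lemma Ci_sqr : (Ci * Ci)%C = RtoC (-1).
Proof. apply injective_projections; simpl; ring. Qed.

Lemma Cmod_le_abs (z : C) : Cmod z <= Rabs (Re z) + Rabs (Im z).
Proof.
  unfold Cmod, Re, Im. destruct z as [a b]; simpl.
  apply Rsqr_incr_0_var.
  - rewrite Rsqr_sqrt by nra. unfold Rsqr.
    assert (Ha := Rabs_pos a). assert (Hb := Rabs_pos b).
    assert (Rabs a * Rabs a = a * a) by (rewrite <- Rabs_mult; apply Rabs_pos_eq; nra).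
    assert (Rabs b * Rabs b = b * b) by (rewrite <- Rabs_mult; apply Rabs_pos_eq; nra).
    nra.
  - assert (Ha := Rabs_pos a). assert (Hb := Rabs_pos b). lra.
Qed.

Lemma Re_le_Cmod (z : C) : Rabs (Re z) <= Cmod z.
Proof. eapply Rle_trans; [|apply Rmax_Cmod]. apply Rmax_l. Qed.

Lemma Im_le_Cmod (z : C) : Rabs (Im z) <= Cmod z.
Proof. eapply Rle_trans; [|apply Rmax_Cmod]. apply Rmax_r. Qed.

(** * Complex derivatives *)

Definition Ccont (f : C -> C) (z : C) : Prop :=
  forall eps, 0 < eps -> exists del, 0 < del /\
    forall w, Cmod (w - z) < del -> Cmod (f w - f z) < eps.

(* Caratheodory's form of differentiability: sum, product, chain and inverse
   rules reduce to continuity statements and algebra. *)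
Definition Cder (f : C -> C) (z l : C) : Prop :=
  exists p : C -> C, Ccont p z /\ p z = l /\
    exists r, 0 < r /\ forall w, Cmod (w - z) < r -> f w = (f z + p w * (w - z))%C.

Lemma Ccont_const (c z : C) : Ccont (fun _ => c) z.
Proof.
  intros eps He. exists 1. split; [lra|]. intros w _.
  replace (c - c)%C with (RtoC 0) by ring. rewrite Cmod_0. lra.
Qed.

Lemma Ccont_id (z : C) : Ccont (fun w => w) z.
Proof. intros eps He. exists eps. auto. Qed.

Lemma Ccont_ext_loc (f g : C -> C) (z : C) (r : R) :
  0 < r -> (forall w, Cmod (w - z) < r -> f w = g w) -> Ccont f z -> Ccont g z.
Proof.
  intros Hr He H eps Hp. destruct (H eps Hp) as [d [Hd H']].
  exists (Rmin d r). split; [apply Rmin_pos; auto|]. intros w Hw.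
  assert (h1 := Rmin_l d r). assert (h2 := Rmin_r d r).
  rewrite <- !He; [apply H'; lra| |lra].
  replace (z - z)%C with (RtoC 0) by ring. rewrite Cmod_0. lra.
Qed.

Lemma Ccont_bounded (f : C -> C) (z : C) : Ccont f z ->
  exists M d, 0 < M /\ 0 < d /\ forall w, Cmod (w - z) < d -> Cmod (f w) <= M.
Proof.
  intros H. destruct (H 1 Rlt_0_1) as [d [Hd H']].
  exists (Cmod (f z) + 1), d. assert (h := Cmod_ge_0 (f z)).
  split; [lra|]. split; [auto|]. intros w Hw. specialize (H' w Hw).
  assert (h' := Cmod_sub_rev (f w) (f z)). lra.
Qed.

Lemma Ccont_plus (f g : C -> C) (z : C) :
  Ccont f z -> Ccont g z -> Ccont (fun w => f w + g w)%C z.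
Proof.
  intros Hf Hg eps He.
  destruct (Hf (eps / 2)) as [d1 [Hd1 H1]]; [lra|].
  destruct (Hg (eps / 2)) as [d2 [Hd2 H2]]; [lra|].
  exists (Rmin d1 d2). split; [apply Rmin_pos; auto|]. intros w Hw.
  assert (h1 := Rmin_l d1 d2). assert (h2 := Rmin_r d1 d2).
  replace (f w + g w - (f z + g z))%C with ((f w - f z) + (g w - g z))%C by ring.
  assert (A := H1 w ltac:(lra)). assert (B := H2 w ltac:(lra)).
  assert (T := Cmod_triangle (f w - f z) (g w - g z)). lra.
Qed.

Lemma Ccont_mult (f g : C -> C) (z : C) :
  Ccont f z -> Ccont g z -> Ccont (fun w => f w * g w)%C z.
Proof.
  intros Hf Hg eps He.
  destruct (Ccont_bounded f z Hf) as [M [d0 [HM [Hd0 H0]]]].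
  set (K := Cmod (g z) + 1). assert (hK : 0 < K) by (unfold K; assert (h := Cmod_ge_0 (g z)); lra).
  destruct (Hf (eps / (2 * K))) as [d1 [Hd1 H1]].
  { apply Rdiv_lt_0_compat; lra. }
  destruct (Hg (eps / (2 * M))) as [d2 [Hd2 H2]].
  { apply Rdiv_lt_0_compat; lra. }
  exists (Rmin d0 (Rmin d1 d2)). split; [repeat apply Rmin_pos; auto|]. intros w Hw.
  assert (h0 := Rmin_l d0 (Rmin d1 d2)). assert (h0' := Rmin_r d0 (Rmin d1 d2)).
  assert (h1 := Rmin_l d1 d2). assert (h2 := Rmin_r d1 d2).
  replace (f w * g w - f z * g z)%C with (f w * (g w - g z) + (f w - f z) * g z)%C by ring.
  assert (A := H1 w ltac:(lra)). assert (B := H2 w ltac:(lra)). assert (D := H0 w ltac:(lra)).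
  eapply Rle_lt_trans; [apply Cmod_triangle|]. rewrite !Cmod_mult.
  assert (P1 : Cmod (f w) * Cmod (g w - g z) <= M * Cmod (g w - g z)).
  { apply Rmult_le_compat_r; auto. apply Cmod_ge_0. }
  assert (P2 : M * Cmod (g w - g z) < eps / 2).
  { apply Rmult_lt_compat_l with (r := M) in B; auto.
    replace (M * (eps / (2 * M))) with (eps / 2) in B by (field; lra). auto. }
  assert (P3 : Cmod (f w - f z) * Cmod (g z) <= Cmod (f w - f z) * K).
  { apply Rmult_le_compat_l; [apply Cmod_ge_0|unfold K; lra]. }
  assert (P4 : Cmod (f w - f z) * K < eps / 2).
  { apply Rmult_lt_compat_r with (r := K) in A; auto.
    replace (eps / (2 * K) * K) with (eps / 2) in A by (field; lra). auto. }
  lra.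
Qed.

Lemma Ccont_comp (f g : C -> C) (z : C) :
  Ccont f z -> Ccont g (f z) -> Ccont (fun w => g (f w)) z.
Proof.
  intros Hf Hg eps He. destruct (Hg eps He) as [d [Hd H]].
  destruct (Hf d Hd) as [d' [Hd' H']]. exists d'. split; auto.
Qed.

Lemma Ccont_neq0 (f : C -> C) (z : C) : Ccont f z -> f z <> RtoC 0 ->
  exists d, 0 < d /\ forall w, Cmod (w - z) < d -> Cmod (f z) / 2 < Cmod (f w).
Proof.
  intros H Hz. assert (h := proj1 (Cmod_gt_0 _) Hz).
  destruct (H (Cmod (f z) / 2)) as [d [Hd H']]; [lra|].
  exists d. split; auto. intros w Hw. specialize (H' w Hw).
  rewrite Cmod_minus_sym in H'.
  assert (h' := Cmod_sub_rev (f z) (f w)). lra.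
Qed.

Lemma Ccont_inv (f : C -> C) (z : C) : Ccont f z -> f z <> RtoC 0 ->
  Ccont (fun w => / f w)%C z.
Proof.
  intros H Hz eps He. assert (h := proj1 (Cmod_gt_0 _) Hz).
  destruct (Ccont_neq0 f z H Hz) as [d [Hd Hd']].
  set (m := Cmod (f z)) in *.
  (* Near [z] one has [|f w| > m / 2], so the denominator [|f w| m] of the difference of inverses
     exceeds [m^2 / 2]. *)
  destruct (H (eps * (m * m / 2))) as [d2 [Hd2 H2]].
  { apply Rmult_lt_0_compat; nra. }
  exists (Rmin d d2). split; [apply Rmin_pos; auto|]. intros w Hw.
  assert (h1 := Rmin_l d d2). assert (h2 := Rmin_r d d2).
  assert (A := Hd' w ltac:(lra)). assert (B := H2 w ltac:(lra)).
  assert (Hfw : f w <> RtoC 0). { intros E. rewrite E, Cmod_0 in A. lra. }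
  replace (/ f w - / f z)%C with ((f z - f w) * / (f w * f z))%C by (field; auto).
  rewrite Cmod_mult, Cmod_inv, Cmod_mult by (apply Cmult_neq_0; auto).
  rewrite Cmod_minus_sym. fold m.
  assert (Hp : 0 < Cmod (f w) * m) by nra.
  apply Rmult_lt_reg_r with (Cmod (f w) * m); auto.
  rewrite Rmult_assoc, Rinv_l, Rmult_1_r by lra.
  eapply Rlt_le_trans; [apply B|]. apply Rmult_le_compat_l; nra.
Qed.

Lemma Cder_cont (f : C -> C) (z l : C) : Cder f z l -> Ccont f z.
Proof.
  intros [p [Hp [_ [r [Hr He]]]]].
  apply Ccont_ext_loc with (f := fun w => (f z + p w * (w - z))%C) (r := r); auto.
  { intros w Hw. symmetry. auto. }
  apply Ccont_plus; [apply Ccont_const|]. apply Ccont_mult; auto.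
  apply Ccont_plus; [apply Ccont_id|apply Ccont_const].
Qed.

Lemma Cder_ext_loc (f g : C -> C) (z l : C) (r : R) :
  0 < r -> (forall w, Cmod (w - z) < r -> f w = g w) -> Cder f z l -> Cder g z l.
Proof.
  intros Hr He [p [Hp [Hl [r' [Hr' H]]]]]. exists p. split; [auto|]. split; [auto|].
  exists (Rmin r r'). split; [apply Rmin_pos; auto|]. intros w Hw.
  assert (h1 := Rmin_l r r'). assert (h2 := Rmin_r r r').
  rewrite <- !He; [apply H; lra| |lra].
  replace (z - z)%C with (RtoC 0) by ring. rewrite Cmod_0. lra.
Qed.

Lemma Cder_ext (f g : C -> C) (z l : C) :
  (forall w, f w = g w) -> Cder f z l -> Cder g z l.
Proof. intros He. apply Cder_ext_loc with 1; [lra|auto]. Qed.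

Lemma Cder_const (c z : C) : Cder (fun _ => c) z (RtoC 0).
Proof.
  exists (fun _ => RtoC 0). split; [apply Ccont_const|]. split; auto.
  exists 1. split; [lra|]. intros; ring.
Qed.

Lemma Cder_id (z : C) : Cder (fun w => w) z (RtoC 1).
Proof.
  exists (fun _ => RtoC 1). split; [apply Ccont_const|]. split; auto.
  exists 1. split; [lra|]. intros; ring.
Qed.

Lemma Cder_plus (f g : C -> C) (z a b : C) :
  Cder f z a -> Cder g z b -> Cder (fun w => f w + g w)%C z (a + b)%C.
Proof.
  intros [p [Hp [Hl [r [Hr H]]]]] [p' [Hp' [Hl' [r' [Hr' H']]]]].
  exists (fun w => p w + p' w)%C. split; [apply Ccont_plus; auto|].
  split; [subst; auto|]. exists (Rmin r r'). split; [apply Rmin_pos; auto|].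
  intros w Hw. assert (h1 := Rmin_l r r'). assert (h2 := Rmin_r r r').
  rewrite H, H' by lra. ring.
Qed.

Lemma Cder_mult (f g : C -> C) (z a b : C) :
  Cder f z a -> Cder g z b -> Cder (fun w => f w * g w)%C z (a * g z + f z * b)%C.
Proof.
  intros Hf Hg. assert (Cg := Cder_cont _ _ _ Hg).
  destruct Hf as [p [Hp [Hl [r [Hr H]]]]]. destruct Hg as [p' [Hp' [Hl' [r' [Hr' H']]]]].
  exists (fun w => p w * g w + f z * p' w)%C.
  split. { apply Ccont_plus; apply Ccont_mult; auto. apply Ccont_const. }
  split; [subst; auto|]. exists (Rmin r r'). split; [apply Rmin_pos; auto|].
  intros w Hw. assert (h1 := Rmin_l r r'). assert (h2 := Rmin_r r r').
  rewrite H, H' by lra. ring.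
Qed.

Lemma Cder_comp (f g : C -> C) (z a b : C) :
  Cder f z a -> Cder g (f z) b -> Cder (fun w => g (f w)) z (b * a)%C.
Proof.
  intros Hf Hg. assert (Cf := Cder_cont _ _ _ Hf).
  destruct Hf as [p [Hp [Hl [r [Hr H]]]]]. destruct Hg as [p' [Hp' [Hl' [r' [Hr' H']]]]].
  destruct (Cf r' Hr') as [d [Hd Hd']].
  exists (fun w => p' (f w) * p w)%C.
  split. { apply Ccont_mult; auto. apply Ccont_comp; auto. }
  split; [subst; auto|]. exists (Rmin r d). split; [apply Rmin_pos; auto|].
  intros w Hw. assert (h1 := Rmin_l r d). assert (h2 := Rmin_r r d).
  rewrite H' by (apply Hd'; lra). rewrite (H w) at 2 by lra. ring.
Qed.

Lemma Cder_inv (f : C -> C) (z a : C) : Cder f z a -> f z <> RtoC 0 ->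
  Cder (fun w => / f w)%C z (- a * / (f z * f z))%C.
Proof.
  intros Hf Hz. assert (Cf := Cder_cont _ _ _ Hf).
  destruct (Ccont_neq0 f z Cf Hz) as [d [Hd Hd']].
  destruct Hf as [p [Hp [Hl [r [Hr H]]]]].
  exists (fun w => - p w * / (f w * f z))%C.
  split.
  { apply Ccont_mult.
    - apply Ccont_ext_loc with (f := fun w => (RtoC (-1) * p w)%C) (r := 1); [lra| |].
      + intros. ring.
      + apply Ccont_mult; auto. apply Ccont_const.
    - apply Ccont_inv. apply Ccont_mult; auto. apply Ccont_const.
      apply Cmult_neq_0; auto. }
  split; [subst; auto|]. exists (Rmin r d). split; [apply Rmin_pos; auto|].
  intros w Hw. assert (h1 := Rmin_l r d). assert (h2 := Rmin_r r d).
  assert (A := Hd' w ltac:(lra)). assert (h := Cmod_ge_0 (f z)).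
  assert (Hfw : f w <> RtoC 0). { intros E. rewrite E, Cmod_0 in A. lra. }
  assert (B := H w ltac:(lra)).
  replace (- p w * / (f w * f z) * (w - z))%C with (- (p w * (w - z)) * / (f w * f z))%C by ring.
  replace (p w * (w - z))%C with (f w - f z)%C by (rewrite B; ring).
  field. auto.
Qed.

Lemma Cder_val (f : C -> C) (z a b : C) : Cder f z a -> a = b -> Cder f z b.
Proof. intros H E. rewrite <- E. exact H. Qed.

Lemma Cder_scal (c : C) (f : C -> C) (z a : C) :
  Cder f z a -> Cder (fun w => c * f w)%C z (c * a)%C.
Proof.
  intros H. replace (c * a)%C with (RtoC 0 * f z + c * a)%C by ring.
  apply (Cder_mult (fun _ => c)); auto. apply Cder_const.
Qed.

Lemma Cder_affine (a b z : C) : Cder (fun w => a * w + b)%C z a.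
Proof.
  apply Cder_val with (a * RtoC 1 + RtoC 0)%C; [|ring].
  apply Cder_plus; [apply Cder_scal, Cder_id|apply Cder_const].
Qed.

Lemma Cder_unique (f : C -> C) (z a b : C) : Cder f z a -> Cder f z b -> a = b.
Proof.
  intros [p [Hp [Hl [r [Hr H]]]]] [p' [Hp' [Hl' [r' [Hr' H']]]]].
  cut ((a - b)%C = RtoC 0). { intros E. rewrite <- (Cplus_0_r b), <- E. ring. }
  apply Cmod_small_0. intros eps He. subst.
  destruct (Hp (eps / 2)) as [d [Hd Q]]; [lra|].
  destruct (Hp' (eps / 2)) as [d' [Hd' Q']]; [lra|].
  set (m := Rmin (Rmin r r') (Rmin d d')).
  assert (Hm : 0 < m) by (unfold m; repeat apply Rmin_pos; auto).
  assert (h1 := Rmin_l r r'). assert (h2 := Rmin_r r r').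
  assert (h3 := Rmin_l d d'). assert (h4 := Rmin_r d d').
  assert (h5 := Rmin_l (Rmin r r') (Rmin d d')). assert (h6 := Rmin_r (Rmin r r') (Rmin d d')).
  fold m in h5, h6.
  (* The slopes [p] and [p'] are only forced to agree off [z]; they are compared at a nearby point
     and continuity carries the equality to [z]. *)
  set (w := (z + RtoC (m / 2))%C).
  assert (Ew : (w - z)%C = RtoC (m / 2)) by (unfold w; ring).
  assert (Hw : Cmod (w - z) < m).
  { rewrite Ew, Cmod_R, Rabs_pos_eq; lra. }
  assert (E : p w = p' w).
  { assert (E1 := H w ltac:(lra)). assert (E2 := H' w ltac:(lra)).
    rewrite E1 in E2. rewrite Ew in E2.
    assert (N : RtoC (m / 2) <> RtoC 0). { intros E. apply RtoC_inj in E. lra. }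
    assert (E3 : (p w * RtoC (m / 2))%C = (p' w * RtoC (m / 2))%C).
    { replace (p w * RtoC (m / 2))%C with (f z + p w * RtoC (m / 2) - f z)%C by ring.
      rewrite E2. ring. }
    replace (p w) with (p w * RtoC (m / 2) / RtoC (m / 2))%C by (field; auto).
    rewrite E3. field. auto. }
  replace (p z - p' z)%C with ((p z - p w) + (p' w - p' z))%C by (rewrite E; ring).
  eapply Rle_trans; [apply Cmod_triangle|].
  assert (B1 := Q w ltac:(lra)). assert (B2 := Q' w ltac:(lra)).
  rewrite Cmod_minus_sym in B1. lra.
Qed.

Lemma Cder_eps (f : C -> C) (z l : C) :
  (forall eps, 0 < eps -> exists del, 0 < del /\ forall w, Cmod (w - z) < del ->
     Cmod (f w - f z - l * (w - z)) <= eps * Cmod (w - z)) <-> Cder f z l.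
Proof.
  split.
  - intros H.
    (* The difference quotient, completed by [l] at [z], is the slope function of Caratheodory's
       definition. *)
    exists (fun w => if Ceq_dec w z then l else ((f w - f z) / (w - z))%C).
    split.
    + intros eps He. destruct (H (eps / 2)) as [d [Hd Hd']]; [lra|].
      exists d. split; auto. intros w Hw.
      destruct (Ceq_dec z z) as [_|n]; [|congruence].
      destruct (Ceq_dec w z) as [e|n].
      * replace (l - l)%C with (RtoC 0) by ring. rewrite Cmod_0. lra.
      * assert (N : (w - z)%C <> RtoC 0) by (apply Cminus_eq_contra; auto).
        assert (P := proj1 (Cmod_gt_0 _) N).
        replace ((f w - f z) / (w - z) - l)%C with ((f w - f z - l * (w - z)) / (w - z))%C
          by (field; auto).
        rewrite Cmod_div by auto. specialize (Hd' w Hw).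
        apply Rle_lt_trans with (eps / 2); [|lra].
        apply Rmult_le_reg_r with (Cmod (w - z)); auto.
        unfold Rdiv at 1. rewrite Rmult_assoc, Rinv_l by lra. lra.
    + split. { destruct (Ceq_dec z z); congruence. }
      exists 1. split; [lra|]. intros w _. destruct (Ceq_dec w z) as [e|n].
      * subst. ring.
      * field. apply Cminus_eq_contra; auto.
  - intros [p [Hp [Hl [r [Hr H]]]]] eps He.
    destruct (Hp eps He) as [d [Hd Hd']].
    exists (Rmin r d). split; [apply Rmin_pos; auto|]. intros w Hw.
    assert (h1 := Rmin_l r d). assert (h2 := Rmin_r r d).
    rewrite (H w) by lra. subst l.
    replace (f z + p w * (w - z) - f z - p z * (w - z))%C with ((p w - p z) * (w - z))%C by ring.
    rewrite Cmod_mult. apply Rmult_le_compat_r; [apply Cmod_ge_0|].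
    left. apply Hd'. lra.
Qed.

(** The bridge to the notion of derivative behind [holo_on_H]; everything else works with [Cder]. *)
Lemma is_derive_Cder (f : C -> C) (z l : C) :
  is_derive (K := C_AbsRing) (V := C_NormedModule) f z l <-> Cder f z l.
Proof.
  rewrite <- Cder_eps. split.
  - intros [_ H] eps He.
    specialize (H z (fun P HP => HP) (mkposreal eps He)).
    destruct H as [d Hd]. exists d. split; [apply cond_pos|].
    intros w Hw. specialize (Hd w Hw). simpl in Hd.
    replace (f w - f z - l * (w - z))%C with (minus (minus (f w) (f z)) (scal (minus w z) l)).
    + exact Hd.
    + unfold minus, plus, opp, scal; simpl. unfold mult; simpl. ring.
  - intros H. split; [apply is_linear_scal_l|].
    intros y Hy. apply (is_filter_lim_locally_unique (V := AbsRing_NormedModule C_AbsRing)) in Hy. subst y.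
    intros eps. destruct (H eps (cond_pos eps)) as [d [Hd H']].
    exists (mkposreal d Hd). intros w Hw. specialize (H' w Hw).
    eapply Rle_trans; [right|exact H'].
    apply (f_equal Cmod).
    unfold minus, plus, opp, scal; simpl. unfold mult; simpl. ring.
Qed.

(** * The complex exponential and its derivative *)

Lemma Cexp_plus (a b : C) : Cexp (a + b) = (Cexp a * Cexp b)%C.
Proof.
  destruct a as [a1 a2], b as [b1 b2]. unfold Cexp; simpl.
  rewrite exp_plus, cos_plus, sin_plus.
  apply injective_projections; simpl; ring.
Qed.

Lemma Cexp_0 : Cexp (RtoC 0) = RtoC 1.
Proof.
  unfold Cexp; simpl. rewrite exp_0, cos_0, sin_0. apply injective_projections; simpl; ring.
Qed.

Lemma Cmod_Cexp (z : C) : Cmod (Cexp z) = exp (Re z).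
Proof.
  unfold Cexp, Cmod; simpl.
  replace (_ + _) with (exp (Re z) * exp (Re z) * (Rsqr (sin (Im z)) + Rsqr (cos (Im z))))
    by (unfold Rsqr; ring).
  rewrite sin2_cos2, Rmult_1_r. apply sqrt_square. left. apply exp_pos.
Qed.

Lemma Cexp_neq_0 (z : C) : Cexp z <> RtoC 0.
Proof. apply Cmod_gt_0. rewrite Cmod_Cexp. apply exp_pos. Qed.

Lemma Cexp_2PI_Z (n : Z) : Cexp (RtoC (2 * PI * IZR n) * Ci) = RtoC 1.
Proof.
  unfold Cexp. simpl.
  replace (2 * PI * IZR n * 0 - 0 * 1) with 0 by ring.
  replace (2 * PI * IZR n * 1 + 0 * 0) with (2 * PI * IZR n) by ring.
  rewrite exp_0. apply injective_projections; simpl; rewrite Rmult_1_l.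
  - replace (2 * PI * IZR n) with (2 * IZR n * PI) by ring.
    destruct (Z_le_gt_dec 0 n) as [H|H].
    + rewrite <- (Z2Nat.id n), <- INR_IZR_INZ by auto.
      rewrite <- (cos_0), <- (cos_period 0 (Z.to_nat n)). f_equal. ring.
    + rewrite <- cos_neg. rewrite <- cos_0, <- (cos_period 0 (Z.to_nat (- n))). f_equal.
      rewrite INR_IZR_INZ, Z2Nat.id, opp_IZR by lia. ring.
  - replace (2 * PI * IZR n) with (IZR (2 * n) * PI) by (rewrite mult_IZR; ring).
    apply sin_eq_0_1. exists (2 * n)%Z. reflexivity.
Qed.

Lemma exp_le_inc (x y : R) : x <= y -> exp x <= exp y.
Proof. intros [H| ->]; [left; apply exp_increasing; auto|right; auto]. Qed.

Lemma exp_ge_1x (x : R) : 1 + x <= exp x.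
Proof.
  destruct (Req_dec x 0) as [->|H]; [rewrite exp_0; lra|]. left. apply exp_ineq1; auto.
Qed.

Lemma x_exp_le (x : R) : x * exp (- x) <= 1.
Proof.
  rewrite exp_Ropp. assert (H := exp_ge_1x x). assert (P := exp_pos x).
  apply Rmult_le_reg_r with (exp x); auto. rewrite Rmult_assoc, Rinv_l by lra. lra.
Qed.

(** Square [exp (x / 2) >= 1 + x / 2]. *)
Lemma sqr_le_2exp (x : R) : 0 <= x -> x * x <= 4 * exp x.
Proof.
  intros H. replace (exp x) with (exp (x / 2) * exp (x / 2)).
  - assert (h := exp_ge_1x (x / 2)). nra.
  - rewrite <- exp_plus. f_equal. lra.
Qed.

Lemma exp_m1_bound (a : R) : Rabs (exp a - 1) <= Rabs a * exp (Rabs a).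
Proof.
  assert (P := exp_pos a).
  unfold Rabs. destruct (Rcase_abs (exp a - 1)), (Rcase_abs a).
  - assert (h := exp_ge_1x a). assert (exp (- a) >= 1) by (assert (h' := exp_ge_1x (- a)); lra). nra.
  - exfalso. assert (h := exp_ge_1x a). lra.
  - exfalso. assert (h := exp_increasing a 0 ltac:(lra)). rewrite exp_0 in h. lra.
  - assert (h := exp_ge_1x (- a)). rewrite exp_Ropp in h.
    assert (E : exp a * / exp a = 1) by (field; lra).
    assert (exp a * (1 - a) <= 1) by nra. nra.
Qed.

Lemma exp_taylor_bound (a : R) : Rabs (exp a - 1 - a) <= a * a * exp (Rabs a).
Proof.
  assert (P := exp_pos a). assert (h := exp_ge_1x a). rewrite (Rabs_pos_eq (_ - a)) by lra.
  assert (E : exp a * exp (- a) = 1) by (rewrite <- exp_plus, Rplus_opp_r; apply exp_0).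
  assert (h' := exp_ge_1x (- a)).
  destruct (Rle_lt_dec 0 a).
  - rewrite Rabs_pos_eq by auto.
    assert (exp a * (1 - a) <= 1) by nra. nra.
  - rewrite Rabs_left by auto. assert (exp a <= 1) by (rewrite <- exp_0; apply exp_le_inc; lra).
    assert (exp (- a) >= 1) by lra.
    assert (exp a * (1 - a) <= 1) by nra.
    assert (exp a - 1 - a <= a * a).
    { assert (exp a - 1 <= a * exp a) by nra. nra. }
    nra.
Qed.

Lemma cos_m1_bound (b : R) : Rabs (cos b - 1) <= Rabs b * Rabs b.
Proof.
  replace (cos b - 1) with (- (2 * (sin (b / 2) * sin (b / 2)))).
  - rewrite Rabs_Ropp, Rabs_mult, Rabs_mult, (Rabs_pos_eq 2) by lra.
    assert (H : Rabs (sin (b / 2)) <= Rabs (b / 2)).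
    { destruct (Rle_lt_dec 0 b).
      - rewrite (Rabs_pos_eq (b / 2)) by lra.
        destruct (Req_dec b 0) as [->|]; [replace (0 / 2) with 0 by lra; rewrite sin_0, Rabs_R0; lra|].
        apply Rabs_le. split.
        + destruct (Rle_lt_dec (b / 2) 1).
          * assert (PI2_1 := PI2_1). assert (0 <= sin (b / 2)) by (apply sin_ge_0; lra). lra.
          * assert (h := SIN_bound (b / 2)). lra.
        + left. apply sin_lt_x. lra.
      - rewrite (Rabs_left (b / 2)) by lra. rewrite <- Rabs_Ropp, <- sin_neg.
        apply Rabs_le. split.
        + destruct (Rle_lt_dec (- (b / 2)) 1).
          * assert (PI2_1 := PI2_1). assert (0 <= sin (- (b / 2))) by (apply sin_ge_0; lra). lra.
          * assert (h := SIN_bound (- (b / 2))). lra.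
        + left. apply sin_lt_x. lra. }
    assert (Rabs (b / 2) = Rabs b / 2).
    { unfold Rdiv. rewrite Rabs_mult, (Rabs_pos_eq (/ 2)) by lra. auto. }
    assert (h := Rabs_pos (sin (b / 2))). assert (h' := Rabs_pos b). nra.
  - replace b with (b / 2 + b / 2) at 3 by lra. rewrite cos_plus.
    assert (h := sin2_cos2 (b / 2)). unfold Rsqr in h. lra.
Qed.

Lemma cos_m1_abs (b : R) : Rabs (cos b - 1) <= 2 * Rabs b.
Proof.
  destruct (Rle_lt_dec (Rabs b) 1).
  - assert (h := cos_m1_bound b). assert (h' := Rabs_pos b). nra.
  - assert (h := COS_bound b). rewrite Rabs_left1 by lra. lra.
Qed.

Lemma sin_x_bound (b : R) : Rabs (sin b - b) <= 2 * (b * b).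
Proof.
  destruct (MVT_gen (fun x => sin x - x) 0 b (fun x => cos x - 1)) as [c [Hc E]].
  - intros x _. auto_derive; auto. ring.
  - intros x _. apply continuity_pt_minus; [apply continuity_sin|apply derivable_continuous_pt, derivable_pt_id].
  - rewrite sin_0 in E. replace (sin b - b) with ((cos c - 1) * b) by lra.
    rewrite Rabs_mult. assert (H := cos_m1_abs c).
    assert (Rabs c <= Rabs b).
    { unfold Rmin, Rmax in Hc. destruct (Rle_dec 0 b).
      - rewrite !Rabs_pos_eq by lra. lra.
      - rewrite !Rabs_left1 by lra. lra. }
    assert (Eb : b * b = Rabs b * Rabs b) by (rewrite <- Rabs_mult; symmetry; apply Rabs_pos_eq; nra).
    rewrite Eb. assert (h := Rabs_pos b). nra.
Qed.

(** The quadratic error term behind the derivative of [Cexp] and behind termwise differentiation in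
    [exp_series_der]. The real part contributes 2 and the imaginary part 3 to the constant; 6 leaves
    slack. *)
Lemma Cexp_taylor (w : C) : Cmod (Cexp w - RtoC 1 - w) <= 6 * (Cmod w * Cmod w) * exp (Cmod w).
Proof.
  destruct w as [a b]. set (m := Cmod (a, b)).
  assert (Ha : Rabs a <= m) by (apply (Re_le_Cmod (a, b))).
  assert (Hb : Rabs b <= m) by (apply (Im_le_Cmod (a, b))).
  eapply Rle_trans; [apply Cmod_le_abs|]. simpl.
  assert (pa := Rabs_pos a). assert (pb := Rabs_pos b).
  assert (Ea : exp (Rabs a) <= exp m) by (apply exp_le_inc; auto).
  assert (Ea1 : exp a <= exp m). { apply exp_le_inc. apply Rle_trans with (Rabs a); auto. apply Rle_abs. }
  assert (p1 := exp_pos a). assert (p2 := exp_pos m). assert (p3 := exp_pos (Rabs a)).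
  assert (M1 : 1 <= exp m) by (assert (h := exp_ge_1x m); lra).
  assert (Eaa : a * a = Rabs a * Rabs a) by (rewrite <- Rabs_mult; symmetry; apply Rabs_pos_eq; nra).
  assert (Ebb : b * b = Rabs b * Rabs b) by (rewrite <- Rabs_mult; symmetry; apply Rabs_pos_eq; nra).
  assert (Q1 : Rabs a * Rabs a <= m * m) by nra.
  assert (Q2 : Rabs b * Rabs b <= m * m) by nra.
  assert (Q3 : Rabs a * Rabs b <= m * m) by nra.
  assert (B1 : Rabs (exp a * cos b + -1 + - a) <= 2 * (m * m) * exp m).
  { replace (exp a * cos b + -1 + - a) with ((exp a - 1 - a) + exp a * (cos b - 1)) by ring.
    eapply Rle_trans; [apply Rabs_triang|]. rewrite Rabs_mult, (Rabs_pos_eq (exp a)) by lra.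
    assert (h1 := exp_taylor_bound a). assert (h2 := cos_m1_bound b).
    assert (Rabs (exp a - 1 - a) <= m * m * exp m).
    { eapply Rle_trans; [apply h1|]. rewrite Eaa. apply Rmult_le_compat; nra. }
    assert (exp a * Rabs (cos b - 1) <= exp m * (m * m)).
    { apply Rmult_le_compat; try lra. apply Rabs_pos. }
    lra. }
  assert (B2 : Rabs (exp a * sin b + -0 + - b) <= 3 * (m * m) * exp m).
  { replace (exp a * sin b + -0 + - b) with ((exp a - 1) * sin b + (sin b - b)) by ring.
    eapply Rle_trans; [apply Rabs_triang|]. rewrite Rabs_mult.
    assert (h1 := exp_m1_bound a). assert (h2 := sin_x_bound b).
    assert (S : Rabs (sin b) <= Rabs b).
    { destruct (MVT_gen sin 0 b cos) as [c [Hc E]].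
      - intros x _. apply is_derive_sin.
      - intros x _. apply continuity_sin.
      - rewrite sin_0 in E. replace (sin b) with (cos c * b) by lra. rewrite Rabs_mult.
        assert (h := COS_bound c). assert (Rabs (cos c) <= 1) by (apply Rabs_le; lra). nra. }
    assert (Rabs (exp a - 1) * Rabs (sin b) <= (Rabs a * exp (Rabs a)) * Rabs b).
    { apply Rmult_le_compat; auto; apply Rabs_pos. }
    assert (Rabs a * exp (Rabs a) * Rabs b <= m * m * exp m).
    { replace (Rabs a * exp (Rabs a) * Rabs b) with (Rabs a * Rabs b * exp (Rabs a)) by ring.
      apply Rmult_le_compat; nra. }
    assert (2 * (b * b) <= 2 * (m * m) * exp m) by (rewrite Ebb; nra).
    lra. }
  replace (exp a * cos b + - (1) + - a) with (exp a * cos b + -1 + - a) by ring.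
  replace (exp a * sin b + - 0 + - b) with (exp a * sin b + -0 + - b) by ring.
  nra.
Qed.

Lemma Cder_Cexp (z : C) : Cder Cexp z (Cexp z).
Proof.
  apply Cder_eps. intros eps He. set (K := exp (Re z)). assert (PK : 0 < K) by apply exp_pos.
  assert (Pe := exp_pos 1).
  set (d := Rmin 1 (eps / (6 * K * exp 1))).
  assert (P6 : 0 < 6 * K * exp 1) by nra.
  assert (Hd : 0 < d). { apply Rmin_pos; [lra|]. apply Rdiv_lt_0_compat; auto. }
  exists d. split; auto. intros w Hw.
  assert (h1 : d <= 1) by apply Rmin_l. assert (h2 : d <= eps / (6 * K * exp 1)) by apply Rmin_r.
  replace (Cexp w) with (Cexp z * Cexp (w - z))%C by (rewrite <- Cexp_plus; f_equal; ring).
  replace (Cexp z * Cexp (w - z) - Cexp z - Cexp z * (w - z))%C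
    with (Cexp z * (Cexp (w - z) - RtoC 1 - (w - z)))%C by ring.
  rewrite Cmod_mult, Cmod_Cexp. fold K.
  set (m := Cmod (w - z)) in *. assert (pm : 0 <= m) by apply Cmod_ge_0.
  assert (T := Cexp_taylor (w - z)). fold m in T.
  assert (E1 : exp m <= exp 1) by (apply exp_le_inc; lra).
  apply Rle_trans with (K * (6 * (m * m) * exp 1)).
  - apply Rmult_le_compat_l; [lra|]. eapply Rle_trans; [apply T|]. apply Rmult_le_compat_l; nra.
  - replace (K * (6 * (m * m) * exp 1)) with (6 * K * exp 1 * m * m) by ring.
    apply Rmult_le_compat_r; auto.
    assert (m <= eps / (6 * K * exp 1)) by lra.
    apply Rmult_le_compat_l with (r := 6 * K * exp 1) in H; [|lra].
    replace (6 * K * exp 1 * (eps / (6 * K * exp 1))) with eps in H by (field; lra). auto.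
Qed.

(** * Integrals of complex-valued functions of a real variable *)

(** [C_R_CompleteNormedModule] is the complex plane as a real normed space, the structure in which
    [fcoef] integrates. *)
Definition CInt (f : R -> C) (a b : R) : C := RInt (V := C_R_CompleteNormedModule) f a b.
Notation ex_CInt := (ex_RInt (V := C_R_CompleteNormedModule)).
Notation is_CInt := (is_RInt (V := C_R_CompleteNormedModule)).

Lemma CInt_unique (f : R -> C) (a b : R) (l : C) : is_CInt f a b l -> CInt f a b = l.
Proof. apply (is_RInt_unique (V := C_R_CompleteNormedModule)). Qed.

Lemma CInt_correct (f : R -> C) (a b : R) : ex_CInt f a b -> is_CInt f a b (CInt f a b).
Proof. apply (RInt_correct (V := C_R_CompleteNormedModule)). Qed.

Definition RCcont (f : R -> C) (x : R) : Prop :=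
  forall eps, 0 < eps -> exists del, 0 < del /\
    forall u, Rabs (u - x) < del -> Cmod (f u - f x) < eps.

Lemma norm_CR (z : C) : norm (V := C_R_CompleteNormedModule) z = Cmod z.
Proof.
  unfold norm; simpl. unfold prod_norm. unfold norm; simpl. unfold abs; simpl.
  unfold Cmod. f_equal. rewrite <- !Rmult_assoc, <- !Rabs_mult.
  rewrite !Rmult_1_r, !Rabs_pos_eq by nra. simpl. ring.
Qed.

Lemma RCcont_continuous (f : R -> C) (x : R) :
  RCcont f x -> continuous (U := C_R_CompleteNormedModule) f x.
Proof.
  intros H P [e He]. destruct (H e (cond_pos e)) as [d [Hd H']].
  exists (mkposreal d Hd). intros u Hu. apply He.
  specialize (H' u Hu). split.
  - eapply Rle_lt_trans; [|apply H']. apply (Re_le_Cmod (f u - f x)).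
  - eapply Rle_lt_trans; [|apply H']. apply (Im_le_Cmod (f u - f x)).
Qed.

Lemma ex_CInt_cont (f : R -> C) (a b : R) :
  (forall x, Rmin a b <= x <= Rmax a b -> RCcont f x) -> ex_CInt f a b.
Proof. intros H. apply ex_RInt_continuous. intros z Hz. apply RCcont_continuous. auto. Qed.

Lemma CInt_bound (f : R -> C) (a b M : R) : a <= b -> ex_CInt f a b ->
  (forall x, a <= x <= b -> Cmod (f x) <= M) -> Cmod (CInt f a b) <= (b - a) * M.
Proof.
  intros Hab He H. rewrite <- norm_CR. apply (norm_RInt_le_const (V := C_R_CompleteNormedModule) f a b); auto.
  - intros x Hx. rewrite norm_CR. auto.
  - apply CInt_correct. auto.
Qed.

(** A complex number is not a scalar of the real normed space, so linearity over it has to be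
    recovered from the two components. *)
Lemma is_CInt_scal (c : C) (f : R -> C) (a b : R) (l : C) :
  is_CInt f a b l -> is_CInt (fun x => c * f x)%C a b (c * l)%C.
Proof.
  intros H.
  assert (H1 := is_RInt_fct_extend_fst (U := R_NormedModule) (V := R_NormedModule) f a b l H).
  assert (H2 := is_RInt_fct_extend_snd (U := R_NormedModule) (V := R_NormedModule) f a b l H).
  destruct c as [p q], l as [u v]. simpl in H1, H2.
  apply (is_RInt_fct_extend_pair (U := R_NormedModule) (V := R_NormedModule)); simpl.
  - apply (is_RInt_minus (V := R_NormedModule)); apply (is_RInt_scal (V := R_NormedModule)); auto.
  - apply (is_RInt_plus (V := R_NormedModule)); apply (is_RInt_scal (V := R_NormedModule)); auto.
Qed.

Lemma ex_CInt_scal (c : C) (f : R -> C) (a b : R) :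
  ex_CInt f a b -> ex_CInt (fun x => c * f x)%C a b.
Proof. intros [l H]. exists (c * l)%C. apply is_CInt_scal. auto. Qed.

Lemma CInt_scal (c : C) (f : R -> C) (a b : R) :
  ex_CInt f a b -> CInt (fun x => c * f x)%C a b = (c * CInt f a b)%C.
Proof.
  intros H. apply CInt_unique. apply is_CInt_scal. apply CInt_correct. auto.
Qed.

Lemma CInt_plus (f g : R -> C) (a b : R) : ex_CInt f a b -> ex_CInt g a b ->
  CInt (fun x => f x + g x)%C a b = (CInt f a b + CInt g a b)%C.
Proof. intros H H'. apply (RInt_plus (V := C_R_CompleteNormedModule)); auto. Qed.

Lemma ex_CInt_plus (f g : R -> C) (a b : R) : ex_CInt f a b -> ex_CInt g a b ->
  ex_CInt (fun x => f x + g x)%C a b.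
Proof. intros H H'. apply (ex_RInt_plus (V := C_R_CompleteNormedModule)); auto. Qed.

Lemma CInt_minus (f g : R -> C) (a b : R) : ex_CInt f a b -> ex_CInt g a b ->
  CInt (fun x => f x - g x)%C a b = (CInt f a b - CInt g a b)%C.
Proof. intros H H'. apply (RInt_minus (V := C_R_CompleteNormedModule)); auto. Qed.

Lemma ex_CInt_minus (f g : R -> C) (a b : R) : ex_CInt f a b -> ex_CInt g a b ->
  ex_CInt (fun x => f x - g x)%C a b.
Proof. intros H H'. apply (ex_RInt_minus (V := C_R_CompleteNormedModule)); auto. Qed.

Lemma CInt_ext (f g : R -> C) (a b : R) :
  (forall x, Rmin a b < x < Rmax a b -> f x = g x) -> CInt f a b = CInt g a b.
Proof. unfold CInt. apply (RInt_ext (V := C_R_CompleteNormedModule)). Qed.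

Lemma CInt_Chasles (f : R -> C) (a b c : R) : ex_CInt f a b -> ex_CInt f b c ->
  (CInt f a b + CInt f b c)%C = CInt f a c.
Proof. intros H H'. apply (RInt_Chasles (V := C_R_CompleteNormedModule)); auto. Qed.

Lemma CInt_const (c : C) (a b : R) : CInt (fun _ => c) a b = (RtoC (b - a) * c)%C.
Proof.
  unfold CInt. rewrite (RInt_const (V := C_R_CompleteNormedModule)). unfold scal; simpl. unfold prod_scal, scal; simpl. unfold mult; simpl.
  destruct c. apply injective_projections; simpl; ring.
Qed.

Lemma CInt_shift (f : R -> C) (h a b : R) : ex_CInt f (a + h) (b + h) ->
  CInt (fun x => f (x + h)) a b = CInt f (a + h) (b + h).
Proof.
  intros H.
  assert (E := RInt_comp_lin (V := C_R_CompleteNormedModule) f 1 h a b).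
  replace (1 * a + h) with (a + h) in E by ring. replace (1 * b + h) with (b + h) in E by ring.
  unfold CInt. rewrite <- E by auto. apply (RInt_ext (V := C_R_CompleteNormedModule)). intros x _.
  replace (1 * x + h) with (x + h) by ring. symmetry. apply (scal_one (V := C_R_CompleteNormedModule) (f (x + h))).
Qed.

Lemma CInt_comp_scal (f : R -> C) (u a b : R) : ex_CInt f (u * a) (u * b) -> u <> 0 ->
  CInt (fun x => f (u * x)) a b = (RtoC (/ u) * CInt f (u * a) (u * b))%C.
Proof.
  intros H Hu.
  assert (E := RInt_comp_lin (V := C_R_CompleteNormedModule) f u 0 a b).
  rewrite !Rplus_0_r in E. unfold CInt at 2. rewrite <- E by auto.
  assert (Hx : ex_CInt (fun y => scal u (f (u * y + 0))) a b).
  { apply (ex_RInt_comp_lin (V := C_R_CompleteNormedModule)). rewrite !Rplus_0_r. auto. }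
  etransitivity; [|apply (CInt_scal (RtoC (/ u)) _ a b Hx)]. apply CInt_ext. intros x _. rewrite Rplus_0_r.
  destruct (f (u * x)) as [p q]. unfold scal; simpl. unfold prod_scal, scal; simpl. unfold mult; simpl.
  apply injective_projections; simpl; field; auto.
Qed.

Lemma RCcont_ext (f g : R -> C) (x : R) : (forall u, f u = g u) -> RCcont f x -> RCcont g x.
Proof.
  intros E H eps He. destruct (H eps He) as [d [Hd H']]. exists d. split; auto.
  intros u Hu. rewrite <- !E. auto.
Qed.

Lemma Ccont_RCcont (f : C -> C) (z d : C) (x : R) :
  Ccont f (z + RtoC x * d) -> RCcont (fun u => f (z + RtoC u * d)%C) x.
Proof.
  intros H eps He. destruct (H eps He) as [e [Hpe H']].
  exists (e / (Cmod d + 1)). assert (h := Cmod_ge_0 d). split; [apply Rdiv_lt_0_compat; lra|].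
  intros u Hu. apply H'. replace (z + RtoC u * d - (z + RtoC x * d))%C with (RtoC (u - x) * d)%C
    by (rewrite RtoC_minus; ring).
  rewrite Cmod_mult, Cmod_R.
  apply Rle_lt_trans with (Rabs (u - x) * (Cmod d + 1)).
  - apply Rmult_le_compat_l; [apply Rabs_pos|lra].
  - apply Rmult_lt_compat_r with (r := Cmod d + 1) in Hu; [|lra].
    replace (e / (Cmod d + 1) * (Cmod d + 1)) with e in Hu by (field; lra). auto.
Qed.

Lemma hor_pt (x y : R) : ((RtoC y * Ci) + RtoC x * RtoC 1)%C = (x, y).
Proof. apply injective_projections; simpl; ring. Qed.

Lemma ver_pt (x y : R) : (RtoC x + RtoC y * Ci)%C = (x, y).
Proof. apply injective_projections; simpl; ring. Qed.

Lemma RCcont_hor (f : C -> C) (x y : R) : Ccont f (x, y) -> RCcont (fun u => f (u, y)) x.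
Proof.
  intros H. apply RCcont_ext with (f := fun u => f (RtoC y * Ci + RtoC u * RtoC 1)%C).
  - intros u. rewrite hor_pt. auto.
  - apply Ccont_RCcont. rewrite hor_pt. auto.
Qed.

Lemma RCcont_ver (f : C -> C) (x y : R) : Ccont f (x, y) -> RCcont (fun u => f (x, u)) y.
Proof.
  intros H. apply RCcont_ext with (f := fun u => f (RtoC x + RtoC u * Ci)%C).
  - intros u. rewrite ver_pt. auto.
  - apply Ccont_RCcont. rewrite ver_pt. auto.
Qed.

(** * Goursat's theorem on rectangles *)

Definition hint (f : C -> C) (y a b : R) : C := CInt (fun u => f (u, y)) a b.
Definition vint (f : C -> C) (x a b : R) : C := CInt (fun v => f (x, v)) a b.

(** The contour integral along the boundary, counterclockwise; on the vertical sides [dz = i dv]. *)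
Definition rect_int (f : C -> C) (x y w s : R) : C :=
  (hint f y x (x + w) + Ci * vint f (x + w) y (y + s)
   - hint f (y + s) x (x + w) - Ci * vint f x y (y + s))%C.

Definition in_rect (x y w s : R) (z : C) : Prop :=
  x <= Re z <= x + w /\ y <= Im z <= y + s.

Section RectangleIntegral.

Variables (f : C -> C) (X Y W S : R).
Hypothesis Hf : forall z, in_rect X Y W S z -> Ccont f z.

Lemma ex_hint (y a b : R) : X <= a <= X + W -> X <= b <= X + W -> Y <= y <= Y + S ->
  ex_CInt (fun u => f (u, y)) a b.
Proof.
  intros Ha Hb Hy. apply ex_CInt_cont. intros x Hx. apply RCcont_hor. apply Hf.
  unfold in_rect; simpl. revert Hx. unfold Rmin, Rmax. destruct (Rle_dec a b); lra.
Qed.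

Lemma ex_vint (x a b : R) : Y <= a <= Y + S -> Y <= b <= Y + S -> X <= x <= X + W ->
  ex_CInt (fun v => f (x, v)) a b.
Proof.
  intros Ha Hb Hy. apply ex_CInt_cont. intros y Hx. apply RCcont_ver. apply Hf.
  unfold in_rect; simpl. revert Hx. unfold Rmin, Rmax. destruct (Rle_dec a b); lra.
Qed.

Lemma rect_int_split (x y w s : R) : 0 <= w -> 0 <= s ->
  X <= x -> x + w <= X + W -> Y <= y -> y + s <= Y + S ->
  rect_int f x y w s =
  (rect_int f x y (w / 2) (s / 2) + rect_int f (x + w / 2) y (w / 2) (s / 2)
   + rect_int f x (y + s / 2) (w / 2) (s / 2)
   + rect_int f (x + w / 2) (y + s / 2) (w / 2) (s / 2))%C.
Proof.
  intros Hw Hs h1 h2 h3 h4. unfold rect_int.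
  replace (x + w / 2 + w / 2) with (x + w) by lra.
  replace (y + s / 2 + s / 2) with (y + s) by lra.
  unfold hint, vint.
  rewrite <- (CInt_Chasles (fun u => f (u, y)) x (x + w / 2) (x + w)) by (apply ex_hint; lra).
  rewrite <- (CInt_Chasles (fun u => f (u, y + s)) x (x + w / 2) (x + w)) by (apply ex_hint; lra).
  rewrite <- (CInt_Chasles (fun v => f (x, v)) y (y + s / 2) (y + s)) by (apply ex_vint; lra).
  rewrite <- (CInt_Chasles (fun v => f (x + w, v)) y (y + s / 2) (y + s)) by (apply ex_vint; lra).
  ring.
Qed.

(** If all four quarters had integrals of modulus below [e / 4], their sum would have modulus below
    [e]. *)
Lemma rect_int_step (x y w s e : R) : 0 <= w -> 0 <= s ->
  X <= x -> x + w <= X + W -> Y <= y -> y + s <= Y + S ->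
  e <= Cmod (rect_int f x y w s) ->
  exists x' y', (x' = x \/ x' = x + w / 2) /\ (y' = y \/ y' = y + s / 2) /\
    e / 4 <= Cmod (rect_int f x' y' (w / 2) (s / 2)).
Proof.
  intros Hw Hs h1 h2 h3 h4 He. rewrite rect_int_split in He by auto.
  set (a := rect_int f x y (w / 2) (s / 2)) in *.
  set (b := rect_int f (x + w / 2) y (w / 2) (s / 2)) in *.
  set (c := rect_int f x (y + s / 2) (w / 2) (s / 2)) in *.
  set (d := rect_int f (x + w / 2) (y + s / 2) (w / 2) (s / 2)) in *.
  assert (T1 := Cmod_triangle (a + b + c) d). assert (T2 := Cmod_triangle (a + b) c).
  assert (T3 := Cmod_triangle a b).
  destruct (Rle_lt_dec (e / 4) (Cmod a)); [exists x, y; auto|].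
  destruct (Rle_lt_dec (e / 4) (Cmod b)); [exists (x + w / 2), y; auto|].
  destruct (Rle_lt_dec (e / 4) (Cmod c)); [exists x, (y + s / 2); auto|].
  exists (x + w / 2), (y + s / 2). repeat split; auto. fold d. lra.
Qed.

End RectangleIntegral.

Lemma CInt_RtoC (a b : R) : CInt (fun u => RtoC u) a b = RtoC ((b * b - a * a) / 2).
Proof.
  apply CInt_unique.
  apply (is_RInt_fct_extend_pair (U := R_NormedModule) (V := R_NormedModule)); simpl.
  - replace ((b * b - a * a) / 2) with (minus (b * b / 2) (a * a / 2)).
    + apply (is_RInt_derive (V := R_CompleteNormedModule) (fun x => x * x / 2) (fun x => x)).
      * intros x _. auto_derive; auto. lra.
      * intros x _. apply continuous_id.
    + unfold minus, plus, opp; simpl. lra.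
  - assert (H := is_RInt_const (V := R_NormedModule) a b 0).
    unfold scal in H; simpl in H. unfold mult in H; simpl in H. rewrite Rmult_0_r in H. exact H.
Qed.

Lemma RCcont_RtoC (x : R) : RCcont (fun u => RtoC u) x.
Proof.
  intros eps He. exists eps. split; auto. intros u Hu. rewrite <- RtoC_minus, Cmod_R. auto.
Qed.

Lemma CInt_affine (p q : C) (a b : R) :
  CInt (fun u => p + q * RtoC u)%C a b = (p * RtoC (b - a) + q * RtoC ((b * b - a * a) / 2))%C.
Proof.
  assert (E : ex_CInt (fun u => RtoC u) a b) by (apply ex_CInt_cont; intros; apply RCcont_RtoC).
  rewrite CInt_plus.
  - rewrite CInt_scal by auto. rewrite CInt_RtoC, CInt_const. ring.
  - apply ex_RInt_const.
  - apply ex_CInt_scal. auto.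
Qed.

(** An explicit computation that takes the place of a primitive: in Goursat's argument the function
    is replaced by its affine approximation, whose contour integral has to be zero. *)
Lemma rect_int_affine (p q : C) (x y w s : R) : rect_int (fun z => p + q * z)%C x y w s = RtoC 0.
Proof.
  assert (H : forall y a b, hint (fun z => p + q * z)%C y a b =
     ((p + q * (RtoC y * Ci)) * RtoC (b - a) + q * RtoC ((b * b - a * a) / 2))%C).
  { intros. unfold hint. rewrite <- CInt_affine. apply CInt_ext. intros u _.
    replace ((u, y0) : C) with (RtoC u + RtoC y0 * Ci)%C by apply ver_pt. ring. }
  assert (V : forall x a b, vint (fun z => p + q * z)%C x a b =
     ((p + q * RtoC x) * RtoC (b - a) + (q * Ci) * RtoC ((b * b - a * a) / 2))%C).
  { intros. unfold vint. rewrite <- CInt_affine. apply CInt_ext. intros u _.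
    replace ((x0, u) : C) with (RtoC x0 + RtoC u * Ci)%C by apply ver_pt. ring. }
  unfold rect_int. rewrite !H, !V.
  destruct p as [p1 p2], q as [q1 q2].
  apply injective_projections; simpl; field.
Qed.

Lemma rect_int_minus (f g : C -> C) (x y w s : R) : 0 <= w -> 0 <= s ->
  (forall z, in_rect x y w s z -> Ccont f z) -> (forall z, in_rect x y w s z -> Ccont g z) ->
  rect_int (fun z => f z - g z)%C x y w s = (rect_int f x y w s - rect_int g x y w s)%C.
Proof.
  intros Hw Hs Hf Hg. unfold rect_int, hint, vint.
  rewrite (CInt_minus (fun u => f (u, y)) (fun u => g (u, y))),
    (CInt_minus (fun u => f (u, y + s)) (fun u => g (u, y + s))),
    (CInt_minus (fun v => f (x + w, v)) (fun v => g (x + w, v))),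
    (CInt_minus (fun v => f (x, v)) (fun v => g (x, v))).
  - ring.
  - apply (ex_vint f x y w s); auto; lra.
  - apply (ex_vint g x y w s); auto; lra.
  - apply (ex_vint f x y w s); auto; lra.
  - apply (ex_vint g x y w s); auto; lra.
  - apply (ex_hint f x y w s); auto; lra.
  - apply (ex_hint g x y w s); auto; lra.
  - apply (ex_hint f x y w s); auto; lra.
  - apply (ex_hint g x y w s); auto; lra.
Qed.

Lemma rect_int_bound (f : C -> C) (x y w s M : R) : 0 <= w -> 0 <= s ->
  (forall z, in_rect x y w s z -> Ccont f z) ->
  (forall z, in_rect x y w s z -> Cmod (f z) <= M) ->
  Cmod (rect_int f x y w s) <= 2 * (w + s) * M.
Proof.
  intros Hw Hs Hc Hb. unfold rect_int.
  assert (A : forall v, y <= v <= y + s -> Cmod (hint f v x (x + w)) <= w * M).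
  { intros v Hv. replace w with (x + w - x) at 2 by ring. apply CInt_bound; [lra| |].
    - apply (ex_hint f x y w s); auto; lra.
    - intros u Hu. apply Hb. split; simpl; lra. }
  assert (B : forall u, x <= u <= x + w -> Cmod (vint f u y (y + s)) <= s * M).
  { intros u Hu. replace s with (y + s - y) at 2 by ring. apply CInt_bound; [lra| |].
    - apply (ex_vint f x y w s); auto; lra.
    - intros v Hv. apply Hb. split; simpl; lra. }
  assert (A1 := A y ltac:(lra)). assert (A2 := A (y + s) ltac:(lra)).
  assert (B1 := B x ltac:(lra)). assert (B2 := B (x + w) ltac:(lra)).
  eapply Rle_trans; [apply Cmod_minus_le|]. rewrite Cmod_mult, Cmod_Ci.
  eapply Rle_trans; [apply Rplus_le_compat_r, Cmod_minus_le|].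
  eapply Rle_trans; [apply Rplus_le_compat_r, Rplus_le_compat_r, Cmod_triangle|].
  rewrite Cmod_mult, Cmod_Ci. lra.
Qed.

(** Nested intervals, each the left or the right half of the previous one; the common point is the
    supremum of the left ends. *)
Lemma halves_nested (x : nat -> R) (w : R) : 0 <= w ->
  (forall n, x (S n) = x n \/ x (S n) = x n + w / 2 ^ n / 2) ->
  exists u, forall n, x n <= u <= x n + w / 2 ^ n.
Proof.
  intros Hw H.
  assert (P : forall n, 0 <= w / 2 ^ n).
  { intros n. apply Rmult_le_pos; auto. left. apply Rinv_0_lt_compat. apply pow_lt. lra. }
  assert (E : forall n, w / 2 ^ (S n) = w / 2 ^ n / 2).
  { intros n. simpl. field. apply pow_nonzero. lra. }
  assert (N : forall n k, x n <= x (n + k)%nat /\ x (n + k)%nat + w / 2 ^ (n + k) <= x n + w / 2 ^ n).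
  { intros n. induction k as [|k IH].
    - rewrite Nat.add_0_r. lra.
    - rewrite Nat.add_succ_r. rewrite E. specialize (P (n + k)%nat).
      destruct (H (n + k)%nat) as [h|h]; rewrite h; lra. }
  destruct (completeness (fun r => exists n, r = x n)) as [u [Hu1 Hu2]].
  - exists (x O + w / 2 ^ 0). intros r [n ->]. destruct (N O n) as [_ h]. simpl in *.
    specialize (P n). lra.
  - exists (x O). exists O. auto.
  - exists u. intros n. split.
    + apply Hu1. exists n. auto.
    + apply Hu2. intros r [k ->]. destruct (Nat.le_gt_cases n k) as [h|h].
      * replace k with (n + (k - n))%nat by lia. destruct (N n (k - n)%nat) as [_ h'].
        specialize (P (n + (k - n))%nat). lra.
      * replace n with (k + (n - k))%nat by lia. destruct (N k (n - k)%nat) as [h' _].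
        specialize (P (k + (n - k))%nat). lra.
Qed.

(** Bisection produces squares of the subdivision whose integrals have modulus at least [eta / 4^n]
    and which shrink to a point. Near that point the function is affine up to [e] times the
    distance, so the same integral is at most perimeter times error, [2 T^2 e / 4^n] with
    [T = W + S]. The powers of 4 cancel and leave [eta <= 2 T^2 e]. *)
Theorem Goursat (f : C -> C) (X Y W S : R) : 0 <= W -> 0 <= S ->
  (forall z, in_rect X Y W S z -> exists l, Cder f z l) ->
  rect_int f X Y W S = RtoC 0.
Proof.
  intros HW HS Hf.
  assert (Hc : forall z, in_rect X Y W S z -> Ccont f z).
  { intros z Hz. destruct (Hf z Hz) as [l Hl]. apply (Cder_cont f z l). auto. }
  set (eta := Cmod (rect_int f X Y W S)).
  set (good := fun n (p : R * R) => X <= fst p /\ fst p + W / 2 ^ n <= X + W /\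
      Y <= snd p /\ snd p + S / 2 ^ n <= Y + S /\
      eta / 4 ^ n <= Cmod (rect_int f (fst p) (snd p) (W / 2 ^ n) (S / 2 ^ n))).
  assert (PW : forall n, 0 <= W / 2 ^ n).
  { intros n. apply Rmult_le_pos; auto. left. apply Rinv_0_lt_compat. apply pow_lt. lra. }
  assert (PS : forall n, 0 <= S / 2 ^ n).
  { intros n. apply Rmult_le_pos; auto. left. apply Rinv_0_lt_compat. apply pow_lt. lra. }
  assert (EE : forall t n, t / 2 ^ (Datatypes.S n) = t / 2 ^ n / 2).
  { intros t n. simpl. field. apply pow_nonzero. lra. }
  (* The hypothesis [good n p] stands inside the existential, so that the successor can be chosen as
     a total function of [n] and [p]. *)
  assert (step : forall n p, exists p', good n p ->
     good (Datatypes.S n) p' /\ (fst p' = fst p \/ fst p' = fst p + W / 2 ^ n / 2) /\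
     (snd p' = snd p \/ snd p' = snd p + S / 2 ^ n / 2)).
  { intros n [x y]. destruct (classic (good n (x, y))) as [G|G]; [|exists (x, y); intros; contradiction].
    destruct G as [g1 [g2 [g3 [g4 g5]]]]. simpl in g1, g2, g3, g4, g5.
    destruct (rect_int_step f X Y W S Hc x y (W / 2 ^ n) (S / 2 ^ n) (eta / 4 ^ n))
      as [x' [y' [Hx [Hy He]]]]; auto.
    exists (x', y'). intros _. unfold good. cbv beta iota delta [fst snd]. rewrite (EE W n), (EE S n).
    specialize (PW n). specialize (PS n).
    replace (eta / 4 ^ Datatypes.S n) with (eta / 4 ^ n / 4) by (simpl; field; apply pow_nonzero; lra).
    repeat split; auto; destruct Hx, Hy; subst; lra. }
  assert (ch : exists nx : nat -> R * R -> R * R, forall n p, good n p ->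
     good (Datatypes.S n) (nx n p) /\ (fst (nx n p) = fst p \/ fst (nx n p) = fst p + W / 2 ^ n / 2) /\
     (snd (nx n p) = snd p \/ snd (nx n p) = snd p + S / 2 ^ n / 2)).
  { exists (fun n p => proj1_sig (constructive_indefinite_description _ (step n p))).
    intros n p. destruct (constructive_indefinite_description _ (step n p)); auto. }
  destruct ch as [nx Hnx].
  set (sq := fix sq n := match n with O => (X, Y) | Datatypes.S n => nx n (sq n) end).
  assert (G : forall n, good n (sq n)).
  { induction n as [|n IH].
    - unfold good; simpl. replace (W / 1) with W by field. replace (S / 1) with S by field.
      unfold eta. repeat split; try lra.
    - apply Hnx. auto. }
  destruct (halves_nested (fun n => fst (sq n)) W HW) as [u Hu].
  { intros n. apply (Hnx n (sq n) (G n)). }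
  destruct (halves_nested (fun n => snd (sq n)) S HS) as [v Hv].
  { intros n. apply (Hnx n (sq n) (G n)). }
  assert (Hz : in_rect X Y W S (u, v)).
  { specialize (Hu O). specialize (Hv O). simpl in *. unfold in_rect; simpl. lra. }
  destruct (Hf _ Hz) as [l Hl].
  apply Cmod_small_0. fold eta. intros eps Heps.
  set (T := W + S). assert (HT : 0 <= T) by (unfold T; lra).
  (* Chosen so that [2 T^2 e <= eps]; the added 1 covers the degenerate rectangle [T = 0]. *)
  set (e := eps / (2 * T * T + 1)). assert (He : 0 < e) by (apply Rdiv_lt_0_compat; nra).
  assert (Hder := Hl). rewrite <- Cder_eps in Hder.
  destruct (Hder e He) as [d [Hd Hd']].
  assert (exists n, T / 2 ^ n < d) as [n Hn].
  { destruct (pow_lt_1_zero (/ 2) ltac:(rewrite Rabs_pos_eq; lra) (d / (T + 1))) as [n Hn].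
    - apply Rdiv_lt_0_compat; lra.
    - exists n. specialize (Hn n (le_n n)).
      rewrite <- RPow_abs, Rabs_pos_eq in Hn by lra. rewrite pow_inv in Hn.
      assert (P2 : 0 < / 2 ^ n) by (apply Rinv_0_lt_compat, pow_lt; lra).
      apply Rmult_lt_compat_r with (r := T + 1) in Hn; [|lra].
      replace (d / (T + 1) * (T + 1)) with d in Hn by (field; lra).
      unfold Rdiv. nra. }
  destruct (G n) as [g1 [g2 [g3 [g4 g5]]]].
  set (x := fst (sq n)) in *. set (y := snd (sq n)) in *.
  specialize (Hu n). specialize (Hv n). cbv beta in Hu, Hv. fold x in Hu. fold y in Hv.
  set (w := W / 2 ^ n) in *. set (s := S / 2 ^ n) in *.
  assert (Pw := PW n). assert (Ps := PS n). fold w in Pw. fold s in Ps.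
  assert (ET : w + s = T / 2 ^ n). { unfold w, s, T. field. apply pow_nonzero. lra. }
  set (aff := fun z : C => ((f (u, v) - l * (u, v)) + l * z)%C).
  assert (Haff : forall z, Ccont aff z).
  { intros z. apply Cder_cont with l. apply Cder_ext with (f := fun z => (l * z + (f (u, v) - l * (u, v)))%C).
    - intros; unfold aff; ring.
    - apply Cder_affine. }
  assert (Hsub : forall z, in_rect x y w s z -> in_rect X Y W S z).
  { unfold in_rect. intros z. lra. }
  assert (Er : rect_int f x y w s = rect_int (fun z => f z - aff z)%C x y w s).
  { rewrite rect_int_minus; auto. unfold aff at 1. rewrite rect_int_affine. ring. }
  assert (B : Cmod (rect_int f x y w s) <= 2 * (w + s) * (e * (w + s))).
  { rewrite Er. apply rect_int_bound; auto.
    - intros z Hz'. apply Ccont_ext_loc with (f := fun z => (f z + RtoC (-1) * aff z)%C) (r := 1);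
        [lra|intros; ring|].
      apply Ccont_plus; auto. apply Ccont_mult; auto. apply Ccont_const.
    - intros z Hz'. assert (M : Cmod (z - (u, v)) <= w + s).
      { eapply Rle_trans; [apply Cmod_le_abs|].
        destruct z as [a b]. destruct Hz' as [z1 z2]. simpl in *.
        apply Rplus_le_compat; apply Rabs_le; lra. }
      replace (f z - aff z)%C with (f z - f (u, v) - l * (z - (u, v)))%C by (unfold aff; ring).
      eapply Rle_trans; [apply Hd'; lra|]. apply Rmult_le_compat_l; lra. }
  rewrite ET in B.
  assert (P4 : 0 < 2 ^ n) by (apply pow_lt; lra).
  assert (E4 : 4 ^ n = 2 ^ n * 2 ^ n) by (rewrite <- Rpow_mult_distr; f_equal; lra).
  assert (Q : eta <= 2 * T * T * e).
  { assert (Q1 : eta / 4 ^ n <= 2 * (T / 2 ^ n) * (e * (T / 2 ^ n))) by lra.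
    apply Rmult_le_compat_r with (r := 4 ^ n) in Q1; [|rewrite E4; nra].
    replace (eta / 4 ^ n * 4 ^ n) with eta in Q1 by (field; rewrite E4; nra).
    replace (2 * (T / 2 ^ n) * (e * (T / 2 ^ n)) * 4 ^ n) with (2 * T * T * e) in Q1
      by (rewrite E4; field; lra). auto. }
  eapply Rle_trans; [apply Q|]. unfold e.
  apply Rmult_le_reg_r with (2 * T * T + 1); [nra|].
  replace (2 * T * T * (eps / (2 * T * T + 1)) * (2 * T * T + 1)) with (2 * T * T * eps) by (field; nra).
  nra.
Qed.

(** * Pointwise Fourier inversion *)

Definition e1 (r : R) : C := Cexp (RtoC (2 * PI * r) * Ci)%C.

Lemma e1_plus (a b : R) : e1 (a + b) = (e1 a * e1 b)%C.
Proof.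
  unfold e1. rewrite <- Cexp_plus. f_equal.
  rewrite Rmult_plus_distr_l, RtoC_plus. ring.
Qed.

Lemma e1_Z (n : Z) : e1 (IZR n) = RtoC 1.
Proof. apply Cexp_2PI_Z. Qed.

Lemma e1_0 : e1 0 = RtoC 1.
Proof. apply (e1_Z 0). Qed.

Lemma Cmod_e1 (r : R) : Cmod (e1 r) = 1.
Proof.
  unfold e1. rewrite Cmod_Cexp. simpl. replace (_ - _) with 0 by ring. apply exp_0.
Qed.

Lemma e1_half : e1 (/ 2) = RtoC (-1).
Proof.
  unfold e1, Cexp. simpl. replace (2 * PI * / 2 * 0 - 0 * 1) with 0 by field.
  replace (2 * PI * / 2 * 1 + 0 * 0) with PI by field.
  rewrite exp_0, cos_PI, sin_PI. apply injective_projections; simpl; ring.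
Qed.

Lemma e1_quarter : e1 (/ 4) = Ci.
Proof.
  unfold e1, Cexp. simpl. replace (2 * PI * / 4 * 0 - 0 * 1) with 0 by field.
  replace (2 * PI * / 4 * 1 + 0 * 0) with (PI / 2) by field.
  rewrite exp_0, cos_PI2, sin_PI2. apply injective_projections; simpl; ring.
Qed.

Lemma e1_eq_1 (r : R) : e1 r = RtoC 1 -> exists k : Z, r = IZR k.
Proof.
  intros H. assert (E := H). unfold e1, Cexp in E. simpl in E.
  replace (2 * PI * r * 0 - 0 * 1) with 0 in E by ring.
  replace (2 * PI * r * 1 + 0 * 0) with (2 * PI * r) in E by ring.
  rewrite exp_0, !Rmult_1_l in E. apply (f_equal snd) in E. simpl in E.
  apply sin_eq_0_0 in E. destruct E as [k Hk]. assert (HP := PI_RGT_0).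
  assert (Er : r = IZR k / 2).
  { apply Rmult_eq_reg_l with (2 * PI); [|lra]. rewrite Hk. field. }
  destruct (Z.Even_or_Odd k) as [[j ->]|[j ->]].
  - exists j. rewrite Er, mult_IZR. field.
  - exfalso. assert (E1 : r = IZR j + / 2) by (rewrite Er, plus_IZR, mult_IZR; field).
    rewrite E1, e1_plus, e1_Z, e1_half in H. apply (f_equal fst) in H. simpl in H. lra.
Qed.

(** Together with the converse below, this lets the continuity rules for functions of a complex
    variable be reused on the real line. *)
Lemma RCcont_of_Re (f : R -> C) (x : R) : Ccont (fun z => f (Re z)) (RtoC x) -> RCcont f x.
Proof.
  intros H. apply RCcont_ext with (f := fun u => f (Re (RtoC 0 + RtoC u * RtoC 1)%C)).
  - intros u. f_equal. simpl. ring.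
  - apply (Ccont_RCcont (fun z => f (Re z))). replace (RtoC 0 + RtoC x * RtoC 1)%C with (RtoC x) by ring. auto.
Qed.

Lemma RCcont_to_Re (f : R -> C) (z : C) : RCcont f (Re z) -> Ccont (fun z => f (Re z)) z.
Proof.
  intros H eps He. destruct (H eps He) as [d [Hd H']]. exists d. split; auto.
  intros w Hw. apply H'. eapply Rle_lt_trans; [|apply Hw]. apply (Re_le_Cmod (w - z)).
Qed.

Lemma RCcont_mult (f g : R -> C) (x : R) :
  RCcont f x -> RCcont g x -> RCcont (fun u => f u * g u)%C x.
Proof.
  intros Hf Hg. apply RCcont_of_Re.
  apply (Ccont_mult (fun z => f (Re z)) (fun z => g (Re z))); apply RCcont_to_Re; auto.
Qed.

Lemma RCcont_plus (f g : R -> C) (x : R) :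
  RCcont f x -> RCcont g x -> RCcont (fun u => f u + g u)%C x.
Proof.
  intros Hf Hg. apply RCcont_of_Re.
  apply (Ccont_plus (fun z => f (Re z)) (fun z => g (Re z))); apply RCcont_to_Re; auto.
Qed.

Lemma RCcont_inv (f : R -> C) (x : R) :
  RCcont f x -> f x <> RtoC 0 -> RCcont (fun u => / f u)%C x.
Proof.
  intros Hf Hx. apply RCcont_of_Re.
  apply (Ccont_inv (fun z => f (Re z))); [apply RCcont_to_Re; auto|auto].
Qed.

Lemma RCcont_const (c : C) (x : R) : RCcont (fun _ => c) x.
Proof. apply RCcont_of_Re. apply Ccont_const. Qed.

Lemma RCcont_comp_affine (f : R -> C) (a b x : R) :
  RCcont f (a * x + b) -> RCcont (fun u => f (a * u + b)) x.
Proof.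
  intros H eps He. destruct (H eps He) as [d [Hd H']].
  exists (d / (Rabs a + 1)). assert (h := Rabs_pos a). split; [apply Rdiv_lt_0_compat; lra|].
  intros u Hu. apply H'. replace (a * u + b - (a * x + b)) with ((u - x) * a) by ring.
  rewrite Rabs_mult. apply Rle_lt_trans with (Rabs (u - x) * (Rabs a + 1)).
  - apply Rmult_le_compat_l; [apply Rabs_pos|lra].
  - apply Rmult_lt_compat_r with (r := Rabs a + 1) in Hu; [|lra].
    replace (d / (Rabs a + 1) * (Rabs a + 1)) with d in Hu by (field; lra). auto.
Qed.

Lemma Ccont_Cexp (z : C) : Ccont Cexp z.
Proof. apply Cder_cont with (Cexp z). apply Cder_Cexp. Qed.

Lemma RCcont_e1 (x : R) : RCcont e1 x.
Proof.
  apply RCcont_ext with (f := fun u => Cexp (RtoC 0 + RtoC u * (RtoC (2 * PI) * Ci))%C).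
  - intros u. unfold e1. f_equal. apply injective_projections; simpl; ring.
  - apply Ccont_RCcont. apply Ccont_Cexp.
Qed.

Lemma RCcont_e1_scal (a x : R) : RCcont (fun u => e1 (a * u)) x.
Proof.
  apply RCcont_ext with (f := fun u => e1 (a * u + 0)); [intros u; rewrite Rplus_0_r; auto|].
  apply RCcont_comp_affine. apply RCcont_e1.
Qed.

Lemma ex_CInt_glob (f : R -> C) (a b : R) : (forall x, RCcont f x) -> ex_CInt f a b.
Proof. intros H. apply ex_CInt_cont. auto. Qed.

Lemma CInt_period (f : R -> C) (h : R) : (forall x, RCcont f x) -> (forall x, f (x + 1) = f x) ->
  CInt f h (h + 1) = CInt f 0 1.
Proof.
  intros Hc Hp. assert (E : forall a b, ex_CInt f a b) by (intros; apply ex_CInt_glob; auto).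
  assert (E1 : CInt f 1 (h + 1) = CInt f 0 h).
  { replace 1 with (0 + 1) at 1 by ring. rewrite <- CInt_shift by auto. apply CInt_ext. auto. }
  rewrite <- (CInt_Chasles f h 0 (h + 1)) by auto.
  rewrite <- (CInt_Chasles f 0 1 (h + 1)) by auto.
  rewrite E1. replace (CInt f h 0 + (CInt f 0 1 + CInt f 0 h))%C
    with (CInt f 0 1 + (CInt f 0 h + CInt f h 0))%C by ring.
  rewrite CInt_Chasles by auto.
  unfold CInt at 2. rewrite (RInt_point (V := C_R_CompleteNormedModule)).
  apply Cplus_0_r.
Qed.

Lemma RCcont_uniform (v : R -> C) (a b : R) : (forall x, RCcont v x) ->
  forall eps, 0 < eps -> exists d, 0 < d /\ forall x y, a <= x <= b -> a <= y <= b ->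
    Rabs (y - x) < d -> Cmod (v y - v x) <= eps.
Proof.
  intros Hv eps He.
  destruct (unifcont_1d (V := C_R_CompleteNormedModule) v a b) with (eps := mkposreal (eps / 2) ltac:(lra))
    as [d Hd].
  - intros x _. apply RCcont_continuous. auto.
  - exists d. split; [apply cond_pos|]. intros x y Hx Hy Hxy.
    specialize (Hd x y Hx Hy Hxy). apply NNPP in Hd. destruct Hd as [h1 h2].
    eapply Rle_trans; [apply Cmod_le_abs|].
    unfold ball in h1, h2; simpl in h1, h2. unfold AbsRing_ball, abs, minus, plus, opp in h1, h2; simpl in h1, h2.
    unfold Re, Im, Cminus, Cplus, Copp; simpl. lra.
Qed.

Definition fourier (u : R -> C) (n : Z) : C := CInt (fun x => u x * e1 (- IZR n * x))%C 0 1.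

Lemma RCcont_fourier_arg (u : R -> C) (n : Z) : (forall x, RCcont u x) ->
  forall x, RCcont (fun x => u x * e1 (- IZR n * x))%C x.
Proof. intros H x. apply RCcont_mult; auto. apply RCcont_e1_scal. Qed.

(** A shift by half a wavelength [h = 1 / (2 n)] changes the sign of the exponential, so twice the
    coefficient is the integral of [v x - v (x + h)] against it, which uniform continuity makes
    small. *)
Lemma riemann_lebesgue (v : R -> C) : (forall x, RCcont v x) -> (forall x, v (x + 1) = v x) ->
  forall eps, 0 < eps -> exists N, (0 < N)%Z /\ forall n, (N <= Z.abs n)%Z -> Cmod (fourier v n) <= eps.
Proof.
  intros Hc Hp eps He.
  (* The interval contains [x] and [x + h] for [x] in [[0, 1]], since [|h| <= 1/2]. *)
  destruct (RCcont_uniform v (-1) 2 Hc eps He) as [d [Hd Hu]].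
  exists (up (/ d) + 1)%Z.
  assert (Pd := Rinv_0_lt_compat d Hd). destruct (archimed (/ d)) as [Ar _].
  split. { apply lt_IZR. rewrite plus_IZR. lra. }
  intros n Hn.
  assert (Hn' : / d < Rabs (IZR n)).
  { rewrite <- abs_IZR. apply IZR_le in Hn. rewrite plus_IZR in Hn. lra. }
  assert (Hn1 : 1 <= Rabs (IZR n)).
  { rewrite <- abs_IZR. apply IZR_le in Hn. apply (IZR_le 1). apply le_IZR in Hn.
    assert (0 < up (/ d))%Z by (apply lt_IZR; lra). lia. }
  assert (Nz : IZR n <> 0). { intros E. rewrite E, Rabs_R0 in Hn1. lra. }
  set (h := / 2 * / IZR n).
  assert (Eh : Rabs h = / 2 * / Rabs (IZR n)).
  { unfold h. rewrite Rabs_mult, (Rabs_pos_eq (/ 2)), Rabs_inv by lra. auto. }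
  assert (Hinv : / Rabs (IZR n) < d).
  { rewrite <- (Rinv_inv d). apply Rinv_lt_contravar; auto. apply Rmult_lt_0_compat; lra. }
  assert (Hinv1 : / Rabs (IZR n) <= 1). { rewrite <- Rinv_1. apply Rinv_le_contravar; lra. }
  assert (Pinv : 0 < / Rabs (IZR n)) by (apply Rinv_0_lt_compat; lra).
  assert (Hhd : Rabs h < d) by lra. assert (Hh1 : Rabs h <= / 2) by lra.
  apply Rabs_le_between in Hh1.
  set (g := fun x => (v x * e1 (- IZR n * x))%C).
  assert (Hg : forall x, RCcont g x) by (apply RCcont_fourier_arg; auto).
  assert (Hgp : forall x, g (x + 1) = g x).
  { intros x. unfold g. rewrite Hp. f_equal.
    replace (- IZR n * (x + 1)) with (- IZR n * x + IZR (- n)) by (rewrite opp_IZR; ring).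
    rewrite e1_plus, e1_Z. ring. }
  assert (E2 : fourier v n = CInt (fun x => RtoC (-1) * (v (1 * x + h)%R * e1 (- IZR n * x)))%C 0 1).
  { unfold fourier. fold g. rewrite <- (CInt_period g h) by auto.
    replace h with (0 + h) at 1 by ring. replace (h + 1) with (1 + h) by ring.
    rewrite <- CInt_shift by (apply ex_CInt_glob; auto). apply CInt_ext. intros x _.
    unfold g. replace (- IZR n * (x + h)) with (- IZR n * x + - / 2) by (unfold h; field; auto).
    rewrite e1_plus. replace (e1 (- / 2)) with (RtoC (-1)).
    - rewrite Rmult_1_l. ring.
    - replace (- / 2) with (/ 2 + IZR (-1)) by lra. rewrite e1_plus, e1_Z, e1_half. ring. }
  assert (X1 : ex_CInt g 0 1) by (apply ex_CInt_glob; auto).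
  assert (X2 : ex_CInt (fun x => v (1 * x + h)%R * e1 (- IZR n * x))%C 0 1).
  { apply ex_CInt_glob. intros x. apply RCcont_mult.
    - apply RCcont_comp_affine. auto.
    - apply RCcont_e1_scal. }
  rewrite CInt_scal in E2 by auto.
  assert (E3 : (RtoC 2 * fourier v n)%C = CInt (fun x => g x - v (1 * x + h)%R * e1 (- IZR n * x))%C 0 1).
  { rewrite CInt_minus by auto. fold g in E2. unfold fourier at 1. fold g.
    replace (RtoC 2 * CInt g 0 1)%C with (CInt g 0 1 + fourier v n)%C by (unfold fourier; fold g; ring).
    rewrite E2 at 1. unfold g. ring. }
  assert (B : Cmod (RtoC 2 * fourier v n) <= (1 - 0) * eps).
  { rewrite E3. apply CInt_bound; [lra|apply ex_CInt_minus; auto|].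
    intros x Hx. unfold g.
    replace (v x * e1 (- IZR n * x) - v (1 * x + h)%R * e1 (- IZR n * x))%C
      with ((v x - v (1 * x + h)%R) * e1 (- IZR n * x))%C by ring.
    rewrite Cmod_mult, Cmod_e1, Rmult_1_r. apply Hu; try lra.
    replace (x - (1 * x + h)) with (- h) by ring. rewrite Rabs_Ropp. auto. }
  rewrite Cmod_mult, Cmod_R, Rabs_pos_eq in B by lra. assert (h0 := Cmod_ge_0 (fourier v n)). lra.
Qed.

Fixpoint sym_sum (a : Z -> C) (N : nat) : C :=
  match N with
  | O => a 0%Z
  | S N' => (sym_sum a N' + a (Z.of_nat N) + a (- Z.of_nat N)%Z)%C
  end.

Lemma sym_sum_ext (a b : Z -> C) (N : nat) : (forall n, a n = b n) -> sym_sum a N = sym_sum b N.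
Proof. intros H. induction N as [|N IH]; simpl; rewrite ?IH, ?H; auto. Qed.

Lemma sym_sum_telescope (a b : Z -> C) (c : C) (N : nat) :
  a 0%Z = (c + b (-1)%Z - b 0%Z)%C -> (forall n, n <> 0%Z -> a n = (b (n - 1)%Z - b n)%C) ->
  sym_sum a N = (c + b (- Z.of_nat N - 1)%Z - b (Z.of_nat N))%C.
Proof.
  intros H0 H. induction N as [|N IH].
  - simpl. rewrite H0. auto.
  - change (sym_sum a (S N)) with (sym_sum a N + a (Z.of_nat (S N)) + a (- Z.of_nat (S N))%Z)%C.
    rewrite IH, (H (Z.of_nat (S N))), (H (- Z.of_nat (S N))%Z) by lia.
    replace (Z.of_nat (S N) - 1)%Z with (Z.of_nat N) by lia.
    replace (- Z.of_nat N - 1)%Z with (- Z.of_nat (S N))%Z by lia. ring.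
Qed.

(** The half-wavelength shift again: the coefficient equals its own negative. *)
Lemma fourier_const (n : Z) : n <> 0%Z -> fourier (fun _ => RtoC 1) n = RtoC 0.
Proof.
  intros Hn. set (a := fourier (fun _ => RtoC 1) n).
  assert (Nz : IZR n <> 0) by (apply not_0_IZR; auto).
  set (h := / 2 * / IZR n). set (g := fun x => (RtoC 1 * e1 (- IZR n * x))%C).
  assert (Hg : forall x, RCcont g x) by (apply RCcont_fourier_arg; intros; apply RCcont_const).
  assert (E : a = (RtoC (-1) * a)%C).
  { unfold a, fourier. fold g. rewrite <- CInt_scal by (apply ex_CInt_glob; auto).
    rewrite <- (CInt_period g h); auto.
    - replace h with (0 + h) at 1 by ring. replace (h + 1) with (1 + h) by ring.
      rewrite <- CInt_shift by (apply ex_CInt_glob; auto). apply CInt_ext. intros x _.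
      unfold g. replace (- IZR n * (x + h)) with (- IZR n * x + - / 2) by (unfold h; field; auto).
      rewrite e1_plus. replace (e1 (- / 2)) with (RtoC (-1)); [ring|].
      replace (- / 2) with (/ 2 + IZR (-1)) by lra. rewrite e1_plus, e1_Z, e1_half. ring.
    - intros x. unfold g.
      replace (- IZR n * (x + 1)) with (- IZR n * x + IZR (- n)) by (rewrite opp_IZR; ring).
      rewrite e1_plus, e1_Z. ring. }
  destruct a as [p q]. apply injective_projections; simpl.
  - apply (f_equal fst) in E. simpl in E. lra.
  - apply (f_equal snd) in E. simpl in E. lra.
Qed.

(* Chernoff's argument: writing [u = u x0 + (e1 (x - x0) - 1) v] makes the
   Fourier series of [u] at [x0] telescope into Fourier coefficients of [v]. *)
Lemma fourier_inversion_aux (u v : R -> C) (x0 : R) :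
  (forall x, RCcont u x) -> (forall x, RCcont v x) -> (forall x, v (x + 1) = v x) ->
  (forall x, u x = (u x0 + (e1 (x - x0) - RtoC 1) * v x)%C) ->
  forall eps, 0 < eps -> exists N0, forall N, (N0 <= N)%nat ->
    Cmod (sym_sum (fun n => fourier u n * e1 (IZR n * x0))%C N - u x0) <= eps.
Proof.
  intros Hu Hv Hp He eps Heps.
  destruct (riemann_lebesgue v Hv Hp (eps / 2)) as [N0 [HN0 HN]]; [lra|].
  exists (Z.to_nat N0). intros N HNN.
  set (b := fun n => (fourier v n * e1 (IZR n * x0))%C).
  assert (K : forall n, (fourier u n * e1 (IZR n * x0))%C =
     (u x0 * (fourier (fun _ => RtoC 1) n * e1 (IZR n * x0)) + b (n - 1)%Z - b n)%C).
  { intros n.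
    assert (E : fourier u n = (u x0 * fourier (fun _ => RtoC 1) n + e1 (- x0) * fourier v (n - 1) - fourier v n)%C).
    { unfold fourier.
      assert (XV : forall m, ex_CInt (fun x => v x * e1 (- IZR m * x))%C 0 1)
        by (intros; apply ex_CInt_glob, RCcont_fourier_arg; auto).
      assert (X1 : ex_CInt (fun x => RtoC 1 * e1 (- IZR n * x))%C 0 1)
        by (apply ex_CInt_glob, RCcont_fourier_arg; intros; apply RCcont_const).
      rewrite <- !CInt_scal by auto.
      rewrite <- CInt_plus by (apply ex_CInt_scal; auto).
      rewrite <- CInt_minus by (auto; apply ex_CInt_plus; apply ex_CInt_scal; auto).
      apply CInt_ext. intros x _. rewrite (He x).
      replace (- IZR (n - 1) * x) with (- IZR n * x + x) by (rewrite minus_IZR; ring).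
      unfold Rminus. rewrite !e1_plus. ring. }
    rewrite E. unfold b. replace (IZR n * x0) with (IZR (n - 1) * x0 + x0) at 2 by (rewrite minus_IZR; ring).
    rewrite !e1_plus.
    assert (E0 : (e1 x0 * e1 (- x0))%C = RtoC 1) by (rewrite <- e1_plus, Rplus_opp_r; apply e1_0).
    replace (IZR n * x0) with (IZR (n - 1) * x0 + x0) by (rewrite minus_IZR; ring). rewrite e1_plus.
    transitivity (u x0 * (fourier (fun _ => RtoC 1) n * (e1 (IZR (n - 1) * x0) * e1 x0)) +
      (e1 x0 * e1 (- x0)) * (fourier v (n - 1) * e1 (IZR (n - 1) * x0)) - fourier v n * (e1 (IZR (n - 1) * x0) * e1 x0))%C;
      [ring|]. rewrite E0. ring. }
  rewrite (sym_sum_ext _ _ N K).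
  rewrite (sym_sum_telescope _ b (u x0)).
  - replace (u x0 + b (- Z.of_nat N - 1)%Z - b (Z.of_nat N) - u x0)%C
      with (b (- Z.of_nat N - 1)%Z - b (Z.of_nat N))%C by ring.
    eapply Rle_trans; [apply Cmod_minus_le|]. unfold b. rewrite !Cmod_mult, !Cmod_e1, !Rmult_1_r.
    assert (A1 := HN (- Z.of_nat N - 1)%Z ltac:(lia)). assert (A2 := HN (Z.of_nat N) ltac:(lia)). lra.
  - replace (fourier (fun _ => RtoC 1) 0) with (RtoC 1).
    + rewrite Rmult_0_l, e1_0. simpl (0 - 1)%Z. ring.
    + unfold fourier. rewrite (CInt_ext _ (fun _ => RtoC 1)).
      * rewrite CInt_const. replace (1 - 0) with 1 by ring. ring.
      * intros x _. replace (- 0 * x) with 0 by ring. rewrite e1_0. ring.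
  - intros n Hn. rewrite fourier_const by auto. ring.
Qed.

(** Differentiability at the single point [x0] makes the quotient of [g - g x0] by [e1 (x - x0) - 1]
    continuous there, hence on the whole line by periodicity; then [fourier_inversion_aux]
    applies. *)
Lemma fourier_inversion (g : C -> C) (y x0 : R) (l : C) :
  (forall x, Ccont g (x, y)) -> (forall x, g (x + 1, y) = g (x, y)) -> Cder g (x0, y) l ->
  forall eps, 0 < eps -> exists N0, forall N, (N0 <= N)%nat ->
    Cmod (sym_sum (fun n => fourier (fun x => g (x, y)) n * e1 (IZR n * x0))%C N - g (x0, y)) <= eps.
Proof.
  intros Hc Hp Hd.
  (* The derivative at [x0] of the denominator [e1 (x - x0)]. That it is nonzero gives the quotient
     a limit at [x0]. *)
  set (w0 := (RtoC (2 * PI) * Ci)%C).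
  assert (Hw0 : w0 <> RtoC 0).
  { apply Cmult_neq_0; [|apply Ci_nz]. intros E. apply RtoC_inj in E. assert (h := PI_RGT_0). lra. }
  set (E := fun z : C => Cexp (w0 * z + - (w0 * (x0, y)))%C).
  assert (HE : Cder E (x0, y) w0).
  { apply Cder_val with (Cexp (w0 * (x0, y) + - (w0 * (x0, y))) * w0)%C.
    - apply (Cder_comp (fun z => w0 * z + - (w0 * (x0, y)))%C Cexp).
      + apply Cder_affine.
      + apply Cder_Cexp.
    - replace (w0 * (x0, y) + - (w0 * (x0, y)))%C with (RtoC 0) by ring. rewrite Cexp_0. ring. }
  assert (Ee : forall x, E (x, y) = e1 (x - x0)).
  { intros x. unfold E, e1, w0. f_equal. apply injective_projections; simpl; ring. }
  destruct Hd as [p [Hpc [Hpl [r [Hr Hpe]]]]].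
  destruct HE as [q [Hqc [Hql [r' [Hr' Hqe]]]]].
  (* On [x0 + Z], where numerator and denominator both vanish, the value is the ratio of the two
     derivatives. *)
  set (v := fun x => if Ceq_dec (e1 (x - x0)) (RtoC 1) then (p (x0, y) / q (x0, y))%C
                     else ((g (x, y) - g (x0, y)) / (e1 (x - x0) - RtoC 1))%C).
  assert (Hpz : forall k x, g (x + IZR k, y) = g (x, y)).
  { assert (Hn : forall n x, g (x + INR n, y) = g (x, y)).
    { induction n as [|n IH]; intros x; [simpl; rewrite Rplus_0_r; auto|].
      rewrite S_INR. replace (x + (INR n + 1)) with ((x + INR n) + 1) by ring. rewrite Hp. apply IH. }
    intros k x. destruct (Z_le_gt_dec 0 k).
    - rewrite <- (Z2Nat.id k), <- INR_IZR_INZ by auto. apply Hn.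
    - rewrite <- (Hn (Z.to_nat (- k)) (x + IZR k)). f_equal. f_equal.
      rewrite INR_IZR_INZ, Z2Nat.id, opp_IZR by lia. ring. }
  assert (Hvz : forall k x, v (x + IZR k) = v x).
  { intros k x. unfold v. replace (x + IZR k - x0) with ((x - x0) + IZR k) by ring.
    rewrite e1_plus, e1_Z, Cmult_1_r, Hpz. auto. }
  assert (Hvc0 : RCcont v x0).
  { intros eps He.
    assert (Hq0 : q (x0, y) <> RtoC 0) by (rewrite Hql; auto).
    destruct (Ccont_neq0 q _ Hqc Hq0) as [d1 [Hd1 Hq1]].
    assert (Hpq : Ccont (fun z => p z * / q z)%C (x0, y)) by (apply Ccont_mult; auto; apply Ccont_inv; auto).
    destruct (Hpq eps He) as [d2 [Hd2 Hpq']].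
    exists (Rmin (Rmin r r') (Rmin d1 d2)). split; [repeat apply Rmin_pos; auto|].
    intros u Hu. assert (h1 := Rmin_l r r'). assert (h2 := Rmin_r r r').
    assert (h3 := Rmin_l d1 d2). assert (h4 := Rmin_r d1 d2).
    assert (h5 := Rmin_l (Rmin r r') (Rmin d1 d2)). assert (h6 := Rmin_r (Rmin r r') (Rmin d1 d2)).
    assert (Em : ((u, y) - (x0, y))%C = RtoC (u - x0)) by (apply injective_projections; simpl; ring).
    assert (Hm : Cmod ((u, y) - (x0, y)) = Rabs (u - x0)) by (rewrite Em, Cmod_R; auto).
    assert (V0 : v x0 = (p (x0, y) * / q (x0, y))%C).
    { unfold v. replace (x0 - x0) with 0 by ring. rewrite e1_0.
      destruct (Ceq_dec (RtoC 1) (RtoC 1)); [reflexivity|congruence]. }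
    rewrite V0. destruct (Req_dec u x0) as [->|N].
    { rewrite V0. replace (p (x0, y) * / q (x0, y) - p (x0, y) * / q (x0, y))%C with (RtoC 0) by ring.
      rewrite Cmod_0. auto. }
    assert (Q1 := Hq1 (u, y) ltac:(rewrite Hm; lra)).
    assert (Hqu : q (u, y) <> RtoC 0).
    { intros Eq. rewrite Eq, Cmod_0 in Q1. assert (h := Cmod_ge_0 (q (x0, y))). lra. }
    assert (Ex := Hqe (u, y) ltac:(rewrite Hm; lra)). rewrite !Ee, Em in Ex.
    replace (x0 - x0) with 0 in Ex by ring. rewrite e1_0 in Ex.
    assert (Gx := Hpe (u, y) ltac:(rewrite Hm; lra)). rewrite Em in Gx.
    assert (Nu : RtoC (u - x0) <> RtoC 0). { intros E0. apply RtoC_inj in E0. lra. }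
    assert (Vu : v u = (p (u, y) * / q (u, y))%C).
    { unfold v. destruct (Ceq_dec (e1 (u - x0)) (RtoC 1)) as [e|n].
      - exfalso. rewrite e in Ex. apply (Cmult_neq_0 _ _ Hqu Nu).
        replace (q (u, y) * RtoC (u - x0))%C with (RtoC 1 + q (u, y) * RtoC (u - x0) - RtoC 1)%C by ring.
        rewrite <- Ex. ring.
      - rewrite Gx, Ex. field. repeat split; auto.
        replace (RtoC 1 + q (u, y) * RtoC (u - x0) - RtoC 1)%C with (q (u, y) * RtoC (u - x0))%C by ring.
        apply Cmult_neq_0; auto. }
    rewrite Vu. apply Hpq'. rewrite Hm. lra. }
  (* At a translate of [x0] periodicity moves the question back to [x0]; elsewhere the denominator
     is nonzero at [x] and, by continuity, near it. *)
  assert (Hvc : forall x, RCcont v x).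
  { intros x. destruct (Ceq_dec (e1 (x - x0)) (RtoC 1)) as [e|n].
    - destruct (e1_eq_1 _ e) as [k Hk].
      apply RCcont_ext with (f := fun u => v (1 * u + - IZR k)).
      + intros u. rewrite <- opp_IZR, Hvz, Rmult_1_l. auto.
      + apply RCcont_comp_affine. replace (1 * x + - IZR k) with x0 by lra. auto.
    - assert (Hc1 : RCcont (fun u => e1 (u - x0) - RtoC 1)%C x).
      { apply RCcont_plus; [|apply RCcont_const].
        apply RCcont_ext with (f := fun u => e1 (1 * u + - x0)); [intros u; rewrite Rmult_1_l; auto|].
        apply RCcont_comp_affine, RCcont_e1. }
      assert (Hc2 : RCcont (fun u => (g (u, y) - g (x0, y)) / (e1 (u - x0) - RtoC 1))%C x).
      { apply RCcont_mult.
        - apply RCcont_plus; [|apply RCcont_const]. apply RCcont_hor. auto.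
        - apply RCcont_inv; auto. apply Cminus_eq_contra. auto. }
      assert (Nz : (e1 (x - x0) - RtoC 1)%C <> RtoC 0) by (apply Cminus_eq_contra; auto).
      assert (Pz := proj1 (Cmod_gt_0 _) Nz).
      intros eps He. destruct (Hc1 _ Pz) as [d1 [Hd1 H1]]. destruct (Hc2 eps He) as [d2 [Hd2 H2]].
      exists (Rmin d1 d2). split; [apply Rmin_pos; auto|]. intros u Hu.
      assert (h1 := Rmin_l d1 d2). assert (h2 := Rmin_r d1 d2).
      unfold v. destruct (Ceq_dec (e1 (x - x0)) (RtoC 1)); [contradiction|].
      destruct (Ceq_dec (e1 (u - x0)) (RtoC 1)) as [e|n'].
      + exfalso. specialize (H1 u ltac:(lra)). rewrite e in H1.
        replace (RtoC 1 - RtoC 1 - (e1 (x - x0) - RtoC 1))%C with (- (e1 (x - x0) - RtoC 1))%C in H1 by ring.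
        rewrite Cmod_opp in H1. lra.
      + apply H2. lra. }
  apply (fourier_inversion_aux (fun x => g (x, y)) v x0).
  - intros x. apply RCcont_hor. auto.
  - auto.
  - intros x. apply (Hvz 1%Z).
  - intros x. unfold v. destruct (Ceq_dec (e1 (x - x0)) (RtoC 1)) as [e|n].
    + rewrite e. destruct (e1_eq_1 _ e) as [k Hk].
      replace x with (x0 + IZR k) by lra. rewrite Hpz. ring.
    + field. apply Cminus_eq_contra. auto.
Qed.

(** * Absolutely convergent complex series *)

(** Componentwise, in agreement with the way [theta] is written. *)
Definition Cseries (u : nat -> C) : C :=
  (Series (fun n => Re (u n)), Series (fun n => Im (u n))).

Definition abs_sum (u : nat -> C) : Prop := ex_series (fun n => Cmod (u n)).

Fixpoint csum (u : nat -> C) (N : nat) : C :=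
  match N with O => RtoC 0 | S n => (csum u n + u n)%C end.

Lemma csum_ext (u v : nat -> C) (N : nat) : (forall k, (k < N)%nat -> u k = v k) -> csum u N = csum v N.
Proof.
  induction N as [|N IH]; intros H; simpl; auto.
  rewrite IH, H; auto.
Qed.

Lemma csum_head (u : nat -> C) (N : nat) : csum u (S N) = (u O + csum (fun k => u (S k)) N)%C.
Proof.
  induction N as [|N IH]; [simpl; ring|].
  change (csum u (S (S N))) with (csum u (S N) + u (S N))%C. rewrite IH. simpl. ring.
Qed.

Lemma csum_add (u : nat -> C) (j p : nat) :
  csum u (j + p) = (csum u j + csum (fun k => u (j + k)%nat) p)%C.
Proof.
  induction p as [|p IH].
  - rewrite Nat.add_0_r. simpl. ring.
  - rewrite Nat.add_succ_r. simpl. rewrite IH. ring.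
Qed.

Lemma csum_zero (u : nat -> C) (N : nat) : (forall k, (k < N)%nat -> u k = RtoC 0) -> csum u N = RtoC 0.
Proof.
  induction N as [|N IH]; intros H; simpl; auto. rewrite IH, H by auto. ring.
Qed.

Lemma abs_sum_le (u : nat -> C) (b : nat -> R) :
  (forall n, Cmod (u n) <= b n) -> ex_series b -> abs_sum u.
Proof.
  intros H Hb. apply (ex_series_le (V := R_CompleteNormedModule)) with b; auto.
  intros n. unfold norm; simpl. unfold abs; simpl. rewrite Rabs_pos_eq by apply Cmod_ge_0. auto.
Qed.

Lemma ex_series_le_R (a b : nat -> R) : (forall n, 0 <= a n <= b n) -> ex_series b -> ex_series a.
Proof.
  intros H Hb. apply (ex_series_le (V := R_CompleteNormedModule)) with b; auto.
  intros n. unfold norm; simpl. unfold abs; simpl. rewrite Rabs_pos_eq; apply H.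
Qed.

Lemma Series_nonneg (b : nat -> R) : (forall n, 0 <= b n) -> ex_series b -> 0 <= Series b.
Proof.
  intros H Hb. assert (L := Series_le (fun n => 0 * b n) b). rewrite Series_scal_l, Rmult_0_l in L.
  apply L; auto. intros n. specialize (H n). lra.
Qed.

Lemma abs_sum_Re (u : nat -> C) : abs_sum u -> ex_series (fun n => Rabs (Re (u n))).
Proof.
  intros H. apply ex_series_le_R with (2 := H). intros n. split; [apply Rabs_pos|apply Re_le_Cmod].
Qed.

Lemma abs_sum_Im (u : nat -> C) : abs_sum u -> ex_series (fun n => Rabs (Im (u n))).
Proof.
  intros H. apply ex_series_le_R with (2 := H). intros n. split; [apply Rabs_pos|apply Im_le_Cmod].
Qed.

Lemma Cseries_ext (u v : nat -> C) : (forall n, u n = v n) -> Cseries u = Cseries v.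
Proof.
  intros H. unfold Cseries. f_equal; apply Series_ext; intros n; rewrite H; auto.
Qed.

Lemma abs_sum_ext (u v : nat -> C) : (forall n, u n = v n) -> abs_sum u -> abs_sum v.
Proof. intros H. apply ex_series_ext. intros n. rewrite H. auto. Qed.

Lemma Cseries_plus (u v : nat -> C) : abs_sum u -> abs_sum v ->
  Cseries (fun n => u n + v n)%C = (Cseries u + Cseries v)%C.
Proof.
  intros Hu Hv. unfold Cseries. apply injective_projections; simpl.
  - apply Series_plus; apply ex_series_Rabs, abs_sum_Re; auto.
  - apply Series_plus; apply ex_series_Rabs, abs_sum_Im; auto.
Qed.

Lemma abs_sum_plus (u v : nat -> C) : abs_sum u -> abs_sum v -> abs_sum (fun n => u n + v n)%C.
Proof.
  intros Hu Hv. apply abs_sum_le with (fun n => Cmod (u n) + Cmod (v n)).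
  - intros n. apply Cmod_triangle.
  - apply (ex_series_plus (V := R_NormedModule)); auto.
Qed.

Lemma abs_sum_scal (c : C) (u : nat -> C) : abs_sum u -> abs_sum (fun n => c * u n)%C.
Proof.
  intros Hu. apply abs_sum_le with (fun n => Cmod c * Cmod (u n)).
  - intros n. rewrite Cmod_mult. lra.
  - apply (ex_series_scal (V := R_NormedModule)). auto.
Qed.

Lemma Cseries_scal (c : C) (u : nat -> C) : abs_sum u -> Cseries (fun n => c * u n)%C = (c * Cseries u)%C.
Proof.
  intros Hu. assert (H1 := ex_series_Rabs _ (abs_sum_Re u Hu)). assert (H2 := ex_series_Rabs _ (abs_sum_Im u Hu)).
  assert (S : forall k a, ex_series (V := R_NormedModule) a -> ex_series (fun n => k * a n)).
  { intros k a Ha. apply (ex_series_scal (V := R_NormedModule) k a Ha). }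
  destruct c as [p q]. unfold Cseries. apply injective_projections; simpl.
  - rewrite <- !Series_scal_l, <- Series_minus by (apply S; auto). auto.
  - rewrite <- !Series_scal_l, <- Series_plus by (apply S; auto). auto.
Qed.

(** Real and imaginary parts are bounded separately; this is the origin of the factor 2 in the later
    numerical bounds. *)
Lemma Cmod_Cseries (u : nat -> C) : abs_sum u -> Cmod (Cseries u) <= 2 * Series (fun n => Cmod (u n)).
Proof.
  intros Hu. eapply Rle_trans; [apply Cmod_le_abs|]. unfold Cseries; simpl.
  assert (A : Rabs (Series (fun n => Re (u n))) <= Series (fun n => Cmod (u n))).
  { eapply Rle_trans; [apply Series_Rabs, abs_sum_Re; auto|]. apply Series_le; auto.
    intros n. split; [apply Rabs_pos|apply Re_le_Cmod]. }
  assert (B : Rabs (Series (fun n => Im (u n))) <= Series (fun n => Cmod (u n))).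
  { eapply Rle_trans; [apply Series_Rabs, abs_sum_Im; auto|]. apply Series_le; auto.
    intros n. split; [apply Rabs_pos|apply Im_le_Cmod]. }
  lra.
Qed.

Lemma Cmod_Cseries_le (u : nat -> C) (b : nat -> R) : (forall n, Cmod (u n) <= b n) -> ex_series b ->
  Cmod (Cseries u) <= 2 * Series b.
Proof.
  intros H Hb. eapply Rle_trans; [apply Cmod_Cseries; apply abs_sum_le with b; auto|].
  apply Rmult_le_compat_l; [lra|]. apply Series_le; auto. intros n. split; [apply Cmod_ge_0|auto].
Qed.

Lemma csum_lim (u : nat -> C) : abs_sum u ->
  forall eps, 0 < eps -> exists N0, forall N, (N0 <= N)%nat -> Cmod (csum u N - Cseries u) <= eps.
Proof.
  intros Hu eps He.
  assert (Es : forall (p : C -> R) N, (forall a b : C, p (a + b)%C = p a + p b) -> p (RtoC 0) = 0 ->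
     p (csum u (S N)) = sum_n (fun n => p (u n)) N).
  { intros p N Hp H0. induction N as [|N IH].
    - simpl. rewrite sum_O, Hp, H0. ring.
    - rewrite sum_Sn. rewrite <- IH. simpl csum. rewrite !Hp. reflexivity. }
  assert (L1 := Series_correct _ (ex_series_Rabs _ (abs_sum_Re u Hu))).
  assert (L2 := Series_correct _ (ex_series_Rabs _ (abs_sum_Im u Hu))).
  unfold is_series in L1, L2.
  assert (P : 0 < eps / 2) by lra.
  destruct (proj1 (filterlim_locally _ _) L1 (mkposreal _ P)) as [N1 H1].
  destruct (proj1 (filterlim_locally _ _) L2 (mkposreal _ P)) as [N2 H2].
  exists (S (N1 + N2)). intros N HN. destruct N as [|N]; [lia|].
  specialize (H1 N ltac:(lia)). specialize (H2 N ltac:(lia)).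
  unfold ball in H1, H2; simpl in H1, H2. unfold AbsRing_ball, abs, minus, plus, opp in H1, H2; simpl in H1, H2.
  rewrite <- (Es Re) in H1 by auto. rewrite <- (Es Im) in H2 by auto.
  eapply Rle_trans; [apply Cmod_le_abs|].
  unfold Cminus, Cplus, Copp, Cseries, Re, Im in *. simpl fst. simpl snd. simpl fst in H1. simpl snd in H2. lra.
Qed.

Lemma Cseries_unique (u : nat -> C) (l : C) : abs_sum u ->
  (forall eps, 0 < eps -> exists N0, forall N, (N0 <= N)%nat -> Cmod (csum u N - l) <= eps) ->
  Cseries u = l.
Proof.
  intros Hu H. cut ((Cseries u - l)%C = RtoC 0).
  { intros E. rewrite <- (Cplus_0_r l), <- E. ring. }
  apply Cmod_small_0. intros eps He.
  destruct (H (eps / 2)) as [N1 H1]; [lra|]. destruct (csum_lim u Hu (eps / 2)) as [N2 H2]; [lra|].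
  specialize (H1 (N1 + N2)%nat ltac:(lia)). specialize (H2 (N1 + N2)%nat ltac:(lia)).
  replace (Cseries u - l)%C with ((csum u (N1 + N2) - l) - (csum u (N1 + N2) - Cseries u))%C by ring.
  eapply Rle_trans; [apply Cmod_minus_le|]. lra.
Qed.

Lemma Cseries_incr_1 (u : nat -> C) : abs_sum u -> Cseries u = (u O + Cseries (fun k => u (S k)))%C.
Proof.
  intros Hu. unfold Cseries. apply injective_projections; simpl.
  - rewrite (Series_incr_1 (fun n => Re (u n))); auto. apply ex_series_Rabs, abs_sum_Re; auto.
  - rewrite (Series_incr_1 (fun n => Im (u n))); auto. apply ex_series_Rabs, abs_sum_Im; auto.
Qed.

Lemma abs_sum_incr_1 (u : nat -> C) : abs_sum u -> abs_sum (fun k => u (S k)).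
Proof. intros H. apply (ex_series_incr_1 (fun n => Cmod (u n))). auto. Qed.

Lemma Cseries_even_odd (u : nat -> C) : abs_sum u -> abs_sum (fun k => u (2 * k)%nat) ->
  abs_sum (fun k => u (2 * k + 1)%nat) ->
  Cseries u = (Cseries (fun k => u (2 * k)%nat) + Cseries (fun k => u (2 * k + 1)%nat))%C.
Proof.
  intros Hu He Ho.
  assert (E : forall N, csum u (2 * N) = (csum (fun k => u (2 * k)%nat) N + csum (fun k => u (2 * k + 1)%nat) N)%C).
  { induction N as [|N IH]; [simpl; ring|].
    replace (2 * S N)%nat with (S (S (2 * N))) by lia.
    change (csum u (S (S (2 * N)))) with (csum u (2 * N) + u (2 * N)%nat + u (S (2 * N)))%C. rewrite IH.
    change (csum (fun k => u (2 * k)%nat) (S N)) with (csum (fun k => u (2 * k)%nat) N + u (2 * N)%nat)%C.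
    change (csum (fun k => u (2 * k + 1)%nat) (S N)) with (csum (fun k => u (2 * k + 1)%nat) N + u (2 * N + 1)%nat)%C.
    replace (2 * N + 1)%nat with (S (2 * N)) by lia. ring. }
  cut ((Cseries u - (Cseries (fun k => u (2 * k)%nat) + Cseries (fun k => u (2 * k + 1)%nat)))%C = RtoC 0).
  { intros E0. apply Ceq_minus. auto. }
  apply Cmod_small_0. intros eps Heps.
  destruct (csum_lim u Hu (eps / 3)) as [N1 H1]; [lra|].
  destruct (csum_lim _ He (eps / 3)) as [N2 H2]; [lra|].
  destruct (csum_lim _ Ho (eps / 3)) as [N3 H3]; [lra|].
  set (N := (N1 + N2 + N3)%nat). specialize (H1 (2 * N)%nat ltac:(lia)).
  specialize (H2 N ltac:(lia)). specialize (H3 N ltac:(lia)). rewrite E in H1.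
  match goal with |- Cmod ?x <= _ => replace x with
    ((csum (fun k => u (2 * k)%nat) N - Cseries (fun k => u (2 * k)%nat)) +
     (csum (fun k => u (2 * k + 1)%nat) N - Cseries (fun k => u (2 * k + 1)%nat)) -
     (csum (fun k => u (2 * k)%nat) N + csum (fun k => u (2 * k + 1)%nat) N - Cseries u))%C by ring end.
  eapply Rle_trans; [apply Cmod_minus_le|].
  eapply Rle_trans; [apply Rplus_le_compat_r, Cmod_triangle|]. lra.
Qed.

(** The majorant [b] makes the tail after [N] terms uniformly small on [[p, q]], so the integrals of
    the partial sums converge to the integral of the sum. *)
Lemma Cseries_CInt (u : nat -> R -> C) (b : nat -> R) (p q : R) : p <= q ->
  (forall n x, RCcont (u n) x) -> ex_CInt (fun x => Cseries (fun n => u n x)) p q ->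
  (forall n x, p <= x <= q -> Cmod (u n x) <= b n) -> ex_series b ->
  Cseries (fun n => CInt (u n) p q) = CInt (fun x => Cseries (fun n => u n x)) p q.
Proof.
  intros Hpq Hc Hx Hb Hs.
  assert (Hb0 : forall n, 0 <= b n).
  { intros n. eapply Rle_trans; [apply Cmod_ge_0|]. apply (Hb n p). lra. }
  assert (Hcs : forall N x, RCcont (fun x => csum (fun n => u n x) N) x).
  { induction N as [|N IH]; intros x; simpl; [apply RCcont_const|]. apply RCcont_plus; auto. }
  apply Cseries_unique.
  - apply abs_sum_le with (fun n => (q - p) * b n).
    + intros n. apply CInt_bound; auto. apply ex_CInt_glob. auto.
    + apply (ex_series_scal (V := R_NormedModule)). auto.
  - intros eps He.
    assert (Hlim : exists N0, forall N, (N0 <= N)%nat -> 2 * Series (fun k => b (N + k)%nat) <= eps / (q - p + 1)).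
    { assert (L := Series_correct _ Hs). unfold is_series in L.
      assert (P : 0 < eps / (q - p + 1) / 2) by (apply Rdiv_lt_0_compat; [apply Rdiv_lt_0_compat|]; lra).
      destruct (proj1 (filterlim_locally _ _) L (mkposreal _ P)) as [N1 H1].
      exists (S N1). intros N HN. destruct N as [|N]; [lia|].
      specialize (H1 N ltac:(lia)).
      unfold ball in H1; simpl in H1. unfold AbsRing_ball, abs, minus, plus, opp in H1; simpl in H1.
      rewrite (Series_incr_n b (S N)), <- sum_n_Reals in H1 by first [exact Hs | apply Nat.lt_0_succ]. simpl Init.Nat.pred in H1.
      apply Rabs_lt_between in H1. simpl in H1.
      assert (Q : forall A D e : R, - (e / 2) < A + - (A + D) < e / 2 -> 2 * D <= e) by (intros; lra).
      apply (Q (sum_n b N)). exact H1. }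
    destruct Hlim as [N0 HN0]. exists N0. intros N HN. specialize (HN0 N HN).
    assert (E : csum (fun n => CInt (u n) p q) N = CInt (fun x => csum (fun n => u n x) N) p q).
    { clear HN HN0. induction N as [|N IH].
      - simpl. rewrite CInt_const. ring.
      - simpl. rewrite IH, CInt_plus; auto; apply ex_CInt_glob; auto. }
    rewrite E, <- CInt_minus by (auto; apply ex_CInt_glob; auto).
    apply Rle_trans with ((q - p) * (eps / (q - p + 1))).
    + apply CInt_bound; auto.
      * apply ex_CInt_minus; auto. apply ex_CInt_glob. auto.
      * intros x Hxx. eapply Rle_trans; [|apply HN0].
        assert (Hab : abs_sum (fun n => u n x)) by (apply abs_sum_le with b; auto).
        assert (Et : Cseries (fun n => u n x) = (csum (fun n => u n x) N + Cseries (fun k => u (N + k)%nat x))%C).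
        { clear HN HN0 E. induction N as [|N IH].
          - simpl. rewrite Cplus_0_l. reflexivity.
          - rewrite IH. rewrite (Cseries_incr_1 (fun k => u (N + k)%nat x)).
            + simpl. rewrite Nat.add_0_r.
              rewrite (Cseries_ext (fun k => u (N + S k)%nat x) (fun k => u (S (N + k)) x)); [ring|].
              intros n. rewrite Nat.add_succ_r. auto.
            + apply abs_sum_le with (fun k => b (N + k)%nat); auto. apply ex_series_incr_n. auto. }
        rewrite Et. match goal with |- Cmod ?z <= _ => replace z with (- Cseries (fun k => u (N + k)%nat x))%C by ring end.
        rewrite Cmod_opp. apply Cmod_Cseries_le.
        { intros k. apply Hb. auto. }
        apply ex_series_incr_n. auto.
    + apply Rmult_le_reg_r with (q - p + 1); [lra|].
      replace ((q - p) * (eps / (q - p + 1)) * (q - p + 1)) with ((q - p) * eps) by (field; lra). nra.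
Qed.

(** * Series of exponentials *)

Definition exp_series (c al : nat -> C) (z : C) : C := Cseries (fun n => c n * Cexp (al n * z))%C.

(** Absolute summability on the disc of radius [d] around [z]: there [|Cexp (al n * w)|] is at most
    [|Cexp (al n * z)| exp (|al n| d)]. *)
Definition exp_sum (c al : nat -> C) (z : C) (d : R) : Prop :=
  ex_series (fun n => Cmod (c n) * Cmod (Cexp (al n * z)) * exp (Cmod (al n) * d)).

(** The Taylor bound is applied to each term with increment [al n * (w - z)]. The resulting factor
    [|al n|^2] is absorbed by part of the exponential [exp (|al n| d)], which leaves a summable
    multiple of [|w - z|^2]. *)
Lemma exp_series_der (c al : nat -> C) (z : C) (d : R) : 0 < d -> exp_sum c al z d ->
  Cder (exp_series c al) z (exp_series (fun n => c n * al n)%C al z).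
Proof.
  intros Hd Hs. set (b := fun n => Cmod (c n) * Cmod (Cexp (al n * z)) * exp (Cmod (al n) * d)) in *.
  assert (Hb0 : forall n, 0 <= Cmod (c n) * Cmod (Cexp (al n * z))).
  { intros n. apply Rmult_le_pos; apply Cmod_ge_0. }
  assert (Hb : forall n k, k <= d -> Cmod (c n) * Cmod (Cexp (al n * z)) * exp (Cmod (al n) * k) <= b n).
  { intros n k Hk. apply Rmult_le_compat_l; auto. apply exp_le_inc.
    apply Rmult_le_compat_l; auto. apply Cmod_ge_0. }
  assert (S0 : forall w, Cmod (w - z) <= d -> abs_sum (fun n => c n * Cexp (al n * w))%C).
  { intros w Hw. apply abs_sum_le with b; auto. intros n.
    replace (Cexp (al n * w)) with (Cexp (al n * z) * Cexp (al n * (w - z)))%C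
      by (rewrite <- Cexp_plus; f_equal; ring).
    rewrite !Cmod_mult, <- Rmult_assoc.
    eapply Rle_trans; [|apply (Hb n (Cmod (w - z))); auto].
    apply Rmult_le_compat_l; auto. rewrite Cmod_Cexp. apply exp_le_inc.
    rewrite <- Cmod_mult. eapply Rle_trans; [apply Rle_abs|apply Re_le_Cmod]. }
  assert (S1 : abs_sum (fun n => c n * al n * Cexp (al n * z))%C).
  { apply abs_sum_le with (fun n => / d * b n).
    - intros n. rewrite !Cmod_mult. unfold b.
      assert (h := exp_ge_1x (Cmod (al n) * d)).
      replace (Cmod (c n) * Cmod (al n) * Cmod (Cexp (al n * z)))
        with (/ d * (Cmod (c n) * Cmod (Cexp (al n * z)) * (Cmod (al n) * d))) by (field; lra).
      apply Rmult_le_compat_l; [left; apply Rinv_0_lt_compat; auto|].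
      apply Rmult_le_compat_l; auto. lra.
    - apply (ex_series_scal (V := R_NormedModule)). auto. }
  apply Cder_eps. intros eps He.
  set (B := Series b). assert (HB : 0 <= B).
  { apply Series_nonneg; auto. intros n. apply Rmult_le_pos; auto. left; apply exp_pos. }
  (* With [m = |al n|] and [h <= d / 2]: [6 (m h)^2 = (24 h^2 / d^2) (m d / 2)^2], and
     [(m d / 2)^2 <= 4 exp (m d / 2)] by [sqr_le_2exp]; hence [24 * 4 = 96]. *)
  set (K := 96 / (d * d)). assert (HK : 0 < K) by (apply Rdiv_lt_0_compat; nra).
  set (e := Rmin (d / 2) (eps / (2 * K * (B + 1)))).
  assert (P : 0 < 2 * K * (B + 1)) by (apply Rmult_lt_0_compat; lra).
  assert (He' : 0 < e). { apply Rmin_pos; [lra|]. apply Rdiv_lt_0_compat; auto. }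
  exists e. split; auto. intros w Hw.
  assert (h1 : e <= d / 2) by apply Rmin_l. assert (h2 : e <= eps / (2 * K * (B + 1))) by apply Rmin_r.
  set (h := Cmod (w - z)) in *. assert (Hh : 0 <= h) by apply Cmod_ge_0.
  unfold exp_series.
  replace (Cseries (fun n => c n * Cexp (al n * w)) - Cseries (fun n => c n * Cexp (al n * z)) -
           Cseries (fun n => c n * al n * Cexp (al n * z)) * (w - z))%C
    with (Cseries (fun n => c n * Cexp (al n * w)) + (RtoC (-1) * Cseries (fun n => c n * Cexp (al n * z)) +
           (- (w - z)) * Cseries (fun n => c n * al n * Cexp (al n * z))))%C by ring.
  assert (Sz : abs_sum (fun n => c n * Cexp (al n * z))%C).
  { apply S0. replace (z - z)%C with (RtoC 0) by ring. rewrite Cmod_0. lra. }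
  rewrite <- (Cseries_scal (RtoC (-1))), <- (Cseries_scal (- (w - z))) by auto.
  rewrite <- Cseries_plus by (apply abs_sum_scal; auto).
  rewrite <- Cseries_plus by (try (apply S0; fold h; lra); apply abs_sum_plus; apply abs_sum_scal; auto).
  eapply Rle_trans.
  { apply Cmod_Cseries_le with (b := fun n => K * (h * h) * b n).
    - intros n.
      replace (Cexp (al n * w)) with (Cexp (al n * z) * Cexp (al n * (w - z)))%C
        by (rewrite <- Cexp_plus; f_equal; ring).
      match goal with |- Cmod ?x <= _ => replace x with
        ((c n * Cexp (al n * z)) * (Cexp (al n * (w - z)) - RtoC 1 - al n * (w - z)))%C by ring end.
      rewrite !Cmod_mult.
      assert (T := Cexp_taylor (al n * (w - z))). rewrite Cmod_mult in T. fold h in T.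
      set (m := Cmod (al n)) in *. assert (Hm : 0 <= m) by apply Cmod_ge_0.
      assert (Q : 6 * (m * h * (m * h)) * exp (m * h) <= K * (h * h) * exp (m * d)).
      { assert (Q1 := sqr_le_2exp (m * (d / 2)) ltac:(nra)).
        assert (Q2 : exp (m * h) <= exp (m * (d / 2))) by (apply exp_le_inc; nra).
        assert (Q3 : exp (m * d) = exp (m * (d / 2)) * exp (m * (d / 2))).
        { rewrite <- exp_plus. f_equal. field. }
        assert (E1 := exp_pos (m * (d / 2))). assert (E2 := exp_pos (m * h)).
        rewrite Q3. unfold K.
        replace (96 / (d * d) * (h * h) * (exp (m * (d / 2)) * exp (m * (d / 2))))
          with (24 / (d * d) * (h * h) * (4 * exp (m * (d / 2))) * exp (m * (d / 2))) by (field; lra).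
        apply Rmult_le_compat; try nra.
        replace (6 * (m * h * (m * h))) with (24 / (d * d) * (h * h) * (m * (d / 2) * (m * (d / 2)))) by (field; lra).
        apply Rmult_le_compat_l; auto. apply Rmult_le_pos; [|nra].
        left; apply Rdiv_lt_0_compat; nra. }
      unfold b. fold m.
      replace (K * (h * h) * (Cmod (c n) * Cmod (Cexp (al n * z)) * exp (m * d)))
        with (Cmod (c n) * Cmod (Cexp (al n * z)) * (K * (h * h) * exp (m * d))) by ring.
      apply Rmult_le_compat_l; auto. lra.
    - apply (ex_series_scal (V := R_NormedModule)). auto. }
  rewrite Series_scal_l. fold B.
  assert (Q : 2 * K * (B + 1) * h <= eps).
  { apply Rle_trans with (2 * K * (B + 1) * (eps / (2 * K * (B + 1)))).
    - apply Rmult_le_compat_l; lra.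
    - right. field. lra. }
  replace (2 * (K * (h * h) * B)) with (2 * K * B * h * h) by ring.
  apply Rmult_le_compat_r; auto.
  assert (2 * K * B * h <= 2 * K * (B + 1) * h); [|lra].
  apply Rmult_le_compat_r; auto. apply Rmult_le_compat_l; lra.
Qed.

(** Halving the radius pays for the factor [al n], so series of exponentials can be differentiated
    repeatedly. *)
Lemma exp_sum_der (c al : nat -> C) (z : C) (d : R) : 0 < d -> exp_sum c al z d ->
  exp_sum (fun n => c n * al n)%C al z (d / 2).
Proof.
  intros Hd H. unfold exp_sum in *.
  apply ex_series_le_R with (fun n => 2 / d * (Cmod (c n) * Cmod (Cexp (al n * z)) * exp (Cmod (al n) * d))).
  - intros n. rewrite Cmod_mult.
    assert (a1 := Cmod_ge_0 (c n)). assert (a2 := Cmod_ge_0 (al n)). assert (a3 := Cmod_ge_0 (Cexp (al n * z))).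
    assert (P := exp_pos (Cmod (al n) * (d / 2))).
    assert (h := exp_ge_1x (Cmod (al n) * (d / 2))).
    split; [repeat apply Rmult_le_pos; lra|].
    replace (exp (Cmod (al n) * d)) with (exp (Cmod (al n) * (d / 2)) * exp (Cmod (al n) * (d / 2)))
      by (rewrite <- exp_plus; f_equal; field).
    replace (Cmod (c n) * Cmod (al n) * Cmod (Cexp (al n * z)) * exp (Cmod (al n) * (d / 2)))
      with (2 / d * (Cmod (c n) * Cmod (Cexp (al n * z)) * ((Cmod (al n) * (d / 2)) * exp (Cmod (al n) * (d / 2)))))
      by (field; lra).
    apply Rmult_le_compat_l; [left; apply Rdiv_lt_0_compat; lra|].
    apply Rmult_le_compat_l; [apply Rmult_le_pos; auto|].
    apply Rmult_le_compat_r; lra.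
  - apply (ex_series_scal (V := R_NormedModule)). auto.
Qed.

(** * Fourier expansions of periodic holomorphic functions on the upper half plane *)

Lemma qpow_plus (tau : C) (n m : Z) : qpow tau (n + m) = (qpow tau n * qpow tau m)%C.
Proof.
  unfold qpow. rewrite <- Cexp_plus. f_equal. rewrite plus_IZR.
  apply injective_projections; simpl; ring.
Qed.

Lemma qpow_0 (tau : C) : qpow tau 0 = RtoC 1.
Proof. unfold qpow. rewrite Rmult_0_r, !Cmult_0_l. apply Cexp_0. Qed.

Lemma qpow_neq_0 (tau : C) (n : Z) : qpow tau n <> RtoC 0.
Proof. apply Cexp_neq_0. Qed.

Lemma Cmod_qpow (tau : C) (n : Z) : Cmod (qpow tau n) = exp (- (2 * PI * IZR n * Im tau)).
Proof. unfold qpow. rewrite Cmod_Cexp. f_equal. simpl. unfold Im. ring. Qed.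

Lemma qpow_shift (tau : C) (r : R) (n : Z) :
  qpow (tau + RtoC r) n = (qpow tau n * e1 (IZR n * r))%C.
Proof.
  unfold qpow, e1. rewrite <- Cexp_plus. f_equal.
  apply injective_projections; simpl; ring.
Qed.

Lemma qpow_line (x y : R) (n : Z) :
  qpow (x, y) n = (RtoC (exp (- (2 * PI * IZR n * y))) * e1 (IZR n * x))%C.
Proof.
  unfold qpow, e1, Cexp. simpl.
  replace ((2 * PI * IZR n * 0 - 0 * 1) * x - (2 * PI * IZR n * 1 + 0 * 0) * y)
    with (- (2 * PI * IZR n * y)) by ring.
  replace ((2 * PI * IZR n * 0 - 0 * 1) * y + (2 * PI * IZR n * 1 + 0 * 0) * x)
    with (2 * PI * (IZR n * x)) by ring.
  replace (2 * PI * (IZR n * x) * 0 - 0 * 1) with 0 by ring.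
  replace (2 * PI * (IZR n * x) * 1 + 0 * 0) with (2 * PI * (IZR n * x)) by ring.
  rewrite exp_0. apply injective_projections; simpl; ring.
Qed.

Lemma Cder_qpow (tau : C) (n : Z) :
  Cder (fun z => qpow z n) tau (RtoC (2 * PI * IZR n) * Ci * qpow tau n)%C.
Proof.
  apply Cder_val with (qpow tau n * (RtoC (2 * PI * IZR n) * Ci))%C; [|ring].
  apply (Cder_comp (fun z => RtoC (2 * PI * IZR n) * Ci * z)%C Cexp).
  - apply Cder_ext with (f := fun z => (RtoC (2 * PI * IZR n) * Ci * z + RtoC 0)%C); [intros; ring|].
    apply Cder_affine.
  - apply Cder_Cexp.
Qed.

Definition holoH (f : C -> C) : Prop := forall z, 0 < Im z -> exists l, Cder f z l.
Definition perH (f : C -> C) : Prop := forall z, 0 < Im z -> f (z + RtoC 1)%C = f z.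

Lemma holoH_iff (f : C -> C) : holo_on_H f <-> holoH f.
Proof.
  split; intros H z Hz.
  - destruct (H z Hz) as [l Hl]. exists l. apply is_derive_Cder. auto.
  - destruct (H z Hz) as [l Hl]. exists l. apply is_derive_Cder. auto.
Qed.

Lemma holoH_cont (f : C -> C) : holoH f -> forall z, 0 < Im z -> Ccont f z.
Proof. intros H z Hz. destruct (H z Hz) as [l Hl]. apply (Cder_cont _ _ _ Hl). Qed.

Definition fcoef_at (f : C -> C) (y : R) (n : Z) : C :=
  CInt (fun x => f (x, y) * qpow (x, y) (- n))%C 0 1.

Lemma fcoef_at_1 (f : C -> C) (n : Z) : fcoef f n = fcoef_at f 1 n.
Proof. reflexivity. Qed.

Lemma holoH_mult_qpow (f : C -> C) (n : Z) : holoH f -> holoH (fun z => f z * qpow z n)%C.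
Proof.
  intros Hf z Hz. destruct (Hf z Hz) as [l Hl].
  eexists. apply (Cder_mult f (fun z => qpow z n)); [apply Hl|apply Cder_qpow].
Qed.

Lemma fcoef_at_cont (f : C -> C) (n : Z) (y : R) : holoH f -> 0 < y ->
  forall x, RCcont (fun x => f (x, y) * qpow (x, y) (- n))%C x.
Proof.
  intros Hf Hy x. apply (RCcont_hor (fun z => f z * qpow z (- n))%C).
  apply (holoH_cont _ (holoH_mult_qpow f (- n) Hf)). auto.
Qed.

(** Goursat on a rectangle of width one: by periodicity the two vertical sides cancel. *)
Lemma fcoef_height (f : C -> C) (n : Z) (y y' : R) : holoH f -> perH f -> 0 < y -> y <= y' ->
  fcoef_at f y n = fcoef_at f y' n.
Proof.
  intros Hf Hp Hy Hyy. set (g := fun z => (f z * qpow z (- n))%C).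
  assert (G : rect_int g 0 y 1 (y' - y) = RtoC 0).
  { apply Goursat; [lra|lra|]. intros z [_ Hz].
    apply (holoH_mult_qpow f (- n) Hf). lra. }
  unfold rect_int, hint, vint in G.
  replace (y + (y' - y)) with y' in G by ring. rewrite Rplus_0_l in G.
  assert (E : CInt (fun v => g (1, v)) y y' = CInt (fun v => g (0, v)) y y').
  { apply CInt_ext. intros v Hv. rewrite Rmin_left, Rmax_right in Hv by auto. unfold g.
    replace ((1, v) : C) with ((0, v) + RtoC 1)%C by (apply injective_projections; simpl; ring).
    rewrite Hp, qpow_shift by (simpl; lra). rewrite Rmult_1_r, e1_Z. ring. }
  rewrite E in G. unfold fcoef_at. change (CInt (fun u => g (u, y)) 0 1 = CInt (fun u => g (u, y')) 0 1).
  apply Ceq_minus. rewrite <- G. ring.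
Qed.

Lemma fcoef_any_height (f : C -> C) (n : Z) (y : R) : holoH f -> perH f -> 0 < y ->
  fcoef_at f y n = fcoef f n.
Proof.
  intros Hf Hp Hy. rewrite fcoef_at_1. destruct (Rle_lt_dec y 1).
  - apply fcoef_height; auto.
  - symmetry. apply fcoef_height; auto; lra.
Qed.

Lemma fcoef_bound (f : C -> C) (n : Z) (y M : R) : holoH f -> perH f -> 0 < y ->
  (forall x, 0 <= x <= 1 -> Cmod (f (x, y)) <= M) ->
  Cmod (fcoef f n) <= M * exp (2 * PI * IZR n * y).
Proof.
  intros Hf Hp Hy HM. rewrite <- (fcoef_any_height f n y) by auto.
  replace (M * exp (2 * PI * IZR n * y)) with ((1 - 0) * (M * exp (2 * PI * IZR n * y))) by ring.
  apply CInt_bound; [lra|apply ex_CInt_glob, fcoef_at_cont; auto|].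
  intros x Hx. rewrite Cmod_mult, Cmod_qpow. rewrite opp_IZR. simpl Im.
  replace (- (2 * PI * - IZR n * y)) with (2 * PI * IZR n * y) by ring.
  apply Rmult_le_compat_r; [left; apply exp_pos|auto].
Qed.

(** A Riemann integrable function is bounded. *)
Lemma line_bounded (f : C -> C) (y : R) : holoH f -> 0 < y ->
  exists M, forall x, 0 <= x <= 1 -> Cmod (f (x, y)) <= M.
Proof.
  intros Hf Hy.
  destruct (ex_RInt_ub (V := C_R_CompleteNormedModule) (fun x => f (x, y)) 0 1) as [M HM].
  - apply ex_CInt_glob. intros x. apply RCcont_hor. apply holoH_cont; auto.
  - exists M. intros x Hx. rewrite <- norm_CR. apply HM. rewrite Rmin_left, Rmax_right by lra. auto.
Qed.

Lemma fourier_fcoef (f : C -> C) (x0 y : R) (n : Z) : holoH f -> perH f -> 0 < y ->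
  (fourier (fun x => f (x, y)) n * e1 (IZR n * x0))%C = (fcoef f n * qpow (x0, y) n)%C.
Proof.
  intros Hf Hp Hy. rewrite <- (fcoef_any_height f n y) by auto.
  unfold fcoef_at, fourier.
  rewrite (CInt_ext (fun x => f (x, y) * qpow (x, y) (- n))%C
    (fun x => RtoC (exp (2 * PI * IZR n * y)) * (f (x, y) * e1 (- IZR n * x)))%C).
  - rewrite CInt_scal.
    + rewrite qpow_line.
      assert (E : (RtoC (exp (2 * PI * IZR n * y)) * RtoC (exp (- (2 * PI * IZR n * y))))%C = RtoC 1).
      { rewrite <- RtoC_mult, <- exp_plus, Rplus_opp_r, exp_0. auto. }
      set (A := CInt _ 0 1). transitivity ((RtoC (exp (2 * PI * IZR n * y)) * RtoC (exp (- (2 * PI * IZR n * y)))) *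
        (A * e1 (IZR n * x0)))%C; [rewrite E; ring|ring].
    + apply ex_CInt_glob, RCcont_fourier_arg. intros x. apply RCcont_hor, holoH_cont; auto.
  - intros x _. rewrite qpow_line, opp_IZR.
    replace (- (2 * PI * - IZR n * y)) with (2 * PI * IZR n * y) by ring. ring.
Qed.

Lemma sym_sum_csum (a : Z -> C) (N : nat) :
  sym_sum a N = csum (fun k => a (- Z.of_nat N + Z.of_nat k)%Z) (2 * N + 1).
Proof.
  induction N as [|N IH]; [simpl; ring|].
  change (sym_sum a (S N)) with (sym_sum a N + a (Z.of_nat (S N)) + a (- Z.of_nat (S N))%Z)%C.
  rewrite IH. replace (2 * S N + 1)%nat with (S (S (2 * N + 1))) by lia.
  rewrite csum_head.
  match goal with |- _ = (_ + csum ?g (S ?n))%C => change (csum g (S n)) with (csum g n + g n)%C end.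
  cbv beta.
  rewrite (csum_ext (fun k => a (- Z.of_nat (S N) + Z.of_nat (S k))%Z) (fun k => a (- Z.of_nat N + Z.of_nat k)%Z))
    by (intros; f_equal; lia).
  replace (- Z.of_nat (S N) + Z.of_nat (S (2 * N + 1)))%Z with (Z.of_nat (S N)) by lia.
  replace (- Z.of_nat (S N) + Z.of_nat 0)%Z with (- Z.of_nat (S N))%Z by lia. ring.
Qed.

Lemma sym_sum_from (a : Z -> C) (n1 : Z) (N : nat) : (forall n, (n < n1)%Z -> a n = RtoC 0) ->
  (Z.abs n1 <= Z.of_nat N)%Z ->
  sym_sum a N = csum (fun k => a (n1 + Z.of_nat k)%Z) (Z.to_nat (Z.of_nat N - n1 + 1)).
Proof.
  intros Ha HN. rewrite sym_sum_csum.
  replace (2 * N + 1)%nat with (Z.to_nat (n1 + Z.of_nat N) + Z.to_nat (Z.of_nat N - n1 + 1))%nat by lia.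
  rewrite csum_add, csum_zero.
  - rewrite Cplus_0_l. apply csum_ext. intros k _. f_equal. lia.
  - intros k Hk. apply Ha. lia.
Qed.

Lemma ex_series_exp_geom (K a : R) : 0 < a -> ex_series (fun n => K * exp (- (a * INR n))).
Proof.
  intros Ha. apply (ex_series_scal (V := R_NormedModule) K).
  apply ex_series_ext with (fun n => (exp (- a)) ^ n).
  - intros n. induction n as [|n IH]; [simpl; rewrite Rmult_0_r, Ropp_0, exp_0; auto|].
    rewrite S_INR. simpl. rewrite IH, <- exp_plus. f_equal. ring.
  - apply ex_series_geom. rewrite Rabs_pos_eq by (left; apply exp_pos).
    rewrite <- exp_0. apply exp_increasing. lra.
Qed.

Section QExpansion.

Variables (f : C -> C) (n1 : Z).
Hypotheses (Hf : holoH f) (Hp : perH f) (H0 : forall n, (n < n1)%Z -> fcoef f n = RtoC 0).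

Let c (k : nat) : C := fcoef f (n1 + Z.of_nat k).
Let al (k : nat) : C := (RtoC (2 * PI * INR k) * Ci)%C.

(** The coefficients are estimated at height [y / 2]; evaluating the terms at height [y] then leaves
    geometric decay of ratio [exp (- (PI y))]. *)
Lemma qexp_term_bound (y : R) : 0 < y ->
  exists K, forall k, Cmod (c k) * exp (- (2 * PI * INR k * y)) <= K * exp (- (PI * y * INR k)).
Proof.
  intros Hy. destruct (line_bounded f (y / 2) Hf) as [M HM]; [lra|].
  exists (M * exp (2 * PI * IZR n1 * (y / 2))). intros k.
  assert (B := fcoef_bound f (n1 + Z.of_nat k) (y / 2) M Hf Hp ltac:(lra) HM). fold (c k) in B.
  apply Rmult_le_compat_r with (r := exp (- (2 * PI * INR k * y))) in B; [|left; apply exp_pos].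
  eapply Rle_trans; [apply B|]. right. rewrite !Rmult_assoc, <- !exp_plus. f_equal. f_equal.
  rewrite plus_IZR, <- INR_IZR_INZ. field.
Qed.

Lemma qexp_al (k : nat) (z : C) : Cexp (al k * z) = qpow z (Z.of_nat k).
Proof. unfold al, qpow. rewrite <- INR_IZR_INZ. reflexivity. Qed.

Lemma qexp_exp_sum (z : C) : 0 < Im z -> exp_sum c al z (Im z / 2).
Proof.
  intros Hz. destruct (qexp_term_bound (Im z / 2)) as [K HK]; [lra|].
  assert (HP := PI_RGT_0).
  apply ex_series_le_R with (fun k => K * exp (- (PI * (Im z / 2) * INR k))).
  - intros k. assert (Q := HK k).
    assert (E : Cmod (c k) * Cmod (Cexp (al k * z)) * exp (Cmod (al k) * (Im z / 2)) =
                Cmod (c k) * exp (- (2 * PI * INR k * (Im z / 2)))).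
    { rewrite qexp_al, Cmod_qpow, <- INR_IZR_INZ, Rmult_assoc, <- exp_plus. f_equal. f_equal.
      unfold al. rewrite Cmod_mult, Cmod_Ci, Cmod_R, Rabs_pos_eq.
      - field.
      - assert (h := pos_INR k). nra. }
    rewrite E. split; auto. apply Rmult_le_pos; [apply Cmod_ge_0|left; apply exp_pos].
  - apply ex_series_exp_geom. nra.
Qed.

Lemma qexp_abs_sum (z : C) : 0 < Im z -> abs_sum (fun k => c k * qpow z (Z.of_nat k))%C.
Proof.
  intros Hz. assert (HP := PI_RGT_0).
  destruct (qexp_term_bound (Im z) Hz) as [K HK].
  apply abs_sum_le with (fun k => K * exp (- (PI * Im z * INR k))).
  - intros k. rewrite Cmod_mult, Cmod_qpow, <- INR_IZR_INZ. apply HK.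
  - apply ex_series_exp_geom. nra.
Qed.

Lemma qexp_series (z : C) : 0 < Im z ->
  f z = (qpow z n1 * Cseries (fun k => c k * qpow z (Z.of_nat k)))%C.
Proof.
  intros Hz. assert (Hs := qexp_abs_sum z Hz).
  rewrite <- Cseries_scal by auto. symmetry. apply Cseries_unique; [apply abs_sum_scal; auto|].
  intros eps He. destruct z as [x0 y]. simpl in Hz.
  destruct (Hf (x0, y) Hz) as [l Hl].
  destruct (fourier_inversion f y x0 l) with (eps := eps) as [N0 HN0]; auto.
  - intros x. apply holoH_cont; auto.
  - intros x. rewrite <- (Hp (x, y)) by auto. f_equal. apply injective_projections; simpl; ring.
  - exists (N0 + Z.to_nat (Z.abs n1) * 2 + 2)%nat. intros N HN.
    (* Since the coefficients vanish below [n1], the symmetric sum over [|n| <= M] has exactly the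
       [N] terms [n1, ..., n1 + N - 1]. *)
    set (M := Z.to_nat (Z.of_nat N + n1 - 1)).
    specialize (HN0 M ltac:(lia)).
    rewrite (sym_sum_ext _ (fun n => fcoef f n * qpow (x0, y) n)%C) in HN0
      by (intros n; apply fourier_fcoef; auto).
    rewrite (sym_sum_from _ n1) in HN0.
    + replace (Z.to_nat (Z.of_nat M - n1 + 1)) with N in HN0 by lia.
      rewrite (csum_ext _ (fun n => qpow (x0, y) n1 * (c n * qpow (x0, y) (Z.of_nat n)))%C) in HN0; auto.
      intros k _. rewrite qpow_plus. unfold c. ring.
    + intros n Hn. rewrite H0 by auto. ring.
    + lia.
Qed.

Definition qexp_g : C -> C := exp_series c al.
Definition qexp_dg : C -> C := exp_series (fun k => c k * al k)%C al.

Lemma qexp_g_eq (z : C) : 0 < Im z -> f z = (qpow z n1 * qexp_g z)%C.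
Proof.
  intros Hz. rewrite qexp_series by auto. f_equal. apply Cseries_ext. intros k. rewrite qexp_al. auto.
Qed.

Lemma qexp_g_der (z : C) : 0 < Im z -> Cder qexp_g z (qexp_dg z).
Proof. intros Hz. apply exp_series_der with (Im z / 2); [lra|]. apply qexp_exp_sum. auto. Qed.

Lemma qexp_dg_der (z : C) : 0 < Im z -> exists l, Cder qexp_dg z l.
Proof.
  intros Hz. eexists. apply exp_series_der with (Im z / 2 / 2); [lra|].
  apply exp_sum_der; [lra|]. apply qexp_exp_sum. auto.
Qed.

(** Raising the height from [y0] to [Im z] shrinks each term with [k >= 1] by at least
    [exp (- (2 PI (Im z - y0)))]. The constant term of [qexp_g] is the leading coefficient, and that
    of [qexp_dg] is zero. *)
Lemma qexp_bounds (y0 : R) : 0 < y0 -> exists K, 0 <= K /\ forall z, y0 <= Im z ->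
  Cmod (qexp_g z - fcoef f n1) <= K * exp (- (2 * PI * Im z)) /\
  Cmod (qexp_dg z) <= K * exp (- (2 * PI * Im z)).
Proof.
  intros Hy. assert (HP := PI_RGT_0). set (z0 := ((0, y0) : C)).
  assert (Hz0 : 0 < Im z0) by auto.
  assert (Hs := qexp_exp_sum z0 Hz0).
  assert (Q0 : abs_sum (fun k => c k * Cexp (al k * z0))%C).
  { apply (abs_sum_ext (fun k => c k * qpow z0 (Z.of_nat k))%C).
    - intros k. rewrite qexp_al. auto.
    - apply qexp_abs_sum; auto. }
  assert (Q1 : abs_sum (fun k => c k * al k * Cexp (al k * z0))%C).
  { assert (Hs' := exp_sum_der c al z0 (Im z0 / 2) ltac:(lra) Hs).
    apply abs_sum_le with (2 := Hs'). intros n. rewrite (Cmod_mult (c n * al n)).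
    rewrite <- (Rmult_1_r (Cmod (c n * al n) * Cmod (Cexp (al n * z0)))) at 1.
    apply Rmult_le_compat_l; [apply Rmult_le_pos; apply Cmod_ge_0|].
    assert (h := exp_ge_1x (Cmod (al n) * (Im z0 / 2 / 2))). assert (h' := Cmod_ge_0 (al n)).
    assert (0 <= Cmod (al n) * (Im z0 / 2 / 2)) by (apply Rmult_le_pos; lra). lra. }
  set (b0 := fun k => Cmod (c (S k) * Cexp (al (S k) * z0))).
  set (b1 := fun k => Cmod (c (S k) * al (S k) * Cexp (al (S k) * z0))).
  assert (E0 : ex_series b0) by apply (abs_sum_incr_1 _ Q0).
  assert (E1 : ex_series b1) by apply (abs_sum_incr_1 _ Q1).
  set (L := exp (2 * PI * y0)). assert (PL : 0 < L) by apply exp_pos.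
  exists (2 * L * (Series b0 + Series b1)).
  assert (P0 : 0 <= Series b0) by (apply Series_nonneg; auto; intros; apply Cmod_ge_0).
  assert (P1 : 0 <= Series b1) by (apply Series_nonneg; auto; intros; apply Cmod_ge_0).
  split; [apply Rmult_le_pos; lra|]. intros z Hz.
  assert (Hz' : 0 < Im z) by lra.
  assert (T : forall k, Cmod (Cexp (al (S k) * z)) <= L * exp (- (2 * PI * Im z)) * Cmod (Cexp (al (S k) * z0))).
  { intros k. rewrite !qexp_al, !Cmod_qpow. unfold L. rewrite <- !exp_plus. apply exp_le_inc.
    rewrite <- INR_IZR_INZ, S_INR. change (Im z0) with y0. assert (h := pos_INR k).
    assert (0 <= 2 * PI * INR k * (Im z - y0)) by (apply Rmult_le_pos; [apply Rmult_le_pos|]; lra). lra. }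
  assert (PE : 0 <= L * exp (- (2 * PI * Im z))) by (apply Rmult_le_pos; [lra|left; apply exp_pos]).
  split.
  - unfold qexp_g, exp_series. rewrite Cseries_incr_1.
    + replace (c 0 * Cexp (al 0 * z))%C with (fcoef f n1).
      * match goal with |- Cmod ?x <= _ => replace x with (Cseries (fun k => c (S k) * Cexp (al (S k) * z)))%C by ring end.
        eapply Rle_trans.
        { apply Cmod_Cseries_le with (b := fun k => L * exp (- (2 * PI * Im z)) * b0 k).
          - intros k. unfold b0. rewrite !Cmod_mult. specialize (T k). assert (h := Cmod_ge_0 (c (S k))). nra.
          - apply (ex_series_scal (V := R_NormedModule)). auto. }
        rewrite Series_scal_l.
        apply Rle_trans with (2 * (L * exp (- (2 * PI * Im z)) * (Series b0 + Series b1))).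
        -- apply Rmult_le_compat_l; [lra|]. apply Rmult_le_compat_l; lra.
        -- right. ring.
      * rewrite qexp_al. simpl Z.of_nat. rewrite qpow_0. unfold c. simpl Z.of_nat. rewrite Z.add_0_r. ring.
    + apply (abs_sum_ext (fun k => c k * qpow z (Z.of_nat k))%C).
      * intros k. rewrite qexp_al. auto.
      * apply qexp_abs_sum; auto.
  - unfold qexp_dg, exp_series.
    assert (Q1z : abs_sum (fun k => c k * al k * Cexp (al k * z))%C).
    { apply abs_sum_le with (2 := Q1). intros n. rewrite !(Cmod_mult (c n * al n)).
      apply Rmult_le_compat_l; [apply Cmod_ge_0|]. rewrite !qexp_al, !Cmod_qpow.
      apply exp_le_inc. rewrite <- INR_IZR_INZ. change (Im z0) with y0. assert (h := pos_INR n).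
      assert (2 * PI * INR n * y0 <= 2 * PI * INR n * Im z) by (apply Rmult_le_compat_l; nra). lra. }
    rewrite Cseries_incr_1 by auto.
    replace (c 0 * al 0 * Cexp (al 0 * z))%C with (RtoC 0).
    + rewrite Cplus_0_l. eapply Rle_trans.
      { apply Cmod_Cseries_le with (b := fun k => L * exp (- (2 * PI * Im z)) * b1 k).
        - intros k. unfold b1. rewrite !(Cmod_mult (c (S k) * al (S k))). specialize (T k).
          assert (h := Cmod_ge_0 (c (S k) * al (S k))). nra.
        - apply (ex_series_scal (V := R_NormedModule)). auto. }
      rewrite Series_scal_l.
      apply Rle_trans with (2 * (L * exp (- (2 * PI * Im z)) * (Series b0 + Series b1))).
      * apply Rmult_le_compat_l; [lra|]. apply Rmult_le_compat_l; lra.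
      * right. ring.
    + unfold al. simpl INR. rewrite Rmult_0_r. ring.
Qed.

End QExpansion.

(** Let the height tend to infinity in [fcoef_bound]: the exponent [N + 2 PI n] is negative. *)
Lemma fcoef_growth (f : C -> C) (K N : R) (n : Z) : holoH f -> perH f ->
  (forall z, 1 <= Im z -> Cmod (f z) <= K * exp (N * Im z)) ->
  N + 2 * PI * IZR n < 0 -> fcoef f n = RtoC 0.
Proof.
  intros Hf Hp Hb Hn. apply Cmod_small_0. intros eps He.
  set (a := - (N + 2 * PI * IZR n)). assert (Ha : 0 < a) by (unfold a; lra).
  (* Makes [|K| + 1 <= eps a y]; then [x exp (-x) <= 1] at [x = a y] bounds the coefficient by
     [eps]. *)
  set (y := Rmax 1 ((Rabs K + 1) / (eps * a))).
  assert (Hy1 : 1 <= y) by apply Rmax_l.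
  assert (Hy2 : (Rabs K + 1) / (eps * a) <= y) by apply Rmax_r.
  assert (B := fcoef_bound f n y (K * exp (N * y)) Hf Hp ltac:(lra)).
  eapply Rle_trans; [apply B|].
  { intros x _. apply Hb. auto. }
  rewrite Rmult_assoc, <- exp_plus.
  replace (N * y + 2 * PI * IZR n * y) with (- (a * y)) by (unfold a; ring).
  assert (Q := x_exp_le (a * y)).
  assert (PK := Rle_abs K). assert (PK' := Rabs_pos K). assert (PE := exp_pos (- (a * y))).
  assert (Hay : (Rabs K + 1) <= eps * (a * y)).
  { apply Rmult_le_compat_l with (r := eps * a) in Hy2; [|nra].
    replace (eps * a * ((Rabs K + 1) / (eps * a))) with (Rabs K + 1) in Hy2 by (field; split; lra). lra. }
  apply Rle_trans with ((Rabs K + 1) * exp (- (a * y))); [apply Rmult_le_compat_r; lra|].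
  apply Rle_trans with (eps * (a * y) * exp (- (a * y))); [apply Rmult_le_compat_r; lra|].
  rewrite Rmult_assoc. nra.
Qed.

Lemma fcoef_zero_all (f : C -> C) : holoH f -> perH f -> (forall n, fcoef f n = RtoC 0) ->
  forall z, 0 < Im z -> f z = RtoC 0.
Proof.
  intros Hf Hp H z Hz. rewrite (qexp_series f 0 Hf Hp) by auto.
  rewrite (Cseries_ext _ (fun k => RtoC 0 * RtoC 0)%C).
  - rewrite Cseries_scal; [ring|]. apply abs_sum_le with (fun k => 0 * exp (- (1 * INR k))).
    + intros k. rewrite Cmod_0. lra.
    + apply ex_series_exp_geom. lra.
  - intros k. rewrite H. ring.
Qed.

(** * Poisson summation for complex Gaussians *)

Definition ee (w : C) : C := Cexp (RtoC (2 * PI) * Ci * w)%C.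

Lemma ee_plus (a b : C) : ee (a + b) = (ee a * ee b)%C.
Proof. unfold ee. rewrite <- Cexp_plus. f_equal. ring. Qed.

Lemma Cmod_ee (w : C) : Cmod (ee w) = exp (- (2 * PI * Im w)).
Proof. unfold ee. rewrite Cmod_Cexp. f_equal. simpl. unfold Im. ring. Qed.

Lemma ee_R (r : R) : ee (RtoC r) = e1 r.
Proof. unfold ee, e1. f_equal. apply injective_projections; simpl; ring. Qed.

Lemma qpow_ee (tau : C) (n : Z) : qpow tau n = ee (RtoC (IZR n) * tau).
Proof. unfold qpow, ee. f_equal. apply injective_projections; simpl; ring. Qed.

Definition gaussian (s z : C) : C := ee (s * (z * z)).

Lemma Cder_gaussian (s z : C) : exists l, Cder (gaussian s) z l.
Proof.
  eexists. unfold gaussian, ee.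
  apply (Cder_comp (fun z => RtoC (2 * PI) * Ci * (s * (z * z)))%C Cexp).
  - apply Cder_scal, Cder_scal, Cder_mult; apply Cder_id.
  - apply Cder_Cexp.
Qed.

Lemma Ccont_gaussian (s z : C) : Ccont (gaussian s) z.
Proof. destruct (Cder_gaussian s z) as [l Hl]. apply (Cder_cont _ _ _ Hl). Qed.

(** Completing the square: the exponent plus [n] is at most [(B + 1)^2 / (4 A)], so the terms are
    dominated by a geometric series. *)
Lemma gauss_summable (A B : R) : 0 < A ->
  ex_series (fun n => exp (- A * (INR (S n) * INR (S n)) + B * INR (S n))).
Proof.
  intros HA. set (K := exp ((B + 1) * (B + 1) / (4 * A))).
  apply ex_series_le_R with (fun n => K * exp (- (1 * INR n))).
  - intros n. split; [left; apply exp_pos|]. unfold K. rewrite <- exp_plus. apply exp_le_inc.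
    rewrite S_INR. set (m := INR n + 1). replace (INR n) with (m - 1) by (unfold m; ring).
    assert (Q : 0 <= A * ((m - (B + 1) / (2 * A)) * (m - (B + 1) / (2 * A)))).
    { apply Rmult_le_pos; [lra|]. apply Rle_0_sqr. }
    replace (A * ((m - (B + 1) / (2 * A)) * (m - (B + 1) / (2 * A))))
      with (A * (m * m) - (B + 1) * m + (B + 1) * (B + 1) / (4 * A)) in Q by (field; lra).
    lra.
  - apply ex_series_exp_geom. lra.
Qed.

Lemma Cmod_gaussian (s : C) (x y : R) :
  Cmod (gaussian s (x, y)) = exp (- (2 * PI * (Im s * (x * x - y * y) + 2 * Re s * x * y))).
Proof. unfold gaussian. rewrite Cmod_ee. f_equal. destruct s. simpl. ring. Qed.

Lemma gaussian_decay (s : C) (Q eps : R) : 0 < Im s -> 0 <= Q -> 0 < eps ->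
  exists X, 0 < X /\ forall x y, X <= Rabs x -> Rabs y <= Q -> Cmod (gaussian s (x, y)) <= eps.
Proof.
  intros Hs HQ He. set (b := Im s) in *. set (a := Rabs (Re s)).
  assert (Ha : 0 <= a) by apply Rabs_pos.
  (* Beyond [X0] the quadratic form in the exponent is at least [|x|], uniformly for [|y| <= Q];
     beyond [1 / eps] this makes the exponential at most [eps]. *)
  set (X0 := (1 + 2 * a * Q + b * (Q * Q)) / b + 1).
  assert (Hn : 0 <= 1 + 2 * a * Q + b * (Q * Q)).
  { assert (0 <= a * Q) by (apply Rmult_le_pos; auto). assert (0 <= b * (Q * Q)) by (apply Rmult_le_pos; nra). lra. }
  assert (HX0 : 1 <= X0).
  { unfold X0. assert (0 <= (1 + 2 * a * Q + b * (Q * Q)) / b); [|lra].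
    apply Rmult_le_pos; auto. left. apply Rinv_0_lt_compat; auto. }
  exists (Rmax X0 (/ eps)). split; [eapply Rlt_le_trans; [|apply Rmax_l]; lra|].
  intros x y Hx Hy. assert (Hx1 : X0 <= Rabs x) by (eapply Rle_trans; [apply Rmax_l|apply Hx]).
  assert (Hx2 : / eps <= Rabs x) by (eapply Rle_trans; [apply Rmax_r|apply Hx]).
  rewrite Cmod_gaussian. fold b.
  set (m := Rabs x) in *.
  assert (Exx : x * x = m * m) by (unfold m; rewrite <- Rabs_mult; symmetry; apply Rabs_pos_eq; nra).
  assert (Hyy : y * y <= Q * Q).
  { replace (y * y) with (Rabs y * Rabs y) by (rewrite <- Rabs_mult; apply Rabs_pos_eq; nra).
    assert (h := Rabs_pos y). nra. }
  assert (Hxy : - (a * m * Q) <= Re s * x * y).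
  { assert (Rabs (Re s * x * y) <= a * m * Q).
    { rewrite !Rabs_mult. fold a m. assert (0 <= a * m) by (apply Rmult_le_pos; lra).
      apply Rmult_le_compat_l; auto. }
    apply Rabs_le_between in H. lra. }
  assert (U : m <= b * (x * x - y * y) + 2 * Re s * x * y).
  { rewrite Exx.
    assert (b * m >= 1 + 2 * a * Q + b * (Q * Q)).
    { apply Rmult_le_compat_l with (r := b) in Hx1; [|lra].
      unfold X0 in Hx1. replace (b * ((1 + 2 * a * Q + b * (Q * Q)) / b + 1))
        with (1 + 2 * a * Q + b * (Q * Q) + b) in Hx1 by (field; lra). lra. }
    assert (b * (m * m) >= m + 2 * (a * m * Q) + b * (Q * Q)).
    { assert (0 <= b * (Q * Q)) by (apply Rmult_le_pos; nra). nra. }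
    assert (b * (y * y) <= b * (Q * Q)) by (apply Rmult_le_compat_l; lra).
    lra. }
  apply Rle_trans with (exp (- m)).
  - apply exp_le_inc. assert (P := PI2_3_2). nra.
  - rewrite exp_Ropp. rewrite <- (Rinv_inv eps).
    apply Rinv_le_contravar; [apply Rinv_0_lt_compat; auto|].
    assert (h := exp_ge_1x m). lra.
Qed.

(** The improper integral as a limit of symmetric truncations. For decaying integrands the ends may
    be displaced by a bounded amount, as [is_line_int_perturb] shows. *)
Definition is_line_int (h : R -> C) (l : C) : Prop :=
  forall eps, 0 < eps -> exists L0, forall L, L0 <= L -> Cmod (CInt h (- L) L - l) <= eps.

Lemma is_line_int_unique (h : R -> C) (a b : C) : is_line_int h a -> is_line_int h b -> a = b.
Proof.
  intros Ha Hb. apply Ceq_minus, Cmod_small_0. intros eps He.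
  destruct (Ha (eps / 2)) as [L1 H1]; [lra|]. destruct (Hb (eps / 2)) as [L2 H2]; [lra|].
  specialize (H1 (Rmax L1 L2) (Rmax_l _ _)). specialize (H2 (Rmax L1 L2) (Rmax_r _ _)).
  set (I := CInt h _ _) in *.
  replace (a - b)%C with ((I - b) - (I - a))%C by ring.
  eapply Rle_trans; [apply Cmod_minus_le|]. lra.
Qed.

Lemma is_line_int_ext (h g : R -> C) (l : C) : (forall x, h x = g x) -> is_line_int h l -> is_line_int g l.
Proof.
  intros E H eps He. destruct (H eps He) as [L0 HL]. exists L0. intros L h'.
  rewrite <- (CInt_ext h g); auto.
Qed.

Lemma is_line_int_scal (c : C) (h : R -> C) (l : C) : (forall x, RCcont h x) -> is_line_int h l ->
  is_line_int (fun x => c * h x)%C (c * l)%C.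
Proof.
  intros Hc H eps He. assert (P := Cmod_ge_0 c).
  destruct (H (eps / (Cmod c + 1))) as [L0 HL]; [apply Rdiv_lt_0_compat; lra|].
  exists L0. intros L h'. specialize (HL L h').
  rewrite CInt_scal by (apply ex_CInt_glob; auto).
  replace (c * CInt h (- L) L - c * l)%C with (c * (CInt h (- L) L - l))%C by ring.
  rewrite Cmod_mult. apply Rle_trans with ((Cmod c + 1) * (eps / (Cmod c + 1))).
  - apply Rmult_le_compat; auto; try apply Cmod_ge_0. lra.
  - right. field. lra.
Qed.

(** Moving the ends changes the integral only over two intervals of length at most [D] far from the
    origin, where [h] is small. *)
Lemma is_line_int_perturb (h : R -> C) (l : C) (D : R) : (forall x, RCcont h x) -> 0 <= D ->
  (forall eps, 0 < eps -> exists X, 0 < X /\ forall x, X <= Rabs x -> Cmod (h x) <= eps) ->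
  is_line_int h l -> forall eps, 0 < eps -> exists L0, forall L a b, L0 <= L -> Rabs (a + L) <= D -> Rabs (b - L) <= D ->
    Cmod (CInt h a b - l) <= eps.
Proof.
  intros Hc HD Hdec H eps He.
  destruct (H (eps / 2)) as [L1 H1]; [lra|].
  destruct (Hdec (eps / (4 * (D + 1)))) as [X [HX HX']]; [apply Rdiv_lt_0_compat; lra|].
  exists (Rmax L1 (X + D)). intros L a b HL Ha Hb.
  assert (HL1 : L1 <= L) by (eapply Rle_trans; [apply Rmax_l|apply HL]).
  assert (HL2 : X + D <= L) by (eapply Rle_trans; [apply Rmax_r|apply HL]).
  specialize (H1 L HL1).
  assert (E : forall p q, ex_CInt h p q) by (intros; apply ex_CInt_glob; auto).
  assert (Hq : D * (eps / (4 * (D + 1))) <= eps / 4).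
  { apply Rmult_le_reg_r with (4 * (D + 1)); [lra|].
    replace (D * (eps / (4 * (D + 1))) * (4 * (D + 1))) with (D * eps) by (field; lra). nra. }
  assert (G : forall p q, Rabs (q - p) <= D -> (forall x, Rmin p q <= x <= Rmax p q -> X <= Rabs x) ->
     Cmod (CInt h p q) <= eps / 4).
  { intros p q Hpq Hx. rewrite <- norm_CR.
    eapply Rle_trans; [apply (norm_RInt_le_const_abs (V := C_R_CompleteNormedModule) h p q _ (eps / (4 * (D + 1))))|].
    - intros x Hxx. rewrite norm_CR. auto.
    - apply CInt_correct. auto.
    - apply Rle_trans with (D * (eps / (4 * (D + 1)))); auto.
      apply Rmult_le_compat_r; auto. left. apply Rdiv_lt_0_compat; lra. }
  assert (Ga : Cmod (CInt h a (- L)) <= eps / 4).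
  { apply G. { replace (- L - a) with (- (a + L)) by ring. rewrite Rabs_Ropp. auto. }
    apply Rabs_le_between in Ha. intros x Hx. rewrite Rabs_left1.
    - revert Hx. unfold Rmin, Rmax. destruct (Rle_dec a (- L)); lra.
    - revert Hx. unfold Rmin, Rmax. destruct (Rle_dec a (- L)); lra. }
  assert (Gb : Cmod (CInt h L b) <= eps / 4).
  { apply G; auto.
    apply Rabs_le_between in Hb. intros x Hx. rewrite Rabs_pos_eq.
    - revert Hx. unfold Rmin, Rmax. destruct (Rle_dec L b); lra.
    - revert Hx. unfold Rmin, Rmax. destruct (Rle_dec L b); lra. }
  rewrite <- (CInt_Chasles h a (- L) b), <- (CInt_Chasles h (- L) L b) by auto.
  replace (CInt h a (- L) + (CInt h (- L) L + CInt h L b) - l)%C with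
    ((CInt h (- L) L - l) + (CInt h a (- L) + CInt h L b))%C by ring.
  eapply Rle_trans; [apply Cmod_triangle|].
  assert (T := Cmod_triangle (CInt h a (- L)) (CInt h L b)). lra.
Qed.

(** The interval from [-N] to [N + 1] is the union of the unit windows [[m, m + 1]] with [|m| <= N],
    which is what a symmetric sum over shifts produces. *)
Lemma is_line_int_of_unit_windows (h : R -> C) (l : C) : (forall x, RCcont h x) ->
  (forall eps, 0 < eps -> exists X, 0 < X /\ forall x, X <= Rabs x -> Cmod (h x) <= eps) ->
  (forall eps, 0 < eps -> exists N0, forall N, (N0 <= N)%nat ->
     Cmod (CInt h (- INR N) (INR N + 1) - l) <= eps) -> is_line_int h l.
Proof.
  intros Hc Hdec H eps He.
  destruct (H (eps / 2)) as [N0 HN]; [lra|].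
  destruct (Hdec (eps / 4)) as [X [HX HX']]; [lra|].
  exists (Rmax (INR N0 + 1) (X + 1)). intros L HL.
  assert (HL1 : INR N0 + 1 <= L) by (eapply Rle_trans; [apply Rmax_l|apply HL]).
  assert (HL2 : X + 1 <= L) by (eapply Rle_trans; [apply Rmax_r|apply HL]).
  destruct (archimed L) as [A1 A2]. assert (P0 := pos_INR N0).
  assert (Hup : (1 <= up L)%Z) by (apply le_IZR; lra).
  set (N := Z.to_nat (up L - 1)).
  assert (EN : INR N = IZR (up L) - 1).
  { unfold N. rewrite INR_IZR_INZ, Z2Nat.id by lia. apply minus_IZR. }
  assert (HNN : (N0 <= N)%nat). { apply INR_le. apply Rle_trans with (L - 1); lra. }
  specialize (HN N HNN).
  assert (E : forall p q, ex_CInt h p q) by (intros; apply ex_CInt_glob; auto).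
  assert (B1 : Cmod (CInt h (- L) (- INR N)) <= eps / 4).
  { apply Rle_trans with ((- INR N - - L) * (eps / 4)).
    - apply CInt_bound; auto; [lra|]. intros x Hx. apply HX'. rewrite Rabs_left1; lra.
    - nra. }
  assert (B2 : Cmod (CInt h L (INR N + 1)) <= eps / 4).
  { apply Rle_trans with ((INR N + 1 - L) * (eps / 4)).
    - apply CInt_bound; auto; [lra|]. intros x Hx. apply HX'. rewrite Rabs_pos_eq; lra.
    - nra. }
  rewrite <- (CInt_Chasles h (- INR N) L (INR N + 1)) in HN by auto.
  rewrite <- (CInt_Chasles h (- L) (- INR N) L) by auto.
  set (a := CInt h (- INR N) L) in *. set (b := CInt h L (INR N + 1)) in *. set (c := CInt h (- L) (- INR N)) in *.
  replace (c + a - l)%C with ((a + b - l) + (c - b))%C by ring.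
  eapply Rle_trans; [apply Cmod_triangle|]. assert (T := Cmod_minus_le c b). lra.
Qed.

(** By Goursat the difference of the two horizontal integrals is carried by the vertical sides, each
    of length [y2 - y1]. *)
Lemma hint_shift_bound (f : C -> C) (y1 y2 a b M : R) : y1 <= y2 -> a <= b ->
  (forall z, exists l, Cder f z l) ->
  (forall v, y1 <= v <= y2 -> Cmod (f (a, v)) <= M /\ Cmod (f (b, v)) <= M) ->
  Cmod (CInt (fun x => f (x, y1)) a b - CInt (fun x => f (x, y2)) a b) <= 2 * (y2 - y1) * M.
Proof.
  intros Hy Hab Hf HM.
  assert (G : rect_int f a y1 (b - a) (y2 - y1) = RtoC 0) by (apply Goursat; auto; lra).
  unfold rect_int, hint, vint in G.
  replace (a + (b - a)) with b in G by ring. replace (y1 + (y2 - y1)) with y2 in G by ring.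
  assert (Hc : forall z, Ccont f z) by (intros z; destruct (Hf z) as [l Hl]; apply (Cder_cont _ _ _ Hl)).
  assert (B1 : Cmod (CInt (fun v => f (a, v)) y1 y2) <= (y2 - y1) * M).
  { apply CInt_bound; auto; [|intros v Hv; apply HM; auto].
    apply ex_CInt_glob. intros x. apply RCcont_ver. auto. }
  assert (B2 : Cmod (CInt (fun v => f (b, v)) y1 y2) <= (y2 - y1) * M).
  { apply CInt_bound; auto; [|intros v Hv; apply HM; auto].
    apply ex_CInt_glob. intros x. apply RCcont_ver. auto. }
  set (I1 := CInt (fun u => f (u, y1)) a b) in *. set (I2 := CInt (fun u => f (u, y2)) a b) in *.
  set (J1 := CInt (fun v => f (a, v)) y1 y2) in *. set (J2 := CInt (fun v => f (b, v)) y1 y2) in *.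
  replace (I1 - I2)%C with ((I1 + Ci * J2 - I2 - Ci * J1) + (Ci * J1 - Ci * J2))%C by ring.
  rewrite G, Cplus_0_l.
  eapply Rle_trans; [apply Cmod_minus_le|]. rewrite !Cmod_mult, Cmod_Ci. lra.
Qed.

Section GaussSum.

Variable s : C.
Hypothesis Hs : 0 < Im s.

Let cf (n : nat) : C := ee (s * RtoC (INR (S n) * INR (S n))).
Let al (n : nat) : C := (RtoC (2 * PI) * Ci * (RtoC (2 * INR (S n)) * s))%C.

(** The sum of [gaussian s (z + n)] over all integers [n]. Expanding the square splits off
    [gaussian s z] and leaves two series of exponentials, for [n > 0] and [n < 0], so that
    differentiability comes from [exp_series_der]. *)
Definition gauss_sum (z : C) : C :=
  (gaussian s z * (RtoC 1 + (exp_series cf al z + exp_series cf (fun n => - al n) z)))%C.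

Lemma gauss_sum_exp_sum_bound (z : C) (d : R) (n : nat) (sg : C) : Cmod sg = 1 -> 0 <= d ->
  Cmod (cf n) * Cmod (Cexp (sg * al n * z)) * exp (Cmod (sg * al n) * d) <=
  exp (- (2 * PI * Im s) * (INR (S n) * INR (S n)) + (4 * PI * Cmod s * (Cmod z + d)) * INR (S n)).
Proof.
  intros Hsg Hd. assert (HP := PI_RGT_0). unfold cf. rewrite Cmod_ee.
  assert (Ea : Cmod (sg * al n) = 4 * PI * Cmod s * INR (S n)).
  { rewrite Cmod_mult, Hsg. unfold al. rewrite !Cmod_mult, Cmod_Ci, !Cmod_R, !Rabs_pos_eq; [ring| |].
    - assert (h := pos_INR (S n)). lra.
    - lra. }
  rewrite Cmod_Cexp, Ea, <- !exp_plus. apply exp_le_inc.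
  assert (E2 : Re (sg * al n * z) <= 4 * PI * Cmod s * INR (S n) * Cmod z).
  { rewrite <- Ea, <- Cmod_mult. eapply Rle_trans; [apply Rle_abs|apply Re_le_Cmod]. }
  replace (Im (s * RtoC (INR (S n) * INR (S n)))) with (Im s * (INR (S n) * INR (S n)))
    by (destruct s; simpl; ring).
  lra.
Qed.

Lemma gauss_sum_exp_sum (z : C) (sg : C) : Cmod sg = 1 -> exp_sum cf (fun n => sg * al n)%C z 1.
Proof.
  intros Hsg. assert (HP := PI_RGT_0).
  eapply ex_series_le_R; [|apply (gauss_summable (2 * PI * Im s) (4 * PI * Cmod s * (Cmod z + 1))); nra].
  intros n. split; [|apply gauss_sum_exp_sum_bound; auto; lra].
  repeat apply Rmult_le_pos; try apply Cmod_ge_0. left; apply exp_pos.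
Qed.

Lemma al_opp (n : nat) : (RtoC (-1) * al n)%C = (- al n)%C.
Proof. ring. Qed.

Lemma Cder_gauss_sum (z : C) : exists l, Cder gauss_sum z l.
Proof.
  destruct (Cder_gaussian s z) as [l Hl]. eexists. unfold gauss_sum.
  apply (Cder_mult (gaussian s) (fun z => RtoC 1 + (exp_series cf al z + exp_series cf (fun n => - al n) z))%C); [apply Hl|].
  apply Cder_plus; [apply Cder_const|]. apply Cder_plus.
  - apply exp_series_der with 1; [lra|].
    assert (H := gauss_sum_exp_sum z (RtoC 1) Cmod_1). unfold exp_sum in *.
    apply ex_series_ext with (2 := H). intros n. rewrite !Cmult_1_l. auto.
  - apply exp_series_der with 1; [lra|].
    assert (H : exp_sum cf (fun n => RtoC (-1) * al n)%C z 1)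
      by (apply gauss_sum_exp_sum; rewrite Cmod_R, Rabs_left; lra).
    unfold exp_sum in *.
    apply ex_series_ext with (2 := H). intros n. rewrite al_opp. auto.
Qed.

Lemma gaussian_term (z : C) (n : nat) (e : R) : (e = 1 \/ e = -1) ->
  gaussian s (z + RtoC (e * INR (S n))) = (gaussian s z * (cf n * Cexp (RtoC e * al n * z)))%C.
Proof.
  intros He. unfold gaussian, cf, al.
  replace (Cexp (RtoC e * (RtoC (2 * PI) * Ci * (RtoC (2 * INR (S n)) * s)) * z))
    with (ee (RtoC e * (RtoC (2 * INR (S n)) * s) * z)) by (unfold ee; f_equal; ring).
  rewrite <- !ee_plus. f_equal.
  rewrite !RtoC_mult. destruct He; subst e; ring.
Qed.

Lemma gaussian_abs_sum (z : C) (e : R) : (e = 1 \/ e = -1) ->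
  abs_sum (fun n => gaussian s (z + RtoC (e * INR (S n))))%C.
Proof.
  intros He. apply (abs_sum_ext (fun n => gaussian s z * (cf n * Cexp (RtoC e * al n * z)))%C).
  { intros n. rewrite gaussian_term; auto. }
  apply abs_sum_scal. assert (HP := PI_RGT_0).
  apply abs_sum_le with (fun n => exp (- (2 * PI * Im s) * (INR (S n) * INR (S n)) + (4 * PI * Cmod s * (Cmod z + 0)) * INR (S n))).
  - intros n. eapply Rle_trans; [|apply (gauss_sum_exp_sum_bound z 0 n (RtoC e)); [|lra]].
    + rewrite Rmult_0_r, exp_0, Rmult_1_r, Cmod_mult. lra.
    + rewrite Cmod_R. destruct He; subst e; [apply Rabs_pos_eq|rewrite Rabs_left]; lra.
  - apply gauss_summable. nra.
Qed.

Lemma gauss_sum_Cseries (z : C) : gauss_sum z =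
  (gaussian s z + Cseries (fun n => gaussian s (z + RtoC (1 * INR (S n))) + gaussian s (z + RtoC (-1 * INR (S n)))))%C.
Proof.
  rewrite Cseries_plus by (apply gaussian_abs_sum; auto).
  unfold gauss_sum, exp_series.
  assert (E : forall e, e = 1 \/ e = -1 -> Cseries (fun n => gaussian s (z + RtoC (e * INR (S n)))) =
     (gaussian s z * Cseries (fun n => cf n * Cexp (RtoC e * al n * z)))%C).
  { intros e He. rewrite <- Cseries_scal.
    - apply Cseries_ext. intros n. apply gaussian_term. auto.
    - assert (N : gaussian s z <> RtoC 0) by apply Cexp_neq_0.
      apply (abs_sum_ext (fun n => / gaussian s z * gaussian s (z + RtoC (e * INR (S n))))%C).
      + intros n. rewrite gaussian_term by auto. field. auto.
      + apply abs_sum_scal. apply gaussian_abs_sum. auto. }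
  rewrite (E 1), (E (-1)) by auto.
  rewrite (Cseries_ext (fun n => cf n * Cexp (RtoC 1 * al n * z))%C (fun n => cf n * Cexp (al n * z))%C)
    by (intros; rewrite Cmult_1_l; auto).
  rewrite (Cseries_ext (fun n => cf n * Cexp (RtoC (-1) * al n * z))%C (fun n => cf n * Cexp (- al n * z))%C)
    by (intros; rewrite al_opp; auto).
  ring.
Qed.

Lemma sym_sum_csum_pairs (a : Z -> C) (N : nat) :
  sym_sum a N = (a 0%Z + csum (fun n => a (Z.of_nat (S n)) + a (- Z.of_nat (S n))%Z) N)%C.
Proof.
  induction N as [|N IH]; [simpl; ring|].
  change (sym_sum a (S N)) with (sym_sum a N + a (Z.of_nat (S N)) + a (- Z.of_nat (S N))%Z)%C.
  rewrite IH. set (g := fun n => (a (Z.of_nat (S n)) + a (- Z.of_nat (S n))%Z)%C).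
  change (csum g (S N)) with (csum g N + (a (Z.of_nat (S N)) + a (- Z.of_nat (S N))%Z))%C. ring.
Qed.

Lemma gauss_sum_lim (z : C) : forall eps, 0 < eps -> exists N0, forall N, (N0 <= N)%nat ->
  Cmod (sym_sum (fun m => gaussian s (z + RtoC (IZR m))) N - gauss_sum z) <= eps.
Proof.
  intros eps He.
  assert (Hs2 : abs_sum (fun n => gaussian s (z + RtoC (1 * INR (S n))) + gaussian s (z + RtoC (-1 * INR (S n))))%C)
    by (apply abs_sum_plus; apply gaussian_abs_sum; auto).
  destruct (csum_lim _ Hs2 eps He) as [N0 HN0].
  exists N0. intros N HN. rewrite gauss_sum_Cseries, sym_sum_csum_pairs.
  rewrite (csum_ext _ (fun n => gaussian s (z + RtoC (1 * INR (S n))) + gaussian s (z + RtoC (-1 * INR (S n))))%C).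
  - rewrite Cplus_0_r. match goal with |- Cmod ?x <= _ => replace x with
     (csum (fun n => gaussian s (z + RtoC (1 * INR (S n))) + gaussian s (z + RtoC (-1 * INR (S n)))) N -
      Cseries (fun n => gaussian s (z + RtoC (1 * INR (S n))) + gaussian s (z + RtoC (-1 * INR (S n)))))%C by ring end.
    auto.
  - intros k _. rewrite opp_IZR, <- INR_IZR_INZ.
    replace (1 * INR (S k)) with (INR (S k)) by ring. replace (-1 * INR (S k)) with (- INR (S k)) by ring. auto.
Qed.

Lemma sym_sum_shift (a : Z -> C) (N : nat) :
  sym_sum (fun m => a (m + 1)%Z) N = (sym_sum a N + a (Z.of_nat N + 1)%Z - a (- Z.of_nat N)%Z)%C.
Proof.
  induction N as [|N IH].
  - simpl. ring.
  - change (sym_sum (fun m => a (m + 1)%Z) (S N)) with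
      (sym_sum (fun m => a (m + 1)%Z) N + a (Z.of_nat (S N) + 1)%Z + a (- Z.of_nat (S N) + 1)%Z)%C.
    change (sym_sum a (S N)) with (sym_sum a N + a (Z.of_nat (S N)) + a (- Z.of_nat (S N))%Z)%C.
    rewrite IH. replace (- Z.of_nat (S N) + 1)%Z with (- Z.of_nat N)%Z by lia.
    replace (Z.of_nat N + 1)%Z with (Z.of_nat (S N)) by lia. ring.
Qed.

(** Shifting the summation index changes a symmetric partial sum by two boundary terms, which
    decay. *)
Lemma gauss_sum_periodic (x : R) : gauss_sum (x + 1, 0) = gauss_sum (x, 0).
Proof.
  apply Ceq_minus. apply Cmod_small_0. intros eps He.
  destruct (gauss_sum_lim (x + 1, 0) (eps / 4)) as [N1 H1]; [lra|].
  destruct (gauss_sum_lim (x, 0) (eps / 4)) as [N2 H2]; [lra|].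
  destruct (gaussian_decay s 0 (eps / 4) Hs) as [X [HX HD]]; [lra|lra|].
  destruct (archimed (X + Rabs x)) as [Ar _].
  set (N := (N1 + N2 + Z.to_nat (up (X + Rabs x)))%nat).
  specialize (H1 N ltac:(lia)). specialize (H2 N ltac:(lia)).
  assert (HN : X + Rabs x <= INR N).
  { rewrite INR_IZR_INZ. left. eapply Rlt_le_trans; [apply Ar|]. apply IZR_le. lia. }
  rewrite (sym_sum_ext _ (fun m => (fun k => gaussian s ((x, 0) + RtoC (IZR k))%C) (m + 1)%Z)) in H1.
  - rewrite (sym_sum_shift (fun k => gaussian s ((x, 0) + RtoC (IZR k)))%C) in H1. cbv beta in H1.
    set (A := sym_sum _ N) in *.
    set (g1 := gaussian s ((x, 0) + RtoC (IZR (Z.of_nat N + 1)))) in *.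
    set (g2 := gaussian s ((x, 0) + RtoC (IZR (- Z.of_nat N)))) in *.
    assert (B1 : Cmod g1 <= eps / 4).
    { unfold g1. replace ((x, 0) + RtoC (IZR (Z.of_nat N + 1)))%C with ((x + (INR N + 1), 0) : C).
      - apply HD; [|rewrite Rabs_R0; lra].
        assert (hx := Rle_abs (- x)). rewrite Rabs_Ropp in hx. rewrite Rabs_pos_eq; lra.
      - rewrite plus_IZR, <- INR_IZR_INZ. apply injective_projections; simpl; ring. }
    assert (B2 : Cmod g2 <= eps / 4).
    { unfold g2. replace ((x, 0) + RtoC (IZR (- Z.of_nat N)))%C with ((x - INR N, 0) : C).
      - apply HD; [|rewrite Rabs_R0; lra].
        assert (hx := Rle_abs x). rewrite Rabs_left1; lra.
      - rewrite opp_IZR, <- INR_IZR_INZ. apply injective_projections; simpl; ring. }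
    set (G1 := gauss_sum ((x + 1)%R, 0)) in *. set (G0 := gauss_sum (x, 0)) in *.
    replace (G1 - G0)%C with
      ((A - G0) - (A + g1 - g2 - G1) + (g1 - g2))%C by ring.
    eapply Rle_trans; [apply Cmod_triangle|].
    assert (T1 := Cmod_minus_le (A - G0) (A + g1 - g2 - G1)).
    assert (T2 := Cmod_minus_le g1 g2). lra.
  - intros m. cbv beta. f_equal. rewrite plus_IZR. apply injective_projections; simpl; ring.
Qed.

Lemma RCcont_gaussian (y x : R) : RCcont (fun x => gaussian s (x, y)) x.
Proof. apply RCcont_hor. apply Ccont_gaussian. Qed.

Lemma gaussian_mod_decay (u : R -> C) : (forall x, Cmod (u x) = 1) ->
  forall eps, 0 < eps -> exists X, 0 < X /\ forall x, X <= Rabs x -> Cmod (gaussian s (x, 0) * u x) <= eps.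
Proof.
  intros Hu eps He. destruct (gaussian_decay s 0 eps Hs) as [X [HX HD]]; [lra|auto|].
  exists X. split; auto. intros x Hx. rewrite Cmod_mult, Hu, Rmult_1_r. apply HD; auto. rewrite Rabs_R0. lra.
Qed.

(** The unfolding step of Poisson summation: [e1 (- k x)] has period 1, so the integrals over
    [[0, 1]] of the shifted Gaussians are integrals of one function over consecutive unit
    windows. *)
Lemma gauss_sum_fourier_is_line_int (k : Z) :
  is_line_int (fun x => gaussian s (x, 0) * e1 (- IZR k * x))%C (fourier (fun x => gauss_sum (x, 0)) k).
Proof.
  set (h := fun x => (gaussian s (x, 0) * e1 (- IZR k * x))%C).
  assert (Hh : forall x, RCcont h x) by (intros x; apply RCcont_mult; [apply RCcont_gaussian|apply RCcont_e1_scal]).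
  set (v := fun (m : R) x => (gaussian s ((x, 0) + RtoC m) * e1 (- IZR k * x))%C).
  assert (Ev : forall m x, v (IZR m) x = h (x + IZR m)).
  { intros m x. unfold v, h. replace ((x, 0) + RtoC (IZR m))%C with ((x + IZR m, 0) : C)
      by (apply injective_projections; simpl; ring). f_equal.
    replace (- IZR k * (x + IZR m)) with (- IZR k * x + IZR (- (k * m))) by (rewrite opp_IZR, mult_IZR; ring).
    rewrite e1_plus, e1_Z. ring. }
  assert (Hv : forall m x, RCcont (v m) x).
  { intros m x. apply RCcont_mult; [|apply RCcont_e1_scal].
    apply RCcont_ext with (f := fun u => gaussian s (1 * u + m, 0)).
    - intros u. f_equal. apply injective_projections; simpl; ring.
    - apply (RCcont_comp_affine (fun u => gaussian s (u, 0))). apply RCcont_gaussian. }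
  set (a := fun m : Z => CInt (v (IZR m)) 0 1).
  assert (Ea : forall m, a m = CInt h (IZR m) (IZR m + 1)).
  { intros m. unfold a. replace (IZR m) with (0 + IZR m) at 2 by ring. rewrite (Rplus_comm (IZR m) 1).
    rewrite <- CInt_shift by (apply ex_CInt_glob; auto). apply CInt_ext. intros x _. apply Ev. }
  assert (Es : forall N, sym_sum a N = CInt h (- INR N) (INR N + 1)).
  { induction N as [|N IH].
    - simpl. rewrite Ea. f_equal; ring.
    - change (sym_sum a (S N)) with (sym_sum a N + a (Z.of_nat (S N)) + a (- Z.of_nat (S N))%Z)%C.
      rewrite IH, !Ea, opp_IZR, <- INR_IZR_INZ, S_INR.
      assert (E : forall p q, ex_CInt h p q) by (intros; apply ex_CInt_glob; auto).
      replace (- (INR N + 1) + 1) with (- INR N) by ring.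
      rewrite CInt_Chasles by auto. rewrite Cplus_comm, CInt_Chasles by auto. auto. }
  set (u := fun n x => (v (1 * INR (S n))%R x + v (-1 * INR (S n))%R x)%C).
  assert (Sb : forall x e, 0 <= x <= 1 -> e = 1 \/ e = -1 -> forall n, Cmod (v (e * INR (S n)) x) <=
    exp (- (2 * PI * Im s) * (INR (S n) * INR (S n)) + (4 * PI * Cmod s) * INR (S n))).
  { intros x e Hx He n. unfold v. rewrite Cmod_mult, Cmod_e1, Rmult_1_r, gaussian_term, Cmod_mult by auto.
    assert (HP := PI_RGT_0).
    assert (B := gauss_sum_exp_sum_bound (x, 0) 0 n (RtoC e)).
    rewrite Rmult_0_r, exp_0, Rmult_1_r, <- Cmod_mult in B.
    eapply Rle_trans; [apply Rmult_le_compat_r; [apply Cmod_ge_0|]|rewrite Rmult_1_l].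
    - rewrite Cmod_gaussian. rewrite <- exp_0. apply exp_le_inc.
      assert (0 <= Im s * (x * x)) by (apply Rmult_le_pos; nra). nra.
    - eapply Rle_trans; [apply B|].
      + rewrite Cmod_R. destruct He; subst e; [apply Rabs_pos_eq|rewrite Rabs_left]; lra.
      + lra.
      + apply exp_le_inc. apply Rplus_le_compat_l. apply Rmult_le_compat_r; [apply pos_INR|].
        assert (Cmod (x, 0) <= 1) by (change ((x, 0) : C) with (RtoC x); rewrite Cmod_R, Rabs_pos_eq; lra).
        assert (h0 := Cmod_ge_0 s). assert (0 <= 4 * PI * Cmod s) by (apply Rmult_le_pos; lra). nra. }
  assert (Sum : ex_series (fun n => exp (- (2 * PI * Im s) * (INR (S n) * INR (S n)) + (4 * PI * Cmod s) * INR (S n)))).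
  { apply gauss_summable. assert (HP := PI_RGT_0). nra. }
  set (b := fun n => 2 * exp (- (2 * PI * Im s) * (INR (S n) * INR (S n)) + (4 * PI * Cmod s) * INR (S n))).
  assert (Ub : forall n x, 0 <= x <= 1 -> Cmod (u n x) <= b n).
  { intros n x Hx. unfold u, b. eapply Rle_trans; [apply Cmod_triangle|].
    assert (A := Sb x 1 Hx ltac:(auto) n). assert (B := Sb x (-1) Hx ltac:(auto) n). lra. }
  assert (Sumb : ex_series b) by apply (ex_series_scal (V := R_NormedModule) 2 _ Sum).
  assert (Hu : forall n x, RCcont (u n) x) by (intros; apply RCcont_plus; auto).
  assert (Eu : forall x, Cseries (fun n => u n x) = (gauss_sum (x, 0) * e1 (- IZR k * x) - h x)%C).
  { intros x. rewrite gauss_sum_Cseries. unfold h.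
    assert (AS : abs_sum (fun n => gaussian s ((x, 0) + RtoC (1 * INR (S n))) + gaussian s ((x, 0) + RtoC (-1 * INR (S n))))%C)
      by (apply abs_sum_plus; apply gaussian_abs_sum; auto).
    match goal with |- _ = ?r => replace r with
      (e1 (- IZR k * x) * Cseries (fun n => gaussian s ((x, 0) + RtoC (1 * INR (S n))) + gaussian s ((x, 0) + RtoC (-1 * INR (S n)))))%C by ring end.
    rewrite <- Cseries_scal by auto. apply Cseries_ext. intros n. unfold u, v. ring. }
  assert (HG : forall x, RCcont (fun x => gauss_sum (x, 0) * e1 (- IZR k * x))%C x).
  { apply (RCcont_fourier_arg (fun x => gauss_sum (x, 0))). intros x. apply RCcont_hor.
    destruct (Cder_gauss_sum (x, 0)) as [l Hl]. apply (Cder_cont _ _ _ Hl). }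
  assert (HX : ex_CInt (fun x => Cseries (fun n => u n x)) 0 1).
  { apply (ex_RInt_ext (V := C_R_CompleteNormedModule) (fun x => gauss_sum (x, 0) * e1 (- IZR k * x) - h x)%C).
    - intros x _. rewrite Eu. auto.
    - apply ex_CInt_minus; apply ex_CInt_glob; auto. }
  assert (EF : fourier (fun x => gauss_sum (x, 0)) k = (a 0%Z + Cseries (fun n => CInt (u n) 0 1))%C).
  { rewrite (Cseries_CInt u b) by (auto; lra).
    rewrite (CInt_ext _ (fun x => gauss_sum (x, 0) * e1 (- IZR k * x) - h x)%C) by (intros; apply Eu).
    rewrite CInt_minus by (apply ex_CInt_glob; auto). rewrite Ea, Rplus_0_l. unfold fourier. ring. }
  apply is_line_int_of_unit_windows; auto.
  - apply gaussian_mod_decay. intros x. apply Cmod_e1.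
  - intros eps He.
    assert (AS : abs_sum (fun n => CInt (u n) 0 1)).
    { apply abs_sum_le with b; auto. intros n. replace (b n) with ((1 - 0) * b n) by ring.
      apply CInt_bound; auto; [lra|]. apply ex_CInt_glob. auto. }
    destruct (csum_lim _ AS eps He) as [N0 HN0]. exists N0. intros N HN.
    rewrite <- Es, sym_sum_csum_pairs, EF.
    rewrite (csum_ext _ (fun n => CInt (u n) 0 1)).
    + match goal with |- Cmod ?x <= _ => replace x with (csum (fun n => CInt (u n) 0 1) N - Cseries (fun n => CInt (u n) 0 1))%C by ring end.
      auto.
    + intros n _. unfold a, u. rewrite CInt_plus by (apply ex_CInt_glob; auto).
      rewrite opp_IZR, <- INR_IZR_INZ. rewrite Rmult_1_l. replace (-1 * INR (S n)) with (- INR (S n)) by ring. auto.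
Qed.

(** The real part of the shift displaces the ends of the truncated integral; the imaginary part is a
    change of contour whose vertical sides decay. *)
Lemma is_line_int_gaussian_shift (p q : R) (I0 : C) : is_line_int (fun x => gaussian s (x, 0)) I0 ->
  is_line_int (fun x => gaussian s (x + p, q)) I0.
Proof.
  intros H eps He.
  assert (Hdec : forall eps, 0 < eps -> exists X, 0 < X /\ forall x, X <= Rabs x -> Cmod (gaussian s (x, 0)) <= eps).
  { intros e He'. destruct (gaussian_decay s 0 e Hs) as [X [HX HD]]; [lra|auto|].
    exists X. split; auto. intros x Hx. apply HD; auto. rewrite Rabs_R0. lra. }
  destruct (is_line_int_perturb (fun x => gaussian s (x, 0)) I0 (Rabs p) (RCcont_gaussian 0) (Rabs_pos p) Hdec H (eps / 2))
    as [L1 HL1]; [lra|].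
  assert (Pq := Rabs_pos q). assert (Pp := Rabs_pos p).
  destruct (gaussian_decay s (Rabs q) (eps / (4 * (Rabs q + 1))) Hs) as [X [HX HD]];
    [lra|apply Rdiv_lt_0_compat; lra|].
  exists (Rmax L1 (X + Rabs p)). intros L HL.
  assert (h1 : L1 <= L) by (eapply Rle_trans; [apply Rmax_l|apply HL]).
  assert (h2 : X + Rabs p <= L) by (eapply Rle_trans; [apply Rmax_r|apply HL]).
  rewrite (CInt_shift (fun x => gaussian s (x, q)) p) by (apply ex_CInt_glob, RCcont_gaussian).
  assert (B1 := HL1 L (- L + p) (L + p) h1 ltac:(right; f_equal; ring) ltac:(right; f_equal; ring)).
  set (M := eps / (4 * (Rabs q + 1))) in *.
  assert (HM : 2 * Rabs q * M <= eps / 2).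
  { unfold M. apply Rmult_le_reg_r with (4 * (Rabs q + 1)); [lra|].
    replace (2 * Rabs q * (eps / (4 * (Rabs q + 1))) * (4 * (Rabs q + 1))) with (2 * Rabs q * eps) by (field; lra). nra. }
  assert (Hp1 := Rle_abs p). assert (Hp2 := Rle_abs (- p)). rewrite Rabs_Ropp in Hp2.
  assert (Edge : forall v, Rabs v <= Rabs q -> Cmod (gaussian s (- L + p, v)) <= M /\ Cmod (gaussian s (L + p, v)) <= M).
  { intros v Hv. split; apply HD; auto.
    - rewrite Rabs_left1; lra.
    - rewrite Rabs_pos_eq; lra. }
  assert (B2 : Cmod (CInt (fun x => gaussian s (x, q)) (- L + p) (L + p) - CInt (fun x => gaussian s (x, 0)) (- L + p) (L + p)) <= eps / 2).
  { destruct (Rle_lt_dec 0 q) as [hq|hq].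
    - rewrite Rabs_pos_eq in HM by auto. rewrite Cmod_minus_sym.
      eapply Rle_trans; [apply (hint_shift_bound (gaussian s) 0 q (- L + p) (L + p) M); auto; try lra|lra].
      + apply Cder_gaussian.
      + intros v Hv. apply Edge. rewrite !Rabs_pos_eq; lra.
    - rewrite Rabs_left in HM by auto.
      eapply Rle_trans; [apply (hint_shift_bound (gaussian s) q 0 (- L + p) (L + p) M); auto; try lra|lra].
      + apply Cder_gaussian.
      + intros v Hv. apply Edge. rewrite !Rabs_left1; lra. }
  set (A := CInt (fun x => gaussian s (x, q)) (- L + p) (L + p)) in *.
  set (B := CInt (fun x => gaussian s (x, 0)) (- L + p) (L + p)) in *.
  replace (A - I0)%C with ((A - B) + (B - I0))%C by ring.
  eapply Rle_trans; [apply Cmod_triangle|]. lra.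
Qed.

(** The integral of [e(s x^2)] over the line, introduced as the zeroth Fourier coefficient of
    [gauss_sum] so that its existence is part of the unfolding step. *)
Definition gauss_int : C := fourier (fun x => gauss_sum (x, 0)) 0.

Lemma is_line_int_gauss_int : is_line_int (fun x => gaussian s (x, 0)) gauss_int.
Proof.
  apply is_line_int_ext with (2 := gauss_sum_fourier_is_line_int 0). intros x.
  replace (- 0 * x) with 0 by ring. rewrite e1_0. ring.
Qed.

Lemma s_neq_0 : s <> RtoC 0.
Proof. intros E. rewrite E in Hs. simpl in Hs. lra. Qed.

(** Complete the square: [s x^2 - k x = s (x - k / (2 s))^2 - k^2 / (4 s)], then move the line of
    integration by [k / (2 s)]. *)
Lemma gauss_sum_fourier (k : Z) :
  fourier (fun x => gauss_sum (x, 0)) k = (ee (RtoC (IZR k * IZR k) * (- / (RtoC 4 * s))) * gauss_int)%C.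
Proof.
  assert (Ns := s_neq_0).
  set (ka := (RtoC (IZR k) / (RtoC 2 * s))%C).
  apply (is_line_int_unique (fun x => gaussian s (x, 0) * e1 (- IZR k * x))%C); [apply gauss_sum_fourier_is_line_int|].
  assert (H := is_line_int_gaussian_shift (- Re ka) (- Im ka) gauss_int is_line_int_gauss_int).
  apply is_line_int_ext with (2 := is_line_int_scal (ee (RtoC (IZR k * IZR k) * (- / (RtoC 4 * s)))) _ _
     (fun x => RCcont_ext (fun u => gaussian s (1 * u + - Re ka, - Im ka)) (fun u => gaussian s (u + - Re ka, - Im ka)) x
        (fun u => f_equal (fun t => gaussian s (t + - Re ka, - Im ka)) (Rmult_1_l u))
        (RCcont_comp_affine (fun u => gaussian s (u, - Im ka)) 1 (- Re ka) x (RCcont_gaussian _ _))) H).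
  intros x. rewrite <- ee_R. unfold gaussian. rewrite <- !ee_plus. f_equal.
  replace ((x + - Re ka, - Im ka) : C) with (RtoC x - ka)%C
    by (destruct ka; apply injective_projections; simpl; ring).
  change ((x, 0) : C) with (RtoC x). unfold ka.
  replace (RtoC (- IZR k * x)) with (- RtoC (IZR k) * RtoC x)%C by (rewrite RtoC_mult, RtoC_opp; auto).
  rewrite RtoC_mult. field. auto.
Qed.

End GaussSum.

(** * The theta function *)

Definition tq (tau : C) (k : nat) : C := qpow tau (Z.of_nat (S k) * Z.of_nat (S k)).

Lemma theta_Cseries (tau : C) : theta tau = (RtoC 1 + RtoC 2 * Cseries (tq tau))%C.
Proof.
  unfold theta, Cseries, tq. apply injective_projections; simpl; ring.
Qed.

Lemma Cmod_tq_le (tau : C) (k : nat) : 0 < Im tau ->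
  Cmod (tq tau k) <= exp (- (2 * PI * Im tau)) * exp (- (2 * PI * Im tau * INR k)).
Proof.
  intros H. assert (HP := PI_RGT_0). unfold tq. rewrite Cmod_qpow, mult_IZR, <- INR_IZR_INZ, S_INR, <- exp_plus.
  apply exp_le_inc. assert (h := pos_INR k). assert (0 < PI * Im tau) by (apply Rmult_lt_0_compat; lra).
  assert (INR k + 1 <= (INR k + 1) * (INR k + 1)) by nra.
  assert (PI * Im tau * (INR k + 1) <= PI * Im tau * ((INR k + 1) * (INR k + 1))) by (apply Rmult_le_compat_l; lra).
  lra.
Qed.

Lemma tq_abs_sum (tau : C) : 0 < Im tau -> abs_sum (tq tau).
Proof.
  intros H. assert (HP := PI_RGT_0).
  apply abs_sum_le with (2 := ex_series_exp_geom (exp (- (2 * PI * Im tau))) (2 * PI * Im tau) ltac:(nra)).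
  intros k. apply Cmod_tq_le. auto.
Qed.

Lemma theta_gauss_sum (s : C) : 0 < Im s -> theta s = gauss_sum s (RtoC 0).
Proof.
  intros Hs. rewrite gauss_sum_Cseries, theta_Cseries by auto.
  replace (gaussian s (RtoC 0)) with (RtoC 1).
  - f_equal. rewrite <- Cseries_scal by (apply tq_abs_sum; auto). apply Cseries_ext. intros n.
    assert (E : forall e, e * e = 1 -> gaussian s (RtoC 0 + RtoC (e * INR (S n))) = tq s n).
    { intros e He. unfold gaussian, tq. rewrite qpow_ee. f_equal. rewrite mult_IZR, <- INR_IZR_INZ.
      rewrite Cplus_0_l, <- RtoC_mult.
      replace (e * INR (S n) * (e * INR (S n))) with (INR (S n) * INR (S n) * (e * e)) by ring.
      rewrite He, Rmult_1_r. ring. }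
    rewrite !E by ring. ring.
  - unfold gaussian. rewrite Cmult_0_l, Cmult_0_r. unfold ee. rewrite Cmult_0_r, Cexp_0. auto.
Qed.

Definition q4 (z : C) : C := (RtoC (/ 4) * z)%C.

Lemma Im_q4 (z : C) : Im (q4 z) = Im z / 4.
Proof. unfold q4. simpl. unfold Im. field. Qed.

Lemma H_neq_0 (z : C) : 0 < Im z -> z <> RtoC 0.
Proof. intros H E. rewrite E in H. simpl in H. lra. Qed.

Lemma Cmod_sqr (z : C) : Cmod z * Cmod z = Re z * Re z + Im z * Im z.
Proof.
  unfold Cmod, Re, Im. rewrite sqrt_sqrt; simpl; nra.
Qed.

Lemma Im_Sinv (z : C) : z <> RtoC 0 -> Im (- / z) = Im z / (Cmod z * Cmod z).
Proof.
  intros H. rewrite Cmod_sqr. destruct z as [x y]. simpl. unfold Im; simpl. field.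
  intros E. apply H. assert (x = 0) by nra. assert (y = 0) by nra. subst. auto.
Qed.

Lemma Im_Sinv_pos (z : C) : 0 < Im z -> 0 < Im (- / z).
Proof.
  intros H. rewrite Im_Sinv by (apply H_neq_0; auto).
  assert (P := proj1 (Cmod_gt_0 _) (H_neq_0 z H)).
  apply Rdiv_lt_0_compat; nra.
Qed.

Lemma Sinv_Sinv (z : C) : z <> RtoC 0 -> (- / (- / z))%C = z.
Proof.
  intros H. field. auto.
Qed.

(** The factor of automorphy of theta under inversion, classically [sqrt (z / (2 i))]; the branch is
    left implicit in the integral. *)
Definition mu (z : C) : C := gauss_int (- / z).

(** Fourier inversion of [gauss_sum] at 0 for [s = -1/z]: there [-1 / (4 s) = z / 4], so the
    coefficients are [mu z] times the terms of theta at [z / 4]. *)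
Lemma theta_inversion (z : C) : 0 < Im z -> theta (- / z) = (mu z * theta (q4 z))%C.
Proof.
  intros Hz. set (s := (- / z)%C). assert (Hs : 0 < Im s) by (apply Im_Sinv_pos; auto).
  assert (Nz := H_neq_0 z Hz).
  assert (Hq : 0 < Im (q4 z)) by (rewrite Im_q4; lra).
  rewrite theta_gauss_sum by auto. change (RtoC 0) with ((0, 0) : C).
  destruct (Cder_gauss_sum s Hs (0, 0)) as [l Hl].
  apply Ceq_minus, Cmod_small_0. intros eps He.
  destruct (fourier_inversion (gauss_sum s) 0 0 l) with (eps := eps / 2) as [N1 H1]; auto; [| |lra|].
  { intros x. destruct (Cder_gauss_sum s Hs (x, 0)) as [l' Hl']. apply (Cder_cont _ _ _ Hl'). }
  { intros x. apply gauss_sum_periodic. auto. }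
  assert (Pm := Cmod_ge_0 (mu z)).
  destruct (csum_lim _ (tq_abs_sum _ Hq) (eps / 2 / (2 * (Cmod (mu z) + 1)))) as [N2 H2].
  { apply Rdiv_lt_0_compat; lra. }
  specialize (H1 (N1 + N2)%nat ltac:(lia)). specialize (H2 (N1 + N2)%nat ltac:(lia)).
  set (N := (N1 + N2)%nat) in *.
  assert (E : sym_sum (fun n => fourier (fun x => gauss_sum s (x, 0)) n * e1 (IZR n * 0))%C N =
     (mu z * (RtoC 1 + RtoC 2 * csum (tq (q4 z)) N))%C).
  { rewrite (sym_sum_ext _ (fun n => mu z * qpow (q4 z) (n * n))%C).
    - rewrite sym_sum_csum_pairs. cbv beta.
      assert (Ec : forall M, csum (fun n => mu z * qpow (q4 z) (Z.of_nat (S n) * Z.of_nat (S n)) +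
         mu z * qpow (q4 z) (- Z.of_nat (S n) * - Z.of_nat (S n)))%C M = (RtoC 2 * mu z * csum (tq (q4 z)) M)%C).
      { induction M as [|M IH]; [simpl; ring|].
        change (csum (tq (q4 z)) (S M)) with (csum (tq (q4 z)) M + tq (q4 z) M)%C.
        match goal with |- csum ?g (S M) = _ => change (csum g (S M)) with (csum g M + g M)%C end.
        rewrite IH. cbv beta. change (tq (q4 z) M) with (qpow (q4 z) (Z.of_nat (S M) * Z.of_nat (S M))).
        replace (- Z.of_nat (S M) * - Z.of_nat (S M))%Z with (Z.of_nat (S M) * Z.of_nat (S M))%Z by ring.
        ring. }
      rewrite Ec. simpl (0 * 0)%Z. rewrite qpow_0. ring.
    - intros n. rewrite Rmult_0_r, e1_0, gauss_sum_fourier by auto. unfold mu. fold s.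
      rewrite qpow_ee, mult_IZR.
      replace (- / (RtoC 4 * s))%C with (q4 z).
      + ring.
      + unfold q4, s. rewrite RtoC_inv by lra. field. auto. }
  rewrite E in H1. rewrite theta_Cseries.
  set (A := csum (tq (q4 z)) N) in *. set (B := Cseries (tq (q4 z))) in *. set (G := gauss_sum s (0, 0)) in *.
  replace (G - mu z * (RtoC 1 + RtoC 2 * B))%C with
    (RtoC 2 * mu z * (A - B) - (mu z * (RtoC 1 + RtoC 2 * A) - G))%C by ring.
  eapply Rle_trans; [apply Cmod_minus_le|].
  assert (Q : Cmod (RtoC 2 * mu z * (A - B)) <= eps / 2).
  { rewrite !Cmod_mult, Cmod_R, Rabs_pos_eq by lra.
    apply Rle_trans with (2 * (Cmod (mu z) + 1) * (eps / 2 / (2 * (Cmod (mu z) + 1)))).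
    - apply Rmult_le_compat; auto; try lra. apply Cmod_ge_0.
    - right. field. lra. }
  lra.
Qed.

(** * Scaling and conjugation of the Gaussian integral *)

Lemma gauss_int_scal (la : R) (s : C) : 0 < la -> 0 < Im s -> gauss_int (RtoC (la * la) * s) = (RtoC (/ la) * gauss_int s)%C.
Proof.
  intros Hl Hs.
  assert (Hs' : 0 < Im (RtoC (la * la) * s)).
  { replace (Im (RtoC (la * la) * s)) with (la * la * Im s) by (destruct s; simpl; ring).
    apply Rmult_lt_0_compat; nra. }
  apply (is_line_int_unique (fun x => gaussian (RtoC (la * la) * s) (x, 0))); [apply is_line_int_gauss_int; auto|].
  intros eps He.
  destruct (is_line_int_gauss_int s Hs (eps * la)) as [L0 HL]; [nra|].
  exists (L0 / la). intros L h.
  assert (h' : L0 <= la * L).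
  { apply Rmult_le_compat_l with (r := la) in h; [|lra]. replace (la * (L0 / la)) with L0 in h by (field; lra). auto. }
  specialize (HL _ h').
  rewrite (CInt_ext _ (fun x => gaussian s (la * x, 0)%R)).
  - rewrite (CInt_comp_scal (fun u => gaussian s (u, 0)) la); [|apply ex_CInt_glob, RCcont_gaussian|lra].
    replace (la * - L) with (- (la * L)) by ring.
    set (I := CInt (fun u => gaussian s (u, 0)) (- (la * L)) (la * L)) in *.
    replace (RtoC (/ la) * I - RtoC (/ la) * gauss_int s)%C with (RtoC (/ la) * (I - gauss_int s))%C by ring.
    rewrite Cmod_mult, Cmod_R, Rabs_pos_eq by (left; apply Rinv_0_lt_compat; auto).
    apply Rmult_le_reg_l with la; auto. rewrite <- Rmult_assoc, Rinv_r by lra. lra.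
  - intros x _. cbv beta. unfold gaussian. f_equal. apply injective_projections; simpl; ring.
Qed.

Lemma CInt_conj (f : R -> C) (a b : R) : ex_CInt f a b ->
  CInt (fun x => Cconj (f x)) a b = Cconj (CInt f a b).
Proof.
  intros H. apply CInt_unique. assert (I := CInt_correct f a b H).
  assert (H1 := is_RInt_fct_extend_fst (U := R_NormedModule) (V := R_NormedModule) f a b _ I).
  assert (H2 := is_RInt_fct_extend_snd (U := R_NormedModule) (V := R_NormedModule) f a b _ I).
  apply (is_RInt_fct_extend_pair (U := R_NormedModule) (V := R_NormedModule)); simpl; auto.
  apply (is_RInt_opp (V := R_NormedModule)). auto.
Qed.

Lemma Cexp_conj (z : C) : Cexp (Cconj z) = Cconj (Cexp z).
Proof.
  destruct z as [a b]. unfold Cexp, Cconj; simpl. rewrite cos_neg, sin_neg. apply injective_projections; simpl; ring.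
Qed.

Lemma gauss_int_conj (s : C) : 0 < Im s -> gauss_int (- Cconj s) = Cconj (gauss_int s).
Proof.
  intros Hs.
  assert (Hs' : 0 < Im (- Cconj s)) by (destruct s; simpl in *; lra).
  apply (is_line_int_unique (fun x => gaussian (- Cconj s) (x, 0))); [apply is_line_int_gauss_int; auto|].
  intros eps He. destruct (is_line_int_gauss_int s Hs eps He) as [L0 HL]. exists L0. intros L h. specialize (HL L h).
  rewrite (CInt_ext _ (fun x => Cconj (gaussian s (x, 0)))).
  - rewrite CInt_conj by (apply ex_CInt_glob, RCcont_gaussian).
    set (I := CInt (fun u => gaussian s (u, 0)) (- L) L) in *.
    replace (Cconj I - Cconj (gauss_int s))%C with (Cconj (I - gauss_int s))
      by (apply injective_projections; simpl; ring).
    rewrite Cmod_conj. auto.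
  - intros x _. unfold gaussian, ee. rewrite <- Cexp_conj. f_equal.
    destruct s. apply injective_projections; simpl; ring.
Qed.

Lemma mu_4 (z : C) : 0 < Im z -> mu (RtoC 4 * z) = (RtoC 2 * mu z)%C.
Proof.
  intros Hz. assert (Nz := H_neq_0 z Hz). unfold mu.
  replace (- / (RtoC 4 * z))%C with (RtoC (/ 2 * / 2) * (- / z))%C.
  - rewrite gauss_int_scal; [|lra|apply Im_Sinv_pos; auto]. rewrite Rinv_inv. auto.
  - replace (/ 2 * / 2) with (/ 4) by lra. rewrite RtoC_inv by lra. field. auto.
Qed.

(** Write [-1/z] as [|z|^(-2)] times [- Cconj z]: scaling extracts [|z|], and conjugation preserves
    the modulus. *)
Lemma Cmod_mu_inv (z : C) : 0 < Im z -> Cmod (mu z) = Cmod z * Cmod (mu (- / z)).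
Proof.
  intros Hz. assert (Nz := H_neq_0 z Hz). assert (Pz := proj1 (Cmod_gt_0 _) Nz).
  unfold mu at 2. rewrite Sinv_Sinv by auto. unfold mu.
  replace (- / z)%C with (RtoC (/ Cmod z * / Cmod z) * (- Cconj z))%C.
  - rewrite gauss_int_scal; [|apply Rinv_0_lt_compat; auto|destruct z; simpl in *; lra].
    rewrite gauss_int_conj, Cmod_mult, Cmod_conj, Cmod_R, Rinv_inv, Rabs_pos_eq by lra. auto.
  - rewrite <- Rinv_mult, Cmod_sqr. destruct z as [x y]. apply injective_projections; simpl; field;
    intros E; apply Nz; assert (x = 0) by nra; assert (y = 0) by nra; subst; auto.
Qed.

(** * Reduction to the region [Im z >= 3/4] *)

(** Translate to [|Re w| <= 1/2]. If [Im w < 3/4], then [|w|^2 <= 1/4 + 9/16 = 13/16], so inversion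
    multiplies the height by at least [16/13]; above [3/4 (13/16)^n] at most [n] inversions suffice.
    Staying at height [3/4], below [sqrt 3 / 2], makes the number of steps finite without a
    fundamental domain. *)
Lemma upper_half_ind (P : C -> Prop) :
  (forall z, 0 < Im z -> (P (z + RtoC 1)%C <-> P z)) ->
  (forall z, 0 < Im z -> P (- / z)%C -> P z) ->
  (forall z, 3 / 4 <= Im z -> P z) ->
  forall z, 0 < Im z -> P z.
Proof.
  intros HT HS HF.
  assert (HTn : forall n z, 0 < Im z -> (P (z + RtoC (INR n))%C <-> P z)).
  { induction n as [|n IH]; intros z Hz.
    - simpl. rewrite Cplus_0_r. tauto.
    - rewrite S_INR, RtoC_plus, Cplus_assoc, HT; [apply IH; auto|]. destruct z; simpl in *; lra. }
  assert (HTz : forall k z, 0 < Im z -> (P (z + RtoC (IZR k))%C <-> P z)).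
  { intros k z Hz. destruct (Z_le_gt_dec 0 k).
    - rewrite <- (Z2Nat.id k), <- INR_IZR_INZ by auto. auto.
    - rewrite <- (HTn (Z.to_nat (- k)) (z + RtoC (IZR k))%C).
      + rewrite INR_IZR_INZ, Z2Nat.id, opp_IZR by lia.
        replace (z + RtoC (IZR k) + RtoC (- IZR k))%C with z by (rewrite RtoC_opp; ring). tauto.
      + destruct z; simpl in *; lra. }
  assert (HI : forall n z, 3 / 4 * (13 / 16) ^ n <= Im z -> P z).
  { induction n as [|n IH]; intros z Hz.
    - apply HF. simpl in Hz. lra.
    - assert (Pp : 0 < (13 / 16) ^ n) by (apply pow_lt; lra). simpl in Hz.
      assert (Hz0 : 0 < Im z) by nra.
      set (k := up (Re z - / 2)). destruct (archimed (Re z - / 2)) as [A1 A2]. fold k in A1, A2.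
      rewrite <- (HTz (- k)%Z) by auto.
      set (w := (z + RtoC (IZR (- k)))%C).
      assert (Ew : Im w = Im z) by (unfold w; destruct z; simpl; ring).
      assert (Rw : - / 2 <= Re w <= / 2).
      { unfold w. rewrite opp_IZR. destruct z; simpl in *. lra. }
      destruct (Rle_lt_dec (3 / 4) (Im w)) as [h|h]; [apply HF; auto|].
      apply HS; [lra|]. apply IH. rewrite Im_Sinv by (apply H_neq_0; lra).
      rewrite Cmod_sqr.
      assert (Q : 0 < Re w * Re w + Im w * Im w <= 13 / 16) by nra.
      apply Rmult_le_reg_r with (Re w * Re w + Im w * Im w); [lra|].
      replace (Im w / (Re w * Re w + Im w * Im w) * (Re w * Re w + Im w * Im w)) with (Im w) by (field; lra).
      rewrite Ew in *. nra. }
  intros z Hz.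
  destruct (pow_lt_1_zero (13 / 16) ltac:(rewrite Rabs_pos_eq; lra) (Im z) Hz) as [n Hn].
  specialize (Hn n (le_n n)). apply (HI n).
  assert (Pp : 0 < (13 / 16) ^ n) by (apply pow_lt; lra).
  rewrite Rabs_pos_eq in Hn by lra. lra.
Qed.

(** * The two parts of theta and the nonvanishing form of weight 3 *)

Lemma Cmod_Cseries_geom (u : nat -> C) (K a : R) : 0 < a -> 0 <= K ->
  (forall k, Cmod (u k) <= K * exp (- (a * INR k))) -> Cmod (Cseries u) <= 2 * (K / (1 - exp (- a))).
Proof.
  intros Ha HK H. eapply Rle_trans; [apply Cmod_Cseries_le with (1 := H); apply ex_series_exp_geom; auto|].
  right. f_equal. rewrite Series_scal_l. unfold Rdiv. f_equal.
  rewrite <- Series_geom.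
  - apply Series_ext. intros n. induction n as [|n IH].
    + simpl. rewrite Rmult_0_r, Ropp_0, exp_0. auto.
    + rewrite S_INR. simpl. rewrite <- IH, <- exp_plus. f_equal. ring.
  - rewrite Rabs_pos_eq by (left; apply exp_pos). rewrite <- exp_0. apply exp_increasing. lra.
Qed.

(* [th0 z] and [th1 z] collect the even and the odd squares of the series [theta (z / 4)]. *)
Definition th0 (z : C) : C := theta z.
Definition th1 (z : C) : C := (theta (q4 z) - theta z)%C.

(** The even squares [(2 n)^2] in the series of theta at [z / 4] reproduce theta at [z] and
    cancel. *)
Lemma th1_Cseries (z : C) : 0 < Im z ->
  th1 z = (RtoC 2 * Cseries (fun j => qpow (q4 z) ((2 * Z.of_nat j + 1) * (2 * Z.of_nat j + 1))))%C.
Proof.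
  intros Hz. assert (Hq : 0 < Im (q4 z)) by (rewrite Im_q4; lra).
  unfold th1. rewrite !theta_Cseries.
  (* [tq] at index [k] carries the square of [k + 1], so odd squares sit at even indices. *)
  assert (Ee : forall k, tq (q4 z) (2 * k) = qpow (q4 z) ((2 * Z.of_nat k + 1) * (2 * Z.of_nat k + 1))).
  { intros k. unfold tq. f_equal. lia. }
  assert (Eo : forall k, tq (q4 z) (2 * k + 1) = tq z k).
  { intros k. unfold tq. rewrite !qpow_ee. f_equal. unfold q4.
    replace (Z.of_nat (S (2 * k + 1)) * Z.of_nat (S (2 * k + 1)))%Z
      with (4 * (Z.of_nat (S k) * Z.of_nat (S k)))%Z by lia.
    rewrite mult_IZR, RtoC_mult, RtoC_inv by lra. field. }
  assert (A := tq_abs_sum _ Hq).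
  rewrite (Cseries_even_odd (tq (q4 z)) A).
  - rewrite (Cseries_ext _ _ Ee), (Cseries_ext _ _ Eo). ring.
  - assert (HP := PI_RGT_0).
    apply abs_sum_le with (2 := ex_series_exp_geom (exp (- (2 * PI * Im (q4 z)))) (2 * PI * Im (q4 z)) ltac:(nra)).
    intros k. eapply Rle_trans; [apply Cmod_tq_le; auto|]. apply Rmult_le_compat_l; [left; apply exp_pos|].
    apply exp_le_inc. apply Ropp_le_contravar. apply Rmult_le_compat_l; [nra|]. apply le_INR. lia.
  - apply (abs_sum_ext (tq z)); [intros; symmetry; apply Eo|]. apply tq_abs_sum. auto.
Qed.

Lemma th0_T (z : C) : th0 (z + RtoC 1) = th0 z.
Proof.
  unfold th0. rewrite !theta_Cseries. f_equal. f_equal. apply Cseries_ext. intros k. unfold tq.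
  rewrite qpow_shift, Rmult_1_r, e1_Z. ring.
Qed.

Lemma th1_odd_abs_sum (z : C) : 0 < Im z ->
  abs_sum (fun j => qpow (q4 z) ((2 * Z.of_nat j + 1) * (2 * Z.of_nat j + 1))).
Proof.
  intros Hz. assert (Hq : 0 < Im (q4 z)) by (rewrite Im_q4; lra). assert (HP := PI_RGT_0).
  apply abs_sum_le with (2 := ex_series_exp_geom (exp (- (2 * PI * Im (q4 z)))) (2 * PI * Im (q4 z)) ltac:(nra)).
  intros k. replace ((2 * Z.of_nat k + 1) * (2 * Z.of_nat k + 1))%Z
    with (Z.of_nat (S (2 * k)) * Z.of_nat (S (2 * k)))%Z by lia.
  eapply Rle_trans; [apply (Cmod_tq_le (q4 z) (2 * k)); auto|]. apply Rmult_le_compat_l; [left; apply exp_pos|].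
  apply exp_le_inc. apply Ropp_le_contravar. apply Rmult_le_compat_l; [nra|]. apply le_INR. lia.
Qed.

(** Odd squares are [4 (j^2 + j) + 1], so every term picks up [e1 (1/4) = i]. *)
Lemma th1_T (z : C) : 0 < Im z -> th1 (z + RtoC 1) = (Ci * th1 z)%C.
Proof.
  intros Hz.
  assert (Hz' : 0 < Im (z + RtoC 1)) by (destruct z; simpl in *; lra).
  rewrite !th1_Cseries by auto.
  rewrite (Cseries_ext _ (fun j => Ci * qpow (q4 z) ((2 * Z.of_nat j + 1) * (2 * Z.of_nat j + 1)))%C).
  - rewrite Cseries_scal by (apply th1_odd_abs_sum; auto). ring.
  - intros j. replace (q4 (z + RtoC 1)) with (q4 z + RtoC (/ 4))%C by (unfold q4; ring).
    rewrite qpow_shift.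
    replace (IZR ((2 * Z.of_nat j + 1) * (2 * Z.of_nat j + 1)) * / 4)
      with (IZR (Z.of_nat j * Z.of_nat j + Z.of_nat j) + / 4).
    + rewrite e1_plus, e1_Z, e1_quarter. ring.
    + rewrite !mult_IZR, !plus_IZR, !mult_IZR. field.
Qed.

Lemma th0_S (z : C) : 0 < Im z -> th0 (- / z) = (mu z * (th0 z + th1 z))%C.
Proof.
  intros Hz. unfold th0, th1. rewrite theta_inversion by auto. f_equal. ring.
Qed.

(** The value of theta at [-1 / (4 z)] comes from inversion at [4 z], where [mu] doubles. *)
Lemma th1_S (z : C) : 0 < Im z -> th1 (- / z) = (mu z * (th0 z - th1 z))%C.
Proof.
  intros Hz. assert (Nz := H_neq_0 z Hz). unfold th1 at 1.
  replace (q4 (- / z)) with (- / (RtoC 4 * z))%C by (unfold q4; rewrite RtoC_inv by lra; field; auto).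
  rewrite (theta_inversion (RtoC 4 * z)).
  - rewrite mu_4 by auto. replace (q4 (RtoC 4 * z)) with z by (unfold q4; rewrite RtoC_inv by lra; field).
    fold (th0 (- / z)). rewrite th0_S by auto. unfold th0, th1. ring.
  - replace (Im (RtoC 4 * z)) with (4 * Im z) by (destruct z; simpl; ring). lra.
Qed.

(** By [PI > 3] these bound [|q|] and [|q^(1/4)|] at height [3/4]. They follow from [(3/2)^9 > 38]
    and [(73/64)^8 > 100/35] through [exp x >= 1 + x]. *)
Lemma exp_neg_bounds : exp (- (9 / 2)) <= / 38 /\ exp (- (9 / 8)) <= 35 / 100.
Proof.
  split.
  - rewrite exp_Ropp. apply Rinv_le_contravar; [lra|].
    replace (9 / 2) with (/ 2 + / 2 + / 2 + / 2 + / 2 + / 2 + / 2 + / 2 + / 2) by lra.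
    rewrite !exp_plus. assert (h := exp_ge_1x (/ 2)). set (e := exp (/ 2)) in *.
    assert (e * e >= 9 / 4) by nra. assert (e * e * e >= 27 / 8) by nra.
    assert (e * e * e * (e * e * e) >= 11) by nra.
    replace (e * e * e * e * e * e * e * e * e) with ((e * e * e * (e * e * e)) * (e * e * e)) by ring.
    assert (e * e * e * (e * e * e) >= 729 / 64) by nra. nra.
  - rewrite exp_Ropp. replace (35 / 100) with (/ (100 / 35)) by lra. apply Rinv_le_contravar; [lra|].
    replace (9 / 8) with (9 / 64 + 9 / 64 + 9 / 64 + 9 / 64 + (9 / 64 + 9 / 64 + 9 / 64 + 9 / 64)) by lra.
    rewrite (exp_plus (9 / 64 + 9 / 64 + 9 / 64 + 9 / 64)). rewrite !exp_plus.
    assert (h := exp_ge_1x (9 / 64)). set (e := exp (9 / 64)) in *.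
    assert (e * e >= 1301 / 1000) by nra.
    replace (e * e * e * e) with ((e * e) * (e * e)) by ring.
    assert ((e * e) * (e * e) >= 16926 / 10000) by nra. nra.
Qed.

Lemma th0_bound (z : C) : 3 / 4 <= Im z -> Cmod (th0 z - RtoC 1) <= / 8.
Proof.
  intros Hz. unfold th0. rewrite theta_Cseries.
  replace (RtoC 1 + RtoC 2 * Cseries (tq z) - RtoC 1)%C with (RtoC 2 * Cseries (tq z))%C by ring.
  rewrite Cmod_mult, Cmod_R, Rabs_pos_eq by lra.
  assert (P3 := PI2_3_2). set (a := 2 * PI * Im z). assert (Ha : 9 / 2 <= a) by (unfold a; nra).
  assert (E : exp (- a) <= / 38).
  { eapply Rle_trans; [|apply exp_neg_bounds]. apply exp_le_inc. lra. }
  assert (Pe := exp_pos (- a)).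
  assert (B := Cmod_Cseries_geom (tq z) (exp (- a)) a ltac:(lra) ltac:(lra) (fun k => Cmod_tq_le z k ltac:(lra))).
  assert (Q : exp (- a) / (1 - exp (- a)) <= / 37).
  { apply Rmult_le_reg_r with (1 - exp (- a)); [lra|].
    unfold Rdiv. rewrite Rmult_assoc, Rinv_l by lra. lra. }
  lra.
Qed.

Lemma th1_bound (z : C) : 3 / 4 <= Im z ->
  Cmod (th1 z - RtoC 2 * qpow (q4 z) 1) <= / 50 * exp (- (PI / 2 * Im z)).
Proof.
  intros Hz. assert (P3 := PI2_3_2). rewrite th1_Cseries by lra.
  rewrite Cseries_incr_1 by (apply th1_odd_abs_sum; lra). simpl (Z.of_nat 0).
  replace ((2 * 0 + 1) * (2 * 0 + 1))%Z with 1%Z by ring.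
  set (r := exp (- (PI / 2 * Im z))). assert (Pr : 0 < r) by apply exp_pos.
  set (u := fun k => qpow (q4 z) ((2 * Z.of_nat (S k) + 1) * (2 * Z.of_nat (S k) + 1))).
  replace (RtoC 2 * (qpow (q4 z) 1 + Cseries u) - RtoC 2 * qpow (q4 z) 1)%C with (RtoC 2 * Cseries u)%C by ring.
  rewrite Cmod_mult, Cmod_R, Rabs_pos_eq by lra.
  (* The odd square after 1 is 9; the gap 8, divided by 4, is [q^2], of modulus [exp (- a)]. *)
  set (a := 4 * PI * Im z). assert (Ha : 9 <= a) by (unfold a; nra).
  assert (Pe := exp_pos (- a)).
  assert (E : exp (- a) <= / 1000).
  { apply Rle_trans with (exp (- (9 / 2)) * exp (- (9 / 2))).
    - rewrite <- exp_plus. apply exp_le_inc. lra.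
    - assert (h := proj1 exp_neg_bounds). assert (h' := exp_pos (- (9 / 2))). nra. }
  assert (B : Cmod (Cseries u) <= 2 * (r * exp (- a) / (1 - exp (- a)))).
  { apply Cmod_Cseries_geom; [lra|nra|]. intros k. unfold u, r. rewrite Cmod_qpow, Im_q4, <- !exp_plus.
    apply exp_le_inc. rewrite mult_IZR, plus_IZR, mult_IZR, <- INR_IZR_INZ, S_INR. unfold a.
    assert (h := pos_INR k). set (n := INR k) in *. assert (Hp : 0 < PI * Im z) by nra.
    assert (0 <= PI * Im z * (n * n + n)) by (apply Rmult_le_pos; nra).
    replace (2 * PI * ((2 * (n + 1) + 1) * (2 * (n + 1) + 1)) * (Im z / 4)) with
      (PI / 2 * Im z + 4 * PI * Im z + 4 * PI * Im z * n + 2 * (PI * Im z * (n * n + n))) by field. lra. }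
  assert (Q : r * exp (- a) / (1 - exp (- a)) <= r * / 900).
  { unfold Rdiv. rewrite Rmult_assoc. apply Rmult_le_compat_l; [lra|].
    apply Rmult_le_reg_r with (1 - exp (- a)); [lra|]. rewrite Rmult_assoc, Rinv_l by lra. lra. }
  lra.
Qed.

Lemma th_norms (z : C) : 3 / 4 <= Im z ->
  7 / 8 <= Cmod (th0 z) <= 9 / 8 /\
  198 / 100 * exp (- (PI / 2 * Im z)) <= Cmod (th1 z) <= 202 / 100 * exp (- (PI / 2 * Im z)) /\
  Cmod (th1 z) <= 71 / 100.
Proof.
  intros Hz. assert (P3 := PI2_3_2). set (r := exp (- (PI / 2 * Im z))).
  assert (B0 := th0_bound z Hz). assert (B1 := th1_bound z Hz). fold r in B1.
  assert (Pr : 0 < r) by apply exp_pos.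
  assert (Er : Cmod (RtoC 2 * qpow (q4 z) 1) = 2 * r).
  { rewrite Cmod_mult, Cmod_R, Rabs_pos_eq, Cmod_qpow, Im_q4 by lra. unfold r. f_equal. f_equal. field. }
  assert (A1 := Cmod_sub_rev (th0 z) (RtoC 1)). rewrite Cmod_1 in A1.
  assert (A2 := Cmod_sub_rev (RtoC 1) (th0 z)). rewrite Cmod_1, Cmod_minus_sym in A2.
  assert (A3 := Cmod_sub_rev (th1 z) (RtoC 2 * qpow (q4 z) 1)). rewrite Er in A3.
  assert (A4 := Cmod_sub_rev (RtoC 2 * qpow (q4 z) 1) (th1 z)). rewrite Er, Cmod_minus_sym in A4.
  assert (Hr : r <= 35 / 100).
  { eapply Rle_trans; [|apply exp_neg_bounds]. apply exp_le_inc. nra. }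
  lra.
Qed.

(** Classically this is [2 eta^6]: weight 3, leading exponent [1/4], and no zeros in the upper half
    plane. *)
Definition theta_disc (z : C) : C := (th0 z * th1 z * (th0 z ^ 4 - th1 z ^ 4))%C.

Lemma theta_disc_bounds (z : C) : 3 / 4 <= Im z ->
  / 2 * exp (- (PI / 2 * Im z)) <= Cmod (theta_disc z) <= 5 * exp (- (PI / 2 * Im z)).
Proof.
  intros Hz. destruct (th_norms z Hz) as [[a1 a2] [[b1 b2] b3]].
  set (r := exp (- (PI / 2 * Im z))) in *. assert (Pr : 0 < r) by apply exp_pos.
  unfold theta_disc. rewrite !Cmod_mult.
  set (x := Cmod (th0 z)) in *. set (y := Cmod (th1 z)) in *.
  assert (y0 : 0 <= y) by apply Cmod_ge_0.
  assert (Q1 := Cmod_sub_rev (th0 z ^ 4) (th1 z ^ 4)).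
  assert (Q2 := Cmod_minus_le (th0 z ^ 4) (th1 z ^ 4)).
  rewrite !Cmod_pow in Q1, Q2. fold x y in Q1, Q2.
  set (w := Cmod (th0 z ^ 4 - th1 z ^ 4)) in *.
  assert (x4 : 58 / 100 <= x ^ 4 <= 161 / 100).
  { replace (x ^ 4) with ((x * x) * (x * x)) by ring.
    assert (76 / 100 <= x * x <= 127 / 100 - / 1000) by nra.
    nra. }
  assert (y4 : 0 <= y ^ 4 <= 26 / 100).
  { replace (y ^ 4) with ((y * y) * (y * y)) by ring.
    assert (0 <= y * y <= 505 / 1000) by nra. nra. }
  assert (xy1 : 7 / 8 * (198 / 100 * r) <= x * y) by (apply Rmult_le_compat; lra).
  assert (xy2 : x * y <= 9 / 8 * (202 / 100 * r)) by (apply Rmult_le_compat; lra).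
  split.
  - apply Rle_trans with ((7 / 8 * (198 / 100 * r)) * (32 / 100)); [lra|]. apply Rmult_le_compat; lra.
  - apply Rle_trans with ((9 / 8 * (202 / 100 * r)) * (187 / 100)); [|lra]. apply Rmult_le_compat; lra.
Qed.

(** At this point [mu] is not yet known to be nonzero. The descent works nevertheless, because the
    vanishing of both parts passes from [z] to [-1/z] whatever the factor is. *)
Lemma th_vec_neq_0 (z : C) : 0 < Im z -> ~ (th0 z = RtoC 0 /\ th1 z = RtoC 0).
Proof.
  revert z. apply upper_half_ind.
  - intros z Hz. rewrite th0_T, th1_T by auto. split; intros H [h1 h2]; apply H; split; auto.
    + rewrite h2. ring.
    + replace (th1 z) with (- Ci * (Ci * th1 z))%C by (rewrite Cmult_assoc; replace (- Ci * Ci)%C with (RtoC 1); [ring|apply injective_projections; simpl; ring]).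
      rewrite h2. ring.
  - intros z Hz H [h1 h2]. apply H. rewrite th0_S, th1_S, h1, h2 by auto. split; ring.
  - intros z Hz [h1 _]. destruct (th_norms z Hz) as [[a _] _]. rewrite h1, Cmod_0 in a. lra.
Qed.

(** Inverting twice applies the square of the matrix [(1 1; 1 -1)], which is 2, to the vector
    [(th0 z, th1 z)]; as this vector is nonzero, the scalar in front of it is 1. *)
Lemma mu_mu (z : C) : 0 < Im z -> (RtoC 2 * mu z * mu (- / z))%C = RtoC 1.
Proof.
  intros Hz. assert (Nz := H_neq_0 z Hz). assert (Hz' := Im_Sinv_pos z Hz).
  assert (E0 := th0_S (- / z) Hz'). assert (E1 := th1_S (- / z) Hz').
  rewrite Sinv_Sinv in E0, E1 by auto. rewrite th0_S, th1_S in E0, E1 by auto.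
  set (c := (RtoC 2 * mu z * mu (- / z))%C).
  assert (F0 : ((RtoC 1 - c) * th0 z)%C = RtoC 0).
  { transitivity (th0 z - c * th0 z)%C; [ring|]. rewrite E0 at 1. unfold c. ring. }
  assert (F1 : ((RtoC 1 - c) * th1 z)%C = RtoC 0).
  { transitivity (th1 z - c * th1 z)%C; [ring|]. rewrite E1 at 1. unfold c. ring. }
  symmetry. apply Ceq_minus. apply NNPP. intros N.
  apply (th_vec_neq_0 z Hz). split; apply NNPP; intros N'; apply (Cmult_neq_0 _ _ N N'); auto.
Qed.

Lemma Cmod_mu (z : C) : 0 < Im z -> 2 * (Cmod (mu z) * Cmod (mu z)) = Cmod z.
Proof.
  intros Hz. assert (Pz := proj1 (Cmod_gt_0 _) (H_neq_0 z Hz)).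
  assert (E := f_equal Cmod (mu_mu z Hz)). rewrite !Cmod_mult, Cmod_1, Cmod_R, Rabs_pos_eq in E by lra.
  assert (E2 := Cmod_mu_inv z Hz).
  rewrite E2 at 2. replace (2 * (Cmod (mu z) * (Cmod z * Cmod (mu (- / z))))) with
    (Cmod z * (2 * Cmod (mu z) * Cmod (mu (- / z)))) by ring. rewrite E. ring.
Qed.

Lemma theta_disc_T (z : C) : 0 < Im z -> theta_disc (z + RtoC 1) = (Ci * theta_disc z)%C.
Proof.
  intros Hz. unfold theta_disc. rewrite th0_T, th1_T by auto. rewrite Cpow_mult_l.
  replace (Ci ^ 4)%C with (RtoC 1) by (simpl; apply injective_projections; simpl; ring). ring.
Qed.

(* The degree six invariant [x y (x^4 - y^4)] of the octahedral group. *)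
Lemma theta_disc_S (z : C) : 0 < Im z -> theta_disc (- / z) = (RtoC 8 * mu z ^ 6 * theta_disc z)%C.
Proof. intros Hz. unfold theta_disc. rewrite th0_S, th1_S by auto. ring. Qed.

Lemma Cmod_theta_disc_S (z : C) : 0 < Im z -> Cmod (theta_disc (- / z)) = Cmod z ^ 3 * Cmod (theta_disc z).
Proof.
  intros Hz. rewrite theta_disc_S by auto. rewrite !Cmod_mult, Cmod_R, Rabs_pos_eq, Cmod_pow by lra.
  rewrite <- (Cmod_mu z Hz). ring.
Qed.

Lemma theta_disc_neq_0 (z : C) : 0 < Im z -> theta_disc z <> RtoC 0.
Proof.
  revert z. apply upper_half_ind.
  - intros z Hz. rewrite theta_disc_T by auto. split; intros H E; apply H.
    + rewrite E. ring.
    + destruct (Ceq_dec (theta_disc z) (RtoC 0)) as [e|n]; auto. exfalso. apply (Cmult_neq_0 _ _ Ci_nz n). auto.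
  - intros z Hz H E. apply H. rewrite theta_disc_S, E by auto. ring.
  - intros z Hz E. assert (H := proj1 (theta_disc_bounds z Hz)). rewrite E, Cmod_0 in H.
    assert (h := exp_pos (- (PI / 2 * Im z))). lra.
Qed.

(** With [z = 4 tau], theta at [tau] is the sum of the two parts at [z], a factor of [x^4 - y^4] and
    thus of [theta_disc z]. *)
Lemma theta_neq_0 (tau : C) : 0 < Im tau -> theta tau <> RtoC 0.
Proof.
  intros H E. set (z := (RtoC 4 * tau)%C).
  assert (Hz : 0 < Im z). { unfold z. replace (Im (RtoC 4 * tau)) with (4 * Im tau) by (destruct tau; simpl; ring). lra. }
  assert (Eq : q4 z = tau) by (unfold q4, z; rewrite RtoC_inv by lra; field).
  apply (theta_disc_neq_0 z Hz). unfold theta_disc, th1. rewrite Eq, E. unfold th0. ring.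
Qed.

Lemma Cder_theta (tau : C) : 0 < Im tau -> exists l, Cder theta tau l.
Proof.
  intros H. set (al := fun k => (RtoC (2 * PI * IZR (Z.of_nat (S k) * Z.of_nat (S k))) * Ci)%C).
  eexists. apply Cder_ext with (f := fun t => (RtoC 1 + RtoC 2 * exp_series (fun _ => RtoC 1) al t)%C).
  - intros w. rewrite theta_Cseries. f_equal. f_equal. unfold exp_series. apply Cseries_ext. intros k.
    unfold al, tq, qpow. ring.
  - apply Cder_plus; [apply Cder_const|]. apply Cder_scal. apply exp_series_der with (Im tau / 2); [lra|].
    unfold exp_sum. assert (HP := PI_RGT_0).
    apply ex_series_le_R with (fun n => exp (- (PI * Im tau) * (INR (S n) * INR (S n)) + 0 * INR (S n)));
      [|apply gauss_summable; nra].
    intros n. rewrite Cmod_1, Rmult_1_l. change (Cexp (al n * tau)) with (tq tau n). unfold tq.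
    rewrite Cmod_qpow, <- exp_plus. split; [left; apply exp_pos|]. apply exp_le_inc.
    unfold al. rewrite Cmod_mult, Cmod_Ci, Cmod_R, mult_IZR, <- INR_IZR_INZ, Rabs_pos_eq.
    + right. field.
    + assert (h := pos_INR (S n)). assert (0 <= INR (S n) * INR (S n)) by nra. nra.
Qed.

(** * Operations on Fourier coefficients *)

Lemma fcoef_lin (u v : C -> C) (c : C) (n : Z) : holoH u -> holoH v ->
  fcoef (fun z => u z + c * v z)%C n = (fcoef u n + c * fcoef v n)%C.
Proof.
  intros Hu Hv. rewrite !fcoef_at_1. unfold fcoef_at.
  assert (Xu : ex_CInt (fun x => u (x, 1) * qpow (x, 1) (- n))%C 0 1)
    by (apply ex_CInt_glob, fcoef_at_cont; auto; lra).
  assert (Xv : ex_CInt (fun x => v (x, 1) * qpow (x, 1) (- n))%C 0 1)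
    by (apply ex_CInt_glob, fcoef_at_cont; auto; lra).
  rewrite <- CInt_scal by auto. rewrite <- CInt_plus by (auto; apply ex_CInt_scal; auto).
  apply CInt_ext. intros x _. ring.
Qed.

Lemma holoH_lin (u v : C -> C) (c : C) : holoH u -> holoH v -> holoH (fun z => u z + c * v z)%C.
Proof.
  intros Hu Hv z Hz. destruct (Hu z Hz) as [a Ha]. destruct (Hv z Hz) as [b Hb].
  eexists. apply Cder_plus; [apply Ha|apply Cder_scal, Hb].
Qed.

Lemma perH_lin (u v : C -> C) (c : C) : perH u -> perH v -> perH (fun z => u z + c * v z)%C.
Proof. intros Hu Hv z Hz. rewrite Hu, Hv by auto. auto. Qed.

Lemma Cder_shift (f : C -> C) (z a l : C) : Cder f (z + a) l -> Cder (fun w => f (w + a)%C) z l.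
Proof.
  intros H. apply Cder_val with (l * RtoC 1)%C; [|ring].
  apply (Cder_comp (fun w => w + a)%C f); auto.
  apply Cder_val with (RtoC 1 + RtoC 0)%C; [|ring]. apply Cder_plus; [apply Cder_id|apply Cder_const].
Qed.

Lemma Im_shift (z : C) (r : R) : Im (z + RtoC r) = Im z.
Proof. destruct z; simpl. ring. Qed.

Lemma holoH_shift (f : C -> C) (r : R) : holoH f -> holoH (fun z => f (z + RtoC r)%C).
Proof.
  intros Hf z Hz. destruct (Hf (z + RtoC r)%C) as [l Hl]; [rewrite Im_shift; auto|].
  exists l. apply Cder_shift. auto.
Qed.

Lemma perH_shift (f : C -> C) (r : R) : perH f -> perH (fun z => f (z + RtoC r)%C).
Proof.
  intros Hf z Hz. replace (z + RtoC 1 + RtoC r)%C with (z + RtoC r + RtoC 1)%C by ring.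
  apply Hf. rewrite Im_shift. auto.
Qed.

Lemma fcoef_shift (f : C -> C) (r : R) (n : Z) : holoH f -> perH f ->
  fcoef (fun z => f (z + RtoC r)%C) n = (e1 (IZR n * r) * fcoef f n)%C.
Proof.
  intros Hf Hp. rewrite !fcoef_at_1. unfold fcoef_at.
  set (g := fun x => (f (x, 1) * qpow (x, 1) (- n))%C).
  assert (Hg : forall x, RCcont g x) by (apply fcoef_at_cont; auto; lra).
  rewrite <- (CInt_period g r); auto.
  - assert (E0 : CInt g r (r + 1) = CInt (fun x => g (x + r)) 0 1).
    { rewrite CInt_shift by (apply ex_CInt_glob; auto). f_equal; ring. }
    rewrite E0, <- CInt_scal.
    + apply CInt_ext. intros x _. unfold g.
      replace ((x, 1) + RtoC r)%C with ((x + r, 1) : C) by (apply injective_projections; simpl; ring).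
      rewrite !qpow_line, opp_IZR.
      replace (- IZR n * (x + r)) with (- IZR n * x + - (IZR n * r)) by ring. rewrite e1_plus.
      assert (E : (e1 (IZR n * r) * e1 (- (IZR n * r)))%C = RtoC 1) by (rewrite <- e1_plus, Rplus_opp_r; apply e1_0).
      match goal with |- (?F * (?X * ?Y))%C = _ => transitivity (F * (X * Y) * (e1 (IZR n * r) * e1 (- (IZR n * r))))%C; [rewrite E|]; ring end.
    + apply ex_CInt_glob. intros x. apply RCcont_ext with (f := fun u => g (1 * u + r)).
      * intros u. rewrite Rmult_1_l. auto.
      * apply RCcont_comp_affine. auto.
  - intros x. unfold g. replace ((x + 1, 1) : C) with ((x, 1) + RtoC 1)%C by (apply injective_projections; simpl; ring).
    rewrite Hp, qpow_shift, Rmult_1_r, e1_Z by (simpl; lra). ring.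
Qed.

(** * Integer powers *)

Lemma Czpow_1 (n : Z) : Czpow (RtoC 1) n = RtoC 1.
Proof.
  destruct n; simpl; auto; rewrite Cpow_1_l; auto. field.
Qed.

Lemma Czpow_mult (a b : C) (n : Z) : a <> RtoC 0 -> b <> RtoC 0 ->
  Czpow (a * b) n = (Czpow a n * Czpow b n)%C.
Proof.
  intros Ha Hb. destruct n; simpl; [ring| |]; rewrite Cpow_mult_l; auto.
  field. split; apply Cpow_nz; auto.
Qed.

Lemma Czpow_neq_0 (a : C) (n : Z) : a <> RtoC 0 -> Czpow a n <> RtoC 0.
Proof.
  intros Ha. destruct n; simpl; [apply C1_nz|apply Cpow_nz; auto|].
  intros E. assert (N := Cpow_nz a (Pos.to_nat p) Ha).
  apply C1_nz. rewrite <- (Cinv_r _ N), E. ring.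
Qed.

Lemma Cmod_Czpow (a : C) (n : Z) : a <> RtoC 0 -> Cmod (Czpow a n) = powerRZ (Cmod a) n.
Proof.
  intros Ha. destruct n; simpl; [apply Cmod_1|apply Cmod_pow|].
  rewrite Cmod_inv by (apply Cpow_nz; auto). rewrite Cmod_pow. auto.
Qed.

Lemma Cder_Cpow (f : C -> C) (z l : C) (n : nat) : Cder f z l -> exists l', Cder (fun w => f w ^ n)%C z l'.
Proof.
  intros H. induction n as [|n [l' IH]].
  - exists (RtoC 0). apply (Cder_const (RtoC 1)).
  - eexists. apply (Cder_mult f (fun w => f w ^ n)%C); eauto.
Qed.

Lemma Cder_Czpow (f : C -> C) (z l : C) (n : Z) : Cder f z l -> f z <> RtoC 0 ->
  exists l', Cder (fun w => Czpow (f w) n) z l'.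
Proof.
  intros H Hz. destruct n; simpl.
  - exists (RtoC 0). apply Cder_const.
  - apply Cder_Cpow with l. auto.
  - destruct (Cder_Cpow f z l (Pos.to_nat p) H) as [l' Hl']. eexists.
    apply (Cder_inv (fun w => f w ^ Pos.to_nat p)%C); eauto. apply Cpow_nz. auto.
Qed.

Lemma powerRZ_exp (x : R) (n : Z) : powerRZ (exp x) n = exp (IZR n * x).
Proof.
  assert (P : forall m, (exp x) ^ m = exp (INR m * x)).
  { induction m as [|m IH]; [simpl; rewrite Rmult_0_l, exp_0; auto|].
    rewrite S_INR. simpl. rewrite IH, <- exp_plus. f_equal. ring. }
  destruct n as [|p|p]; simpl.
  - rewrite Rmult_0_l, exp_0. auto.
  - rewrite P, INR_IPR. auto.
  - rewrite P, INR_IPR, <- exp_Ropp. f_equal. unfold IZR. ring.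
Qed.

(** The exponent will be [-(2 t + 3)], whose sign is not fixed, so bounds from both sides are
    carried. *)
Lemma powerRZ_sandwich (a b : R) (n : Z) : 0 < a -> 0 < b -> exists K, 0 < K /\
  forall x r, 0 < r -> a * r <= x <= b * r -> powerRZ x n <= K * powerRZ r n.
Proof.
  intros Ha Hb. destruct n as [|p|p]; simpl.
  - exists 1. split; [lra|]. intros. lra.
  - exists (b ^ Pos.to_nat p). split; [apply pow_lt; auto|]. intros x r Hr Hx.
    rewrite <- Rpow_mult_distr. apply pow_incr. assert (0 < a * r) by nra. lra.
  - exists (/ a ^ Pos.to_nat p). split; [apply Rinv_0_lt_compat, pow_lt; auto|]. intros x r Hr Hx.
    rewrite <- Rinv_mult, <- Rpow_mult_distr. assert (0 < a * r) by nra.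
    apply Rinv_le_contravar; [apply pow_lt; auto|]. apply pow_incr. lra.
Qed.

(** * Vanishing of level one functions of weight zero *)

(* If [|phi| <= K] on the upper half plane then all Fourier coefficients are at most [3 K],
   so [|phi| <= K / 2] where [Im z >= 3/4], hence everywhere by invariance. *)
Lemma weight0_zero (phi : C -> C) (K : R) : holoH phi -> perH phi ->
  (forall z, 0 < Im z -> Cmod (phi (- / z)%C) = Cmod (phi z)) ->
  (forall z, 3 / 4 <= Im z -> Cmod (phi z) <= K * exp (- (2 * PI * Im z))) ->
  forall z, 0 < Im z -> phi z = RtoC 0.
Proof.
  intros Hh Hp HS HK. assert (HP := PI_RGT_0). assert (P3 := PI2_3_2).
  assert (Hext : forall B, (forall z, 3 / 4 <= Im z -> Cmod (phi z) <= B) -> forall z, 0 < Im z -> Cmod (phi z) <= B).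
  { intros B HB. apply upper_half_ind; auto.
    - intros z Hz. rewrite Hp by auto. tauto.
    - intros z Hz. rewrite HS by auto. auto. }
  assert (K0 : 0 <= K).
  { assert (h := HK (0, 1) ltac:(simpl; lra)). assert (h' := Cmod_ge_0 (phi (0, 1))).
    assert (e := exp_pos (- (2 * PI * Im (0, 1)))). apply Rnot_lt_le. intros n. nra. }
  assert (Hbase : forall z, 0 < Im z -> Cmod (phi z) <= K).
  { apply Hext. intros z Hz. eapply Rle_trans; [apply HK; auto|].
    rewrite <- (Rmult_1_r K) at 2. apply Rmult_le_compat_l; auto. rewrite <- exp_0. apply exp_le_inc. nra. }
  assert (Hneg : forall n, (n < 1)%Z -> fcoef phi n = RtoC 0).
  { intros n Hn. apply (fcoef_growth phi K (- (2 * PI))); auto.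
    - intros z Hz. replace (- (2 * PI) * Im z) with (- (2 * PI * Im z)) by ring. apply HK. lra.
    - assert (IZR n <= 0) by (apply IZR_le; lia). nra. }
  assert (Hstep : forall B, 0 <= B -> (forall z, 0 < Im z -> Cmod (phi z) <= B) ->
     forall z, 0 < Im z -> Cmod (phi z) <= B / 2).
  { intros B HB0 HB. apply Hext. intros z Hz.
    assert (Hc : forall n, (1 <= n)%Z -> Cmod (fcoef phi n) <= 3 * B).
    { intros n Hn. assert (1 <= IZR n) by (apply IZR_le; auto).
      (* At this height the growth factor of the coefficient estimate is [exp 1], at most 3. *)
      set (y := / (2 * PI * IZR n)). assert (Hy : 0 < y) by (apply Rinv_0_lt_compat; nra).
      eapply Rle_trans; [apply (fcoef_bound phi n y B); auto|].
      replace (2 * PI * IZR n * y) with 1 by (unfold y; field; split; nra).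
      assert (h := exp_le_3). nra. }
    rewrite (qexp_series phi 1 Hh Hp Hneg) by lra.
    rewrite Cmod_mult, Cmod_qpow.
    set (a := 2 * PI * Im z). assert (Ha : 9 / 2 <= a) by (unfold a; nra).
    replace (2 * PI * 1 * Im z) with a by (unfold a; ring).
    assert (E : exp (- a) <= / 38).
    { eapply Rle_trans; [|apply exp_neg_bounds]. apply exp_le_inc. lra. }
    assert (Pe := exp_pos (- a)).
    assert (Bd := Cmod_Cseries_geom (fun k => fcoef phi (1 + Z.of_nat k) * qpow z (Z.of_nat k))%C (3 * B) a).
    assert (Bd' := Bd ltac:(lra) ltac:(lra)). clear Bd.
    assert (Q : Cmod (Cseries (fun k => fcoef phi (1 + Z.of_nat k) * qpow z (Z.of_nat k)))%C <= 2 * (3 * B / (1 - exp (- a)))).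
    { apply Bd'. intros k. rewrite Cmod_mult, Cmod_qpow, <- INR_IZR_INZ.
      replace (2 * PI * INR k * Im z) with (a * INR k) by (unfold a; ring).
      apply Rmult_le_compat_r; [left; apply exp_pos|]. apply Hc. lia. }
    assert (Q2 : 3 * B / (1 - exp (- a)) <= 38 / 37 * (3 * B)).
    { apply Rmult_le_reg_r with (1 - exp (- a)); [lra|]. unfold Rdiv at 1. rewrite Rmult_assoc, Rinv_l by lra. nra. }
    set (S0 := Cmod (Cseries _)) in *. assert (hS : 0 <= S0) by apply Cmod_ge_0.
    apply Rle_trans with (/ 38 * (2 * (38 / 37 * (3 * B)))); [apply Rmult_le_compat; lra|lra]. }
  assert (Hn : forall n z, 0 < Im z -> Cmod (phi z) <= K / 2 ^ n).
  { induction n as [|n IH].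
    - intros z Hz. simpl. rewrite Rdiv_1_r. auto.
    - intros z Hz. replace (K / 2 ^ S n) with (K / 2 ^ n / 2) by (simpl; field; apply pow_nonzero; lra).
      apply Hstep; auto. apply Rmult_le_pos; auto. left. apply Rinv_0_lt_compat, pow_lt. lra. }
  intros z Hz. apply Cmod_small_0. intros eps He.
  destruct (pow_lt_1_zero (/ 2) ltac:(rewrite Rabs_pos_eq; lra) (eps / (K + 1))) as [n Hn'].
  - apply Rdiv_lt_0_compat; lra.
  - specialize (Hn' n (le_n n)). rewrite <- RPow_abs, Rabs_pos_eq, pow_inv in Hn' by lra.
    eapply Rle_trans; [apply (Hn n z Hz)|].
    assert (P2 : 0 < / 2 ^ n) by (apply Rinv_0_lt_compat, pow_lt; lra).
    apply Rmult_lt_compat_r with (r := K + 1) in Hn'; [|lra].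
    replace (eps / (K + 1) * (K + 1)) with eps in Hn' by (field; lra). unfold Rdiv. nra.
Qed.

(** * Plus forms as vector-valued forms of level one *)

Definition plus_form (t : Z) (f : C -> C) : Prop :=
  holoH f /\ transforms_like_theta t f /\ plus_space t f.

Lemma theta_T (z : C) : theta (z + RtoC 1) = theta z.
Proof. apply th0_T. Qed.

Lemma mobius_T (z : C) : mobius 1 1 0 1 z = (z + RtoC 1)%C.
Proof. unfold mobius. rewrite Cmult_0_l, Cplus_0_l. field. Qed.

Lemma plus_form_per (t : Z) (f : C -> C) : plus_form t f -> perH f.
Proof.
  intros [_ [Ht _]] z Hz.
  assert (E := Ht 1%Z 1%Z 0%Z 1%Z ltac:(split; [auto|exists 0%Z; auto]) z Hz).
  rewrite mobius_T, theta_T in E.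
  replace (theta z / theta z)%C with (RtoC 1) in E by (field; apply theta_neq_0; auto).
  rewrite E, Czpow_1. ring.
Qed.

(** This is [(-1)^t], the residue modulo 4 of the odd exponents allowed by the plus condition;
    [eps_i] is the value of [e1 (n / 4)] on that class. *)
Definition eps_t (t : Z) : Z := if Z.even t then 1%Z else (-1)%Z.
Definition eps_i (t : Z) : C := (RtoC (IZR (eps_t t)) * Ci)%C.

Lemma eps_i_sqr (t : Z) : (eps_i t * eps_i t)%C = RtoC (-1).
Proof.
  unfold eps_i, eps_t. destruct (Z.even t); apply injective_projections; simpl; ring.
Qed.

Lemma plus_cases (t : Z) (f : C -> C) (n : Z) : plus_space t f ->
  fcoef f n = RtoC 0 \/ (n mod 4 = 0)%Z \/ ((n - eps_t t) mod 4 = 0)%Z.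
Proof.
  intros Hp. destruct (plus_okb t n) eqn:E; [right|left; auto].
  unfold plus_okb in E. apply Bool.orb_true_iff in E. unfold eps_t.
  destruct (Z.even t); destruct E as [E|E]; apply Z.eqb_eq in E; Z.div_mod_to_equations; lia.
Qed.

Lemma e1_div4_0 (n : Z) : (n mod 4 = 0)%Z -> e1 (IZR n * / 4) = RtoC 1 /\ e1 (IZR n * / 2) = RtoC 1.
Proof.
  intros H. assert (E : n = (4 * (n / 4))%Z) by (Z.div_mod_to_equations; lia).
  set (k := (n / 4)%Z) in E. rewrite E, mult_IZR. split.
  - replace (4 * IZR k * / 4) with (IZR k) by field. apply e1_Z.
  - replace (4 * IZR k * / 2) with (IZR (2 * k)) by (rewrite mult_IZR; field). apply e1_Z.
Qed.

Lemma e1_div4_eps (t n : Z) : ((n - eps_t t) mod 4 = 0)%Z ->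
  e1 (IZR n * / 4) = eps_i t /\ e1 (IZR n * / 2) = RtoC (-1).
Proof.
  intros H. assert (E : n = (4 * ((n - eps_t t) / 4) + eps_t t)%Z) by (Z.div_mod_to_equations; lia).
  set (k := ((n - eps_t t) / 4)%Z) in E. rewrite E, plus_IZR, mult_IZR. unfold eps_i, eps_t.
  destruct (Z.even t); split.
  - replace ((4 * IZR k + 1) * / 4) with (IZR k + / 4) by field. rewrite e1_plus, e1_Z, e1_quarter. ring.
  - replace ((4 * IZR k + 1) * / 2) with (IZR (2 * k) + / 2) by (rewrite mult_IZR; field).
    rewrite e1_plus, e1_Z, e1_half. ring.
  - replace ((4 * IZR k + -1) * / 4) with (IZR (k - 1) + (/ 4 + / 2)) by (rewrite minus_IZR; field).
    rewrite !e1_plus, e1_Z, e1_quarter, e1_half. ring.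
  - replace ((4 * IZR k + -1) * / 2) with (IZR (2 * k - 1) + / 2) by (rewrite minus_IZR, mult_IZR; field).
    rewrite e1_plus, e1_Z, e1_half. ring.
Qed.

(* Twice the parts of [f] supported on even and on odd exponents. *)
Definition even_part (f : C -> C) (z : C) : C := (f z + RtoC 1 * f (z + RtoC (/ 2)))%C.
Definition odd_part (f : C -> C) (z : C) : C := (f z + RtoC (-1) * f (z + RtoC (/ 2)))%C.

Section PlusForm.

Variables (t : Z) (f : C -> C).
Hypothesis Hf : plus_form t f.

Let a := eps_i t.
Let Hh : holoH f := proj1 Hf.
Let Hper : perH f := plus_form_per t f Hf.

Lemma even_part_holo : holoH (even_part f).
Proof. apply holoH_lin; auto. apply holoH_shift. auto. Qed.
Lemma odd_part_holo : holoH (odd_part f).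
Proof. apply holoH_lin; auto. apply holoH_shift. auto. Qed.
Lemma even_part_per : perH (even_part f).
Proof. apply perH_lin; auto. apply perH_shift. auto. Qed.
Lemma odd_part_per : perH (odd_part f).
Proof. apply perH_lin; auto. apply perH_shift. auto. Qed.

Lemma fcoef_even_part (n : Z) : fcoef (even_part f) n = (fcoef f n + RtoC 1 * (e1 (IZR n * / 2) * fcoef f n))%C.
Proof. unfold even_part. rewrite fcoef_lin, fcoef_shift; auto. apply holoH_shift; auto. Qed.

Lemma fcoef_odd_part (n : Z) : fcoef (odd_part f) n = (fcoef f n + RtoC (-1) * (e1 (IZR n * / 2) * fcoef f n))%C.
Proof. unfold odd_part. rewrite fcoef_lin, fcoef_shift; auto. apply holoH_shift; auto. Qed.

(** The plus condition enters here: on its two classes [e1 (n / 4)] takes only the values 1 and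
    [eps_i t]. The identity is checked on Fourier coefficients. *)
Lemma quarter_shift (z : C) : 0 < Im z ->
  (RtoC 2 * f (z + RtoC (/ 4)))%C = (even_part f z + a * odd_part f z)%C.
Proof.
  intros Hz.
  set (d := fun z => ((even_part f z + a * odd_part f z) + RtoC (-2) * f (z + RtoC (/ 4)))%C).
  cut (d z = RtoC 0).
  { unfold d. intros E. transitivity (RtoC 2 * f (z + RtoC (/ 4)) + (even_part f z + a * odd_part f z + RtoC (-2) * f (z + RtoC (/ 4))))%C;
    [rewrite E; ring|ring]. }
  revert z Hz. apply fcoef_zero_all.
  - apply holoH_lin; [apply holoH_lin; [apply even_part_holo|apply odd_part_holo]|]. apply holoH_shift. auto.
  - apply perH_lin; [apply perH_lin; [apply even_part_per|apply odd_part_per]|]. apply perH_shift. auto.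
  - intros n. unfold d. rewrite fcoef_lin, fcoef_lin.
    2: apply even_part_holo. 2: apply odd_part_holo. 2: (apply holoH_lin; [apply even_part_holo|apply odd_part_holo]).
    2: (apply holoH_shift; auto).
    rewrite fcoef_even_part, fcoef_odd_part, fcoef_shift by auto.
    destruct (plus_cases t f n (proj2 (proj2 Hf))) as [E|[E|E]].
    + rewrite E. ring.
    + destruct (e1_div4_0 n E) as [E1 E2]. rewrite E1, E2. ring.
    + destruct (e1_div4_eps t n E) as [E1 E2]. rewrite E1, E2. fold a. ring.
Qed.

Lemma even_part_half (z : C) : 0 < Im z -> even_part f (z + RtoC (/ 2)) = even_part f z.
Proof.
  intros Hz. unfold even_part. replace (z + RtoC (/ 2) + RtoC (/ 2))%C with (z + RtoC 1)%C.
  - rewrite Hper by auto. ring.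
  - replace 1 with (/ 2 + / 2) by lra. rewrite RtoC_plus. ring.
Qed.

Lemma odd_part_half (z : C) : 0 < Im z -> odd_part f (z + RtoC (/ 2)) = (- odd_part f z)%C.
Proof.
  intros Hz. unfold odd_part. replace (z + RtoC (/ 2) + RtoC (/ 2))%C with (z + RtoC 1)%C.
  - rewrite Hper by auto. ring.
  - replace 1 with (/ 2 + / 2) by lra. rewrite RtoC_plus. ring.
Qed.

Lemma three_quarter_shift (z : C) : 0 < Im z ->
  (RtoC 2 * f (z + RtoC (- / 4)))%C = (even_part f z - a * odd_part f z)%C.
Proof.
  intros Hz. rewrite <- (Hper (z + RtoC (- / 4))%C) by (rewrite Im_shift; auto).
  replace (z + RtoC (- / 4) + RtoC 1)%C with (z + RtoC (/ 2) + RtoC (/ 4))%C.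
  - rewrite quarter_shift by (rewrite Im_shift; auto). rewrite even_part_half, odd_part_half by auto. ring.
  - rewrite <- !Cplus_assoc, <- !RtoC_plus. f_equal. f_equal. lra.
Qed.

Lemma even_part_quarter (z : C) : 0 < Im z -> even_part f (z + RtoC (/ 4)) = even_part f z.
Proof.
  intros Hz.
  assert (E1 := quarter_shift z Hz). assert (E2 := three_quarter_shift z Hz).
  assert (E3 : even_part f (z + RtoC (/ 4)) = (f (z + RtoC (/ 4)) + f (z + RtoC (- / 4)))%C).
  { unfold even_part. rewrite Cmult_1_l. f_equal. rewrite <- (Hper (z + RtoC (- / 4))%C) by (rewrite Im_shift; auto).
    f_equal. rewrite <- !Cplus_assoc, <- !RtoC_plus. f_equal. f_equal. lra. }
  rewrite E3. transitivity ((RtoC 2 * f (z + RtoC (/ 4)) + RtoC 2 * f (z + RtoC (- / 4))) / RtoC 2)%C; [field|].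
  rewrite E1, E2. field.
Qed.

Lemma odd_part_quarter (z : C) : 0 < Im z -> odd_part f (z + RtoC (/ 4)) = (a * odd_part f z)%C.
Proof.
  intros Hz.
  assert (E1 := quarter_shift z Hz). assert (E2 := three_quarter_shift z Hz).
  assert (E3 : odd_part f (z + RtoC (/ 4)) = (f (z + RtoC (/ 4)) - f (z + RtoC (- / 4)))%C).
  { unfold odd_part. unfold Cminus. f_equal. rewrite <- (Hper (z + RtoC (- / 4))%C) by (rewrite Im_shift; auto).
    replace (z + RtoC (- / 4) + RtoC 1)%C with (z + RtoC (/ 4) + RtoC (/ 2))%C; [ring|].
    rewrite <- !Cplus_assoc, <- !RtoC_plus. f_equal. f_equal. lra. }
  rewrite E3. transitivity ((RtoC 2 * f (z + RtoC (/ 4)) - RtoC 2 * f (z + RtoC (- / 4))) / RtoC 2)%C; [field|].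
  rewrite E1, E2. field.
Qed.

(** * The transformation under inversion *)

Let e := (2 * t + 1)%Z.

Definition theta4 (z : C) : C := theta (q4 z).
(** The theta quotient of the matrix [(1 0; 4 1)] at [(z - 1) / 4], the point that it sends to
    [(-1/z + 1) / 4]. *)
Definition theta_ratio (z : C) : C := (theta4 (- / z + RtoC 1) / theta4 (z + RtoC (-1)))%C.
Definition succ_factor (z : C) : C := Czpow (theta_ratio z) e.
(** What distinguishes the matrix [(1 0; -4 1)] at [(z + 1) / 4] from the previous one: the two
    theta quotients are [mu z] times [1 - i] and [1 + i], and [(1 - i) / (1 + i) = -i]. *)
Definition pred_factor : C := Czpow (- Ci)%C e.

Lemma theta4_neq_0 (z : C) : 0 < Im z -> theta4 z <> RtoC 0.
Proof. intros Hz. apply theta_neq_0. rewrite Im_q4. lra. Qed.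

Lemma theta4_th (z : C) : theta4 z = (th0 z + th1 z)%C.
Proof. unfold theta4, th0, th1. ring. Qed.

Lemma theta4_succ (z : C) : 0 < Im z -> theta4 (z + RtoC 1) = (th0 z + Ci * th1 z)%C.
Proof. intros Hz. rewrite theta4_th, th0_T, th1_T by auto. auto. Qed.

Lemma th_pred (z : C) : 0 < Im z ->
  th0 (z + RtoC (-1)) = th0 z /\ th1 (z + RtoC (-1)) = (- Ci * th1 z)%C.
Proof.
  intros Hz. assert (Hz' : 0 < Im (z + RtoC (-1))) by (rewrite Im_shift; auto).
  assert (E0 := th0_T (z + RtoC (-1))). assert (E1 := th1_T _ Hz').
  replace (z + RtoC (-1) + RtoC 1)%C with z in E0, E1 by ring. split; auto.
  rewrite E1. transitivity (- (Ci * Ci) * th1 (z + RtoC (-1)))%C; [rewrite Ci_sqr; ring|ring].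
Qed.

Lemma theta4_pred (z : C) : 0 < Im z -> theta4 (z + RtoC (-1)) = (th0 z - Ci * th1 z)%C.
Proof.
  intros Hz. destruct (th_pred z Hz) as [E0 E1]. rewrite theta4_th, E0, E1. ring.
Qed.

Lemma theta4_S_succ (z : C) : 0 < Im z ->
  theta4 (- / z + RtoC 1) = (mu z * (RtoC 1 + Ci) * theta4 (z + RtoC (-1)))%C.
Proof.
  intros Hz. rewrite theta4_succ, theta4_pred, th0_S, th1_S by (auto; apply Im_Sinv_pos; auto).
  transitivity (mu z * ((RtoC 1 + Ci) * th0 z - (Ci - RtoC 1) * th1 z))%C; [ring|].
  replace (Ci - RtoC 1)%C with (Ci + Ci * Ci)%C by (rewrite Ci_sqr; ring). ring.
Qed.

Lemma theta4_S_pred (z : C) : 0 < Im z ->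
  theta4 (- / z + RtoC (-1)) = (mu z * (RtoC 1 - Ci) * theta4 (z + RtoC 1))%C.
Proof.
  intros Hz. rewrite theta4_succ, theta4_pred, th0_S, th1_S by (auto; apply Im_Sinv_pos; auto).
  transitivity (mu z * ((RtoC 1 - Ci) * th0 z + (Ci + RtoC 1) * th1 z))%C; [ring|].
  replace (Ci + RtoC 1)%C with (Ci - Ci * Ci)%C by (rewrite Ci_sqr; ring). ring.
Qed.

Lemma theta_ratio_mu (z : C) : 0 < Im z -> theta_ratio z = (mu z * (RtoC 1 + Ci))%C.
Proof.
  intros Hz. unfold theta_ratio. rewrite theta4_S_succ by auto. field. apply theta4_neq_0. rewrite Im_shift. auto.
Qed.

Lemma Cmod_theta_ratio (z : C) : 0 < Im z -> Cmod (theta_ratio z) * Cmod (theta_ratio z) = Cmod z.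
Proof.
  intros Hz. rewrite theta_ratio_mu, !Cmod_mult by auto. rewrite <- (Cmod_mu z Hz).
  replace (Cmod (mu z) * Cmod (RtoC 1 + Ci) * (Cmod (mu z) * Cmod (RtoC 1 + Ci)))
    with (Cmod (RtoC 1 + Ci) * Cmod (RtoC 1 + Ci) * (Cmod (mu z) * Cmod (mu z))) by ring.
  rewrite Cmod_sqr. simpl. ring.
Qed.

Lemma theta_ratio_neq_0 (z : C) : 0 < Im z -> theta_ratio z <> RtoC 0.
Proof.
  intros Hz E. assert (H := Cmod_theta_ratio z Hz). rewrite E, Cmod_0, Rmult_0_l in H.
  assert (P := proj1 (Cmod_gt_0 _) (H_neq_0 z Hz)). lra.
Qed.

(** For [tau = (z - 1) / 4] one has [4 tau + 1 = z], hence [tau / (4 tau + 1) = (1 - 1/z) / 4]. *)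
Lemma S_law_succ (z : C) : 0 < Im z -> f (q4 (- / z + RtoC 1)) = (succ_factor z * f (q4 (z + RtoC (-1))))%C.
Proof.
  intros Hz. assert (Nz := H_neq_0 z Hz). set (tau := q4 (z + RtoC (-1))).
  assert (Ht : 0 < Im tau) by (unfold tau; rewrite Im_q4, Im_shift; lra).
  assert (E := proj1 (proj2 Hf) 1%Z 0%Z 4%Z 1%Z ltac:(split; [auto|exists 1%Z; auto]) tau Ht).
  replace (mobius 1 0 4 1 tau) with (q4 (- / z + RtoC 1)) in E.
  - exact E.
  - unfold mobius.
    replace (RtoC 4 * tau + RtoC 1)%C with z by (unfold tau, q4; rewrite RtoC_inv by lra; field).
    unfold tau, q4. field. auto.
Qed.

Lemma S_law_pred (z : C) : 0 < Im z ->
  f (q4 (- / z + RtoC (-1))) = (pred_factor * succ_factor z * f (q4 (z + RtoC 1)))%C.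
Proof.
  intros Hz. assert (Nz := H_neq_0 z Hz). set (tau := q4 (z + RtoC 1)).
  assert (Ht : 0 < Im tau) by (unfold tau; rewrite Im_q4, Im_shift; lra).
  assert (E := proj1 (proj2 Hf) 1%Z 0%Z (-4)%Z 1%Z ltac:(split; [auto|exists (-1)%Z; auto]) tau Ht).
  replace (mobius 1 0 (-4) 1 tau) with (q4 (- / z + RtoC (-1))) in E.
  - rewrite E. f_equal. change (theta (q4 (- / z + RtoC (-1)))) with (theta4 (- / z + RtoC (-1))).
    change (theta tau) with (theta4 (z + RtoC 1)).
    replace (theta4 (- / z + RtoC (-1)) / theta4 (z + RtoC 1))%C with (- Ci * theta_ratio z)%C.
    + unfold pred_factor, succ_factor. rewrite Czpow_mult; auto.
      * intros E0. apply (f_equal snd) in E0. simpl in E0. lra.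
      * apply theta_ratio_neq_0. auto.
    + rewrite theta4_S_pred, theta_ratio_mu by auto.
      replace (RtoC 1 - Ci)%C with (- Ci * Ci - Ci)%C.
      * field. apply theta4_neq_0. rewrite Im_shift. auto.
      * replace (- Ci * Ci)%C with (- (Ci * Ci))%C by ring. rewrite Ci_sqr. ring.
  - unfold mobius.
    replace (RtoC (-4) * tau + RtoC 1)%C with (- z)%C by (unfold tau, q4; rewrite RtoC_inv by lra; field).
    unfold tau, q4. field. auto.
Qed.

Lemma pred_factor_Cmod : Cmod pred_factor = 1.
Proof.
  assert (N : (- Ci)%C <> RtoC 0) by (intros E0; apply (f_equal snd) in E0; simpl in E0; lra).
  unfold pred_factor. rewrite Cmod_Czpow by auto. rewrite Cmod_opp, Cmod_Ci. destruct e; simpl; rewrite ?pow1; auto; lra.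
Qed.

Lemma pred_factor_neq_1 : pred_factor <> RtoC 1.
Proof.
  assert (N : (- Ci)%C <> RtoC 0) by (intros E0; apply (f_equal snd) in E0; simpl in E0; lra).
  assert (P : forall m, Cpow (- Ci)%C (2 * m + 1) = (- Ci)%C \/ Cpow (- Ci)%C (2 * m + 1) = Ci).
  { induction m as [|m IH].
    - left. simpl. ring.
    - replace (2 * S m + 1)%nat with (2 + (2 * m + 1))%nat by lia. rewrite Cpow_add_r.
      replace ((- Ci) ^ 2)%C with (RtoC (-1)) by (simpl; apply injective_projections; simpl; ring).
      destruct IH as [-> | ->]; [right|left]; ring. }
  assert (Hodd : e <> 0%Z) by (unfold e; lia).
  unfold pred_factor. destruct e as [|p|p] eqn:Ee; [lia| |]; simpl.
  - replace (Pos.to_nat p) with (2 * Z.to_nat t + 1)%nat by (unfold e in Ee; lia).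
    destruct (P (Z.to_nat t)) as [-> | ->]; intros E; apply (f_equal fst) in E; simpl in E; lra.
  - replace (Pos.to_nat p) with (2 * Z.to_nat (- t - 1) + 1)%nat by (unfold e in Ee; lia).
    destruct (P (Z.to_nat (- t - 1))) as [-> | ->]; intros E; apply (f_equal fst) in E; simpl in E; lra.
Qed.

Lemma q4_succ (z : C) : q4 (z + RtoC 1) = (q4 z + RtoC (/ 4))%C.
Proof. unfold q4. ring. Qed.

Lemma q4_pred (z : C) : q4 (z + RtoC (-1)) = (q4 z + RtoC (- / 4))%C.
Proof. unfold q4. rewrite (RtoC_opp (/ 4)). ring. Qed.

(** Twice [f] at [(z + 1) / 4] and, for [form_pred], at [(z - 1) / 4], written in the two parts.
    Inversion exchanges them up to a factor. *)
Definition form_succ (z : C) : C := (even_part f (q4 z) + a * odd_part f (q4 z))%C.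
Definition form_pred (z : C) : C := (even_part f (q4 z) - a * odd_part f (q4 z))%C.

Lemma form_succ_eq (z : C) : 0 < Im z -> form_succ z = (RtoC 2 * f (q4 (z + RtoC 1)))%C.
Proof. intros Hz. rewrite q4_succ, quarter_shift by (rewrite Im_q4; lra). auto. Qed.

Lemma form_pred_eq (z : C) : 0 < Im z -> form_pred z = (RtoC 2 * f (q4 (z + RtoC (-1))))%C.
Proof. intros Hz. rewrite q4_pred, three_quarter_shift by (rewrite Im_q4; lra). auto. Qed.

Lemma form_succ_S (z : C) : 0 < Im z -> form_succ (- / z) = (succ_factor z * form_pred z)%C.
Proof.
  intros Hz. rewrite form_succ_eq, form_pred_eq by (auto; apply Im_Sinv_pos; auto). rewrite S_law_succ by auto. ring.
Qed.

Lemma form_pred_S (z : C) : 0 < Im z -> form_pred (- / z) = (pred_factor * succ_factor z * form_succ z)%C.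
Proof.
  intros Hz. rewrite form_succ_eq, form_pred_eq by (auto; apply Im_Sinv_pos; auto). rewrite S_law_pred by auto. ring.
Qed.

Lemma succ_factor_neq_0 (z : C) : 0 < Im z -> succ_factor z <> RtoC 0.
Proof. intros Hz. apply Czpow_neq_0, theta_ratio_neq_0. auto. Qed.

(** Existence of a derivative is enough: its value cancels in the Wronskian. *)
Lemma Cder_succ_factor (z : C) : 0 < Im z -> exists l, Cder succ_factor z l.
Proof.
  intros Hz. assert (Nz := H_neq_0 z Hz). unfold succ_factor.
  assert (HT : forall w, 0 < Im w -> exists l, Cder theta4 w l).
  { intros w Hw. destruct (Cder_theta (q4 w)) as [l Hl]; [rewrite Im_q4; lra|].
    eexists. apply (Cder_comp q4 theta); [|apply Hl]. apply Cder_scal, Cder_id. }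
  destruct (HT (- / z + RtoC 1)%C) as [l1 Hl1]; [rewrite Im_shift; apply Im_Sinv_pos; auto|].
  destruct (HT (z + RtoC (-1))%C) as [l2 Hl2]; [rewrite Im_shift; auto|].
  assert (D1 : exists l, Cder (fun w => theta4 (- / w + RtoC 1)%C) z l).
  { eexists. apply (Cder_comp (fun w => - / w + RtoC 1)%C theta4); [|apply Hl1].
    apply Cder_plus; [|apply Cder_const].
    apply Cder_ext with (f := fun w => (RtoC (-1) * / w)%C); [intros; ring|].
    apply Cder_scal. apply (Cder_inv (fun w => w)); auto. apply Cder_id. }
  destruct D1 as [l3 D1].
  assert (D2 : Cder (fun w => theta4 (w + RtoC (-1))%C) z l2) by (apply Cder_shift; auto).
  eapply Cder_Czpow; [|apply theta_ratio_neq_0; auto]. unfold theta_ratio.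
  apply (Cder_mult (fun w => theta4 (- / w + RtoC 1)%C) (fun w => / theta4 (w + RtoC (-1)))%C); [apply D1|].
  apply Cder_inv; [apply D2|]. apply theta4_neq_0. rewrite Im_shift. auto.
Qed.

(** If one part vanishes, [form_succ] equals plus or minus [form_pred], both at [z] and at [-1/z].
    The two inversion laws are then compatible only if [pred_factor = 1] or [form_pred z = 0], and
    an odd power of [-i] is not 1. *)
Lemma plus_form_zero_of_part :
  (forall z, 0 < Im z -> even_part f z = RtoC 0) \/ (forall z, 0 < Im z -> odd_part f z = RtoC 0) ->
  forall z, 0 < Im z -> f z = RtoC 0.
Proof.
  intros H.
  assert (HV : forall z, 0 < Im z -> form_pred z = RtoC 0).
  { intros z Hz. assert (Hz' := Im_Sinv_pos z Hz).
    assert (Hq : 0 < Im (q4 z)) by (rewrite Im_q4; lra).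
    assert (Hq' : 0 < Im (q4 (- / z))) by (rewrite Im_q4; lra).
    assert (EU := form_succ_S z Hz). assert (EV := form_pred_S z Hz).
    assert (E : ((RtoC 1 - pred_factor) * succ_factor z * form_pred z)%C = RtoC 0).
    { destruct H as [H|H].
      - assert (E1 : form_succ z = (- form_pred z)%C) by (unfold form_succ, form_pred; rewrite (H (q4 z)) by auto; ring).
        assert (E2 : form_succ (- / z) = (- form_pred (- / z))%C) by (unfold form_succ, form_pred; rewrite (H (q4 (- / z))) by auto; ring).
        rewrite EU, EV, E1 in E2.
        transitivity (succ_factor z * form_pred z - pred_factor * succ_factor z * form_pred z)%C; [ring|]. rewrite E2. ring.
      - assert (E1 : form_succ z = form_pred z) by (unfold form_succ, form_pred; rewrite (H (q4 z)) by auto; ring).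
        assert (E2 : form_succ (- / z) = form_pred (- / z)) by (unfold form_succ, form_pred; rewrite (H (q4 (- / z))) by auto; ring).
        rewrite EU, EV, E1 in E2.
        transitivity (succ_factor z * form_pred z - pred_factor * succ_factor z * form_pred z)%C; [ring|]. rewrite E2. ring. }
    apply NNPP. intros N. revert E. apply Cmult_neq_0; auto. apply Cmult_neq_0; [|apply succ_factor_neq_0; auto].
    apply Cminus_eq_contra. intros E. apply pred_factor_neq_1. auto. }
  intros z Hz. set (s := (RtoC 4 * z + RtoC 1)%C).
  assert (Hs : 0 < Im s) by (unfold s; rewrite Im_shift; destruct z; simpl in *; lra).
  assert (E := HV s Hs). rewrite form_pred_eq in E by auto.
  replace (q4 (s + RtoC (-1))) with z in E by (unfold q4, s; rewrite RtoC_inv by lra; field).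
  transitivity (RtoC 2 * f z / RtoC 2)%C; [field|]. rewrite E. field.
Qed.

(** * The Wronskian of the two parts *)

Section Wronskian.

Variables A0 A1 : Z.
Hypotheses (HA0 : forall n, (n < A0)%Z -> fcoef (even_part f) n = RtoC 0)
           (HA1 : forall n, (n < A1)%Z -> fcoef (odd_part f) n = RtoC 0).

(** The derivative of [F] computed from its expansion [qpow z n1 * qexp_g F n1 z]; in this form both
    its holomorphy and its decay can be read off. *)
Definition qder (F : C -> C) (n1 : Z) (z : C) : C :=
  (qpow z n1 * (RtoC (2 * PI * IZR n1) * Ci * qexp_g F n1 z + qexp_dg F n1 z))%C.

Lemma ball_in_H (z w : C) : Cmod (w - z) < Im z -> 0 < Im w.
Proof.
  intros H. assert (h := Im_le_Cmod (w - z)).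
  assert (h' : Rabs (Im (w - z)) < Im z) by lra. apply Rabs_lt_between in h'.
  destruct w, z; simpl in *. lra.
Qed.

Lemma qder_der (F : C -> C) (n1 : Z) (z : C) : holoH F -> perH F ->
  (forall n, (n < n1)%Z -> fcoef F n = RtoC 0) -> 0 < Im z -> Cder F z (qder F n1 z).
Proof.
  intros HF HP H0 Hz.
  apply Cder_ext_loc with (f := fun w => (qpow w n1 * qexp_g F n1 w)%C) (r := Im z); auto.
  - intros w Hw. symmetry. apply qexp_g_eq; auto. apply (ball_in_H z); auto.
  - apply Cder_val with (RtoC (2 * PI * IZR n1) * Ci * qpow z n1 * qexp_g F n1 z + qpow z n1 * qexp_dg F n1 z)%C.
    + apply (Cder_mult (fun w => qpow w n1)); [apply Cder_qpow|apply qexp_g_der; auto].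
    + unfold qder. ring.
Qed.

Lemma qder_holo (F : C -> C) (n1 : Z) : holoH F -> perH F -> holoH (qder F n1).
Proof.
  intros HF HP z Hz. destruct (qexp_dg_der F n1 HF HP z Hz) as [l Hl]. eexists. unfold qder.
  apply (Cder_mult (fun w => qpow w n1)); [apply Cder_qpow|].
  apply Cder_plus; [apply Cder_scal, qexp_g_der; auto|apply Hl].
Qed.

Definition wronskian_tau (z : C) : C := (even_part f z * qder (odd_part f) A1 z - odd_part f z * qder (even_part f) A0 z)%C.
Definition wronskian (z : C) : C := wronskian_tau (q4 z).

(** Used to differentiate functional equations that hold on the upper half plane only. *)
Lemma Cder_loc_unique (F G : C -> C) (z l m : C) : 0 < Im z ->
  (forall w, 0 < Im w -> F w = G w) -> Cder F z l -> Cder G z m -> l = m.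
Proof.
  intros Hz E HF HG. apply (Cder_unique G z); auto.
  apply Cder_ext_loc with (f := F) (r := Im z); auto. intros w Hw. apply E. apply (ball_in_H z); auto.
Qed.

Lemma wronskian_T (z : C) : 0 < Im z -> wronskian (z + RtoC 1) = (a * wronskian z)%C.
Proof.
  intros Hz. unfold wronskian. rewrite q4_succ. set (s := q4 z).
  assert (Hs : 0 < Im s) by (unfold s; rewrite Im_q4; lra).
  assert (Hs' : 0 < Im (s + RtoC (/ 4))) by (rewrite Im_shift; auto).
  assert (E0 : qder (even_part f) A0 (s + RtoC (/ 4)) = qder (even_part f) A0 s).
  { apply (Cder_loc_unique (fun w => even_part f (w + RtoC (/ 4)))%C (even_part f) s); auto.
    - apply even_part_quarter.
    - apply Cder_shift, qder_der; auto; [apply even_part_holo|apply even_part_per].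
    - apply qder_der; auto; [apply even_part_holo|apply even_part_per]. }
  assert (E1 : qder (odd_part f) A1 (s + RtoC (/ 4)) = (a * qder (odd_part f) A1 s)%C).
  { apply (Cder_loc_unique (fun w => odd_part f (w + RtoC (/ 4)))%C (fun w => a * odd_part f w)%C s); auto.
    - apply odd_part_quarter.
    - apply Cder_shift, qder_der; auto; [apply odd_part_holo|apply odd_part_per].
    - apply Cder_scal, qder_der; auto; [apply odd_part_holo|apply odd_part_per]. }
  unfold wronskian_tau. rewrite even_part_quarter, odd_part_quarter, E0, E1 by auto. ring.
Qed.

(** The Wronskian of [form_succ] and [form_pred] is a constant multiple of [wronskian], and
    inversion multiplies both functions by the same [succ_factor] up to constants. So the derivative
    of that factor cancels, leaving its square, while the chain rule for [-1/z] contributes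
    [z^2]. *)
Lemma wronskian_S (z : C) : 0 < Im z -> Cmod (wronskian (- / z)) = powerRZ (Cmod z) (2 * t + 3) * Cmod (wronskian z).
Proof.
  intros Hz. assert (Nz := H_neq_0 z Hz). assert (Pz := proj1 (Cmod_gt_0 _) Nz).
  set (dh0 := fun w => (qder (even_part f) A0 (q4 w) * (RtoC (/ 4) * RtoC 1))%C).
  set (dh1 := fun w => (qder (odd_part f) A1 (q4 w) * (RtoC (/ 4) * RtoC 1))%C).
  assert (Hq4 : forall w, Cder q4 w (RtoC (/ 4) * RtoC 1)%C) by (intros w; apply Cder_scal, Cder_id).
  assert (D0 : forall w, 0 < Im w -> Cder (fun w => even_part f (q4 w)) w (dh0 w)).
  { intros w Hw. apply (Cder_comp q4 (even_part f)); auto.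
    apply qder_der; auto; [apply even_part_holo|apply even_part_per|rewrite Im_q4; lra]. }
  assert (D1 : forall w, 0 < Im w -> Cder (fun w => odd_part f (q4 w)) w (dh1 w)).
  { intros w Hw. apply (Cder_comp q4 (odd_part f)); auto.
    apply qder_der; auto; [apply odd_part_holo|apply odd_part_per|rewrite Im_q4; lra]. }
  set (dU := fun w => (dh0 w + a * dh1 w)%C). set (dV := fun w => (dh0 w + (- a) * dh1 w)%C).
  assert (DU : forall w, 0 < Im w -> Cder form_succ w (dU w)).
  { intros w Hw. apply Cder_plus; auto. apply Cder_scal; auto. }
  assert (DV : forall w, 0 < Im w -> Cder form_pred w (dV w)).
  { intros w Hw. apply Cder_ext with (f := fun w => (even_part f (q4 w) + (- a) * odd_part f (q4 w))%C).
    - intros u. unfold form_pred. ring.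
    - apply Cder_plus; auto. apply Cder_scal; auto. }
  set (D := (RtoC (-1) * (- RtoC 1 * / (z * z)))%C).
  assert (DS : Cder (fun w => - / w)%C z D).
  { apply Cder_ext with (f := fun w => (RtoC (-1) * / w)%C); [intros; ring|].
    apply Cder_scal. apply (Cder_inv (fun w => w)); auto. apply Cder_id. }
  destruct (Cder_succ_factor z Hz) as [R' HR'].
  assert (Hz' := Im_Sinv_pos z Hz).
  assert (E1 : (dU (- / z) * D)%C = (R' * form_pred z + succ_factor z * dV z)%C).
  { apply (Cder_loc_unique (fun w => form_succ (- / w))%C (fun w => succ_factor w * form_pred w)%C z); auto.
    - apply form_succ_S.
    - apply (Cder_comp (fun w => - / w)%C form_succ); auto.
    - apply Cder_mult; auto. }
  assert (E2 : (dV (- / z) * D)%C = (pred_factor * (R' * form_succ z + succ_factor z * dU z))%C).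
  { apply (Cder_loc_unique (fun w => form_pred (- / w))%C (fun w => pred_factor * (succ_factor w * form_succ w))%C z); auto.
    - intros w Hw. rewrite form_pred_S by auto. ring.
    - apply (Cder_comp (fun w => - / w)%C form_pred); auto.
    - apply Cder_scal, Cder_mult; auto. }
  set (Z := fun w => (form_succ w * dV w - form_pred w * dU w)%C).
  assert (EZ : forall w, Z w = (RtoC (/ 2) * (- a) * wronskian w)%C).
  { intros w. unfold Z, form_succ, form_pred, dU, dV, dh0, dh1, wronskian, wronskian_tau.
    replace (RtoC (/ 4)) with (RtoC (/ 2) * RtoC (/ 2))%C by (rewrite <- RtoC_mult; f_equal; lra).
    set (i2 := RtoC (/ 2)). assert (Ei : (i2 * RtoC 2)%C = RtoC 1) by (unfold i2; rewrite <- RtoC_mult; f_equal; lra).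
    set (x0 := even_part f (q4 w)). set (x1 := odd_part f (q4 w)). set (y0 := qder (even_part f) A0 (q4 w)). set (y1 := qder (odd_part f) A1 (q4 w)).
    transitivity ((i2 * RtoC 2) * i2 * (- a) * (x0 * y1 - x1 * y0))%C; [ring|]. rewrite Ei. ring. }
  assert (ES : (Z (- / z) * D)%C = (- pred_factor * (succ_factor z * succ_factor z) * Z z)%C).
  { unfold Z. transitivity (form_succ (- / z) * (dV (- / z) * D) - form_pred (- / z) * (dU (- / z) * D))%C; [ring|].
    rewrite E1, E2, form_succ_S, form_pred_S by auto. ring. }
  assert (ED : Cmod D = / (Cmod z * Cmod z)).
  { unfold D. rewrite Cmod_mult, Cmod_mult, Cmod_opp, Cmod_1, Cmod_R, Cmod_inv by (apply Cmult_neq_0; auto).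
    rewrite Cmod_mult, Rabs_left by lra. ring. }
  assert (EC := f_equal Cmod ES). rewrite !EZ in EC.
  assert (Na : Cmod a = 1).
  { assert (h := f_equal Cmod (eps_i_sqr t)). fold a in h. rewrite Cmod_mult, Cmod_R, Rabs_left in h by lra.
    assert (h0 := Cmod_ge_0 a). nra. }
  rewrite !Cmod_mult, !Cmod_opp, Na, pred_factor_Cmod, ED, Cmod_R, Rabs_pos_eq in EC by lra.
  (* This is where the modulus of the Gaussian integral is used: [|theta_ratio z|^2 = |z|]. *)
  assert (ER : Cmod (succ_factor z) * Cmod (succ_factor z) = powerRZ (Cmod z) (2 * t + 1)).
  { unfold succ_factor. rewrite Cmod_Czpow by (apply theta_ratio_neq_0; auto).
    rewrite <- powerRZ_mult, Cmod_theta_ratio by auto. auto. }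
  rewrite ER in EC.
  replace (2 * t + 3)%Z with ((2 * t + 1) + 2)%Z by ring. rewrite powerRZ_add by lra.
  replace (powerRZ (Cmod z) 2) with (Cmod z * Cmod z) by (simpl; ring).
  set (p := powerRZ (Cmod z) (2 * t + 1)) in *. set (m := Cmod z * Cmod z) in *.
  assert (Pm : 0 < m) by (unfold m; nra).
  set (X := Cmod (wronskian (- / z))) in *. set (Y := Cmod (wronskian z)) in *.
  apply Rmult_eq_reg_l with (/ 2 * 1 * / m); [|apply Rmult_integral_contrapositive; split; [lra|apply Rinv_neq_0_compat; lra]].
  transitivity (/ 2 * 1 * X * / m); [ring|]. rewrite EC. field. lra.
Qed.

Lemma wronskian_holo : holoH wronskian.
Proof.
  intros z Hz. set (s := q4 z). assert (Hs : 0 < Im s) by (unfold s; rewrite Im_q4; lra).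
  destruct (even_part_holo s Hs) as [l0 L0]. destruct (odd_part_holo s Hs) as [l1 L1].
  destruct (qder_holo (even_part f) A0 even_part_holo even_part_per s Hs) as [m0 M0].
  destruct (qder_holo (odd_part f) A1 odd_part_holo odd_part_per s Hs) as [m1 M1].
  eexists. apply (Cder_comp q4 wronskian_tau); [apply Cder_scal, Cder_id|].
  apply Cder_ext with (f := fun w => (even_part f w * qder (odd_part f) A1 w + RtoC (-1) * (odd_part f w * qder (even_part f) A0 w))%C).
  - intros w. unfold wronskian_tau. ring.
  - apply Cder_plus; [apply Cder_mult; [apply L0|apply M1]|].
    apply Cder_scal. apply Cder_mult; [apply L1|apply M0].
Qed.

(** The weights balance: [12 (2 t + 3) = 4 * 3 (2 t + 3)]. The fourth power of [theta_disc] removes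
    its factor [i] under translation, and the twelfth power of the Wronskian removes [eps_i t]. *)
Definition wronskian_quotient (z : C) : C := (wronskian z ^ 12 * Czpow (theta_disc z ^ 4) (- (2 * t + 3)))%C.

Lemma wronskian_quotient_holo : holoH wronskian_quotient.
Proof.
  intros z Hz. destruct (wronskian_holo z Hz) as [l Hl].
  destruct (Cder_Cpow _ _ _ 12 Hl) as [l1 Hl1].
  assert (ND := theta_disc_neq_0 z Hz).
  assert (HD : exists l, Cder theta_disc z l).
  { destruct (Cder_theta z Hz) as [m Hm].
    destruct (Cder_theta (q4 z)) as [m4 Hm4]; [rewrite Im_q4; lra|].
    assert (T0 : Cder th0 z m) by auto.
    assert (T1 : exists l, Cder th1 z l).
    { eexists. apply Cder_ext with (f := fun w => (theta (q4 w) + RtoC (-1) * theta w)%C).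
      - intros w. unfold th1. ring.
      - apply Cder_plus; [|apply Cder_scal; apply Hm].
        apply (Cder_comp q4 theta); [apply Cder_scal, Cder_id|apply Hm4]. }
    destruct T1 as [m1 T1].
    destruct (Cder_Cpow _ _ _ 4 T0) as [p0 P0]. destruct (Cder_Cpow _ _ _ 4 T1) as [p1 P1].
    eexists. apply Cder_ext with (f := fun w => (th0 w * th1 w * (th0 w ^ 4 + RtoC (-1) * th1 w ^ 4))%C).
    - intros w. unfold theta_disc. ring.
    - apply Cder_mult; [apply Cder_mult; [apply T0|apply T1]|].
      apply Cder_plus; [apply P0|]. apply Cder_scal. apply P1. }
  destruct HD as [d Hd]. destruct (Cder_Cpow _ _ _ 4 Hd) as [d4 Hd4].
  destruct (Cder_Czpow _ _ _ (- (2 * t + 3)) Hd4) as [d5 Hd5]; [apply Cpow_nz; auto|].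
  eexists. apply Cder_mult; [apply Hl1|apply Hd5].
Qed.

Lemma wronskian_quotient_per : perH wronskian_quotient.
Proof.
  intros z Hz. unfold wronskian_quotient. rewrite wronskian_T, theta_disc_T by auto. rewrite !Cpow_mult_l.
  replace (Ci ^ 4)%C with (RtoC 1) by (simpl; apply injective_projections; simpl; ring).
  replace (a ^ 12)%C with (RtoC 1).
  - rewrite !Cmult_1_l. auto.
  - replace (a ^ 12)%C with ((a * a) * (a * a) * (a * a) * (a * a) * (a * a) * (a * a))%C by ring.
    unfold a. rewrite eps_i_sqr. apply injective_projections; simpl; ring.
Qed.

Lemma wronskian_quotient_S (z : C) : 0 < Im z -> Cmod (wronskian_quotient (- / z)%C) = Cmod (wronskian_quotient z).
Proof.
  intros Hz. assert (Pz := proj1 (Cmod_gt_0 _) (H_neq_0 z Hz)).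
  assert (ND := theta_disc_neq_0 z Hz). assert (ND' := theta_disc_neq_0 _ (Im_Sinv_pos z Hz)).
  unfold wronskian_quotient. rewrite !Cmod_mult, !Cmod_Czpow, !Cmod_pow by (apply Cpow_nz; auto).
  rewrite wronskian_S, Cmod_theta_disc_S by auto. set (x := Cmod z) in *.
  set (p := (2 * t + 3)%Z).
  rewrite !Rpow_mult_distr. rewrite powerRZ_mult.
  replace (powerRZ ((x ^ 3) ^ 4) (- p)) with (/ (powerRZ x p) ^ 12).
  - field. apply powerRZ_NOR. lra.
  - assert (Ex : x = exp (ln x)) by (rewrite exp_ln; auto).
    rewrite Ex. rewrite powerRZ_exp.
    replace ((exp (ln x) ^ 3) ^ 4) with (powerRZ (exp (ln x)) 12) by (simpl; ring).
    replace (exp (IZR p * ln x) ^ 12) with (powerRZ (exp (IZR p * ln x)) 12) by (simpl; ring).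
    rewrite !powerRZ_exp, <- exp_Ropp. f_equal. rewrite opp_IZR. ring.
Qed.

Lemma qder_bound (F : C -> C) (n1 : Z) (y0 : R) : holoH F -> perH F ->
  (forall n, (n < n1)%Z -> fcoef F n = RtoC 0) -> 0 < y0 ->
  exists K, 0 <= K /\ forall z, y0 <= Im z ->
    Cmod (F z) <= K * exp (- (2 * PI * IZR n1 * Im z)) /\
    Cmod (qder F n1 z) <= K * exp (- (2 * PI * IZR n1 * Im z)).
Proof.
  intros HF HP Hn Hy. assert (PP := PI_RGT_0).
  destruct (qexp_bounds F n1 HF HP y0 Hy) as [K [HK HB]].
  set (c := Cmod (fcoef F n1)). assert (Hc : 0 <= c) by apply Cmod_ge_0.
  set (d := Cmod (RtoC (2 * PI * IZR n1) * Ci)). assert (Hd : 0 <= d) by apply Cmod_ge_0.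
  exists ((1 + d) * (c + K) + K). split.
  { assert (0 <= d * (c + K)) by (apply Rmult_le_pos; lra). lra. }
  intros z Hz. destruct (HB z Hz) as [B1 B2].
  assert (Ee : exp (- (2 * PI * Im z)) <= 1).
  { rewrite <- exp_0. apply exp_le_inc. nra. }
  assert (Pe := exp_pos (- (2 * PI * Im z))).
  assert (G : Cmod (qexp_g F n1 z) <= c + K).
  { assert (T := Cmod_sub_rev (qexp_g F n1 z) (fcoef F n1)). fold c in T. nra. }
  assert (G' : Cmod (qexp_dg F n1 z) <= K) by nra.
  assert (g0 := Cmod_ge_0 (qexp_g F n1 z)).
  set (E := exp (- (2 * PI * IZR n1 * Im z))). assert (PE : 0 < E) by apply exp_pos.
  split.
  - rewrite (qexp_g_eq F n1 HF HP Hn) by lra. rewrite Cmod_mult, Cmod_qpow. fold E.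
    rewrite Rmult_comm. apply Rmult_le_compat_r; [lra|].
    assert (0 <= d * (c + K)) by (apply Rmult_le_pos; lra). lra.
  - unfold qder. rewrite Cmod_mult, Cmod_qpow. fold E. rewrite Rmult_comm. apply Rmult_le_compat_r; [lra|].
    eapply Rle_trans; [apply Cmod_triangle|]. rewrite (Cmod_mult (RtoC (2 * PI * IZR n1) * Ci)). fold d.
    assert (d * Cmod (qexp_g F n1 z) <= d * (c + K)) by (apply Rmult_le_compat_l; auto). lra.
Qed.

(** The numerator has leading exponent [12 (A0 + A1) / 4] and the denominator [4 (2 t + 3) / 4]. The
    difference [3 (A0 + A1) - (2 t + 3)] is a positive integer, hence at least 1, as [weight0_zero]
    requires. *)
Lemma wronskian_quotient_decay : (2 * t + 3 < 3 * (A0 + A1))%Z -> exists K, forall z, 3 / 4 <= Im z ->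
  Cmod (wronskian_quotient z) <= K * exp (- (2 * PI * Im z)).
Proof.
  intros HA. assert (PP := PI_RGT_0).
  (* Height [3/4] for [z] is height [3/16] for [z / 4]. *)
  destruct (qder_bound (even_part f) A0 (3 / 16) even_part_holo even_part_per HA0) as [K0 [P0 B0]]; [lra|].
  destruct (qder_bound (odd_part f) A1 (3 / 16) odd_part_holo odd_part_per HA1) as [K1 [P1 B1]]; [lra|].
  destruct (powerRZ_sandwich ((/ 2) ^ 4) (5 ^ 4) (- (2 * t + 3))) as [K2 [P2 B2]]; [apply pow_lt; lra|apply pow_lt; lra|].
  exists ((2 * (K0 * K1)) ^ 12 * K2). intros z Hz.
  assert (Hq : 3 / 16 <= Im (q4 z)) by (rewrite Im_q4; lra).
  destruct (B0 _ Hq) as [b0 b0']. destruct (B1 _ Hq) as [b1 b1']. rewrite Im_q4 in b0, b0', b1, b1'.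
  set (y := Im z) in *.
  set (E0 := exp (- (2 * PI * IZR A0 * (y / 4)))) in *. set (E1 := exp (- (2 * PI * IZR A1 * (y / 4)))) in *.
  assert (pE0 : 0 < E0) by apply exp_pos. assert (pE1 : 0 < E1) by apply exp_pos.
  assert (W : Cmod (wronskian z) <= 2 * (K0 * K1) * (E0 * E1)).
  { unfold wronskian, wronskian_tau. eapply Rle_trans; [apply Cmod_minus_le|]. rewrite !Cmod_mult.
    assert (Q1 : Cmod (even_part f (q4 z)) * Cmod (qder (odd_part f) A1 (q4 z)) <= (K0 * E0) * (K1 * E1))
      by (apply Rmult_le_compat; auto; apply Cmod_ge_0).
    assert (Q2 : Cmod (odd_part f (q4 z)) * Cmod (qder (even_part f) A0 (q4 z)) <= (K1 * E1) * (K0 * E0))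
      by (apply Rmult_le_compat; auto; apply Cmod_ge_0).
    nra. }
  assert (ND := theta_disc_neq_0 z ltac:(fold y; lra)).
  unfold wronskian_quotient. rewrite Cmod_mult, Cmod_Czpow, !Cmod_pow by (apply Cpow_nz; auto).
  set (r := exp (- (PI / 2 * y))). assert (Pr : 0 < r) by apply exp_pos.
  destruct (theta_disc_bounds z Hz) as [d1 d2]. fold y r in d1, d2.
  assert (Dp : powerRZ (Cmod (theta_disc z) ^ 4) (- (2 * t + 3)) <= K2 * powerRZ (r ^ 4) (- (2 * t + 3))).
  { apply B2; [apply pow_lt; auto|]. rewrite <- !Rpow_mult_distr. split; apply pow_incr; lra. }
  assert (Wp : Cmod (wronskian z) ^ 12 <= (2 * (K0 * K1)) ^ 12 * (E0 * E1) ^ 12).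
  { rewrite <- Rpow_mult_distr. apply pow_incr. split; [apply Cmod_ge_0|auto]. }
  assert (Q0 : 0 <= (2 * (K0 * K1)) ^ 12) by (apply pow_le; assert (0 <= K0 * K1) by (apply Rmult_le_pos; lra); lra).
  assert (Pd : 0 <= powerRZ (Cmod (theta_disc z) ^ 4) (- (2 * t + 3))).
  { apply powerRZ_le. apply pow_lt. apply (proj1 (Cmod_gt_0 _)). auto. }
  eapply Rle_trans; [apply Rmult_le_compat; [apply pow_le, Cmod_ge_0|auto|apply Wp|apply Dp]|].
  replace ((2 * (K0 * K1)) ^ 12 * (E0 * E1) ^ 12 * (K2 * powerRZ (r ^ 4) (- (2 * t + 3))))
    with ((2 * (K0 * K1)) ^ 12 * K2 * ((E0 * E1) ^ 12 * powerRZ (r ^ 4) (- (2 * t + 3)))) by ring.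
  apply Rmult_le_compat_l; [apply Rmult_le_pos; lra|].
  replace ((E0 * E1) ^ 12) with (powerRZ (E0 * E1) 12) by (simpl; ring).
  replace (r ^ 4) with (powerRZ r 4) by (simpl; ring).
  unfold E0, E1, r. rewrite <- exp_plus, !powerRZ_exp, <- exp_plus. apply exp_le_inc.
  rewrite opp_IZR. apply IZR_lt in HA. rewrite !plus_IZR, !mult_IZR, !plus_IZR in *.
  set (X0 := IZR A0) in *. set (X1 := IZR A1) in *. set (T := IZR t) in *.
  assert (HA' : 1 <= 3 * (X0 + X1) - (2 * T + 3)).
  { assert (Hi : (1 <= 3 * (A0 + A1) - (2 * t + 3))%Z).
    { cut (2 * t + 3 < 3 * (A0 + A1))%Z; [lia|]. apply lt_IZR. rewrite !plus_IZR, !mult_IZR, !plus_IZR. auto. }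
    apply IZR_le in Hi. rewrite minus_IZR, !plus_IZR, !mult_IZR, !plus_IZR in Hi. auto. }
  assert (0 < PI * y) by (apply Rmult_lt_0_compat; lra).
  assert (2 * (PI * y) * 1 <= 2 * (PI * y) * (3 * (X0 + X1) - (2 * T + 3))) by (apply Rmult_le_compat_l; lra).
  lra.
Qed.

Lemma wronskian_zero : (2 * t + 3 < 3 * (A0 + A1))%Z -> forall z, 0 < Im z -> wronskian z = RtoC 0.
Proof.
  intros HA z Hz. destruct (wronskian_quotient_decay HA) as [K HK].
  assert (E := weight0_zero wronskian_quotient K wronskian_quotient_holo wronskian_quotient_per wronskian_quotient_S HK z Hz).
  apply NNPP. intros N. revert E. unfold wronskian_quotient. apply Cmult_neq_0; [apply Cpow_nz; auto|].
  apply Czpow_neq_0, Cpow_nz, theta_disc_neq_0. auto.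
Qed.

(** After removing the powers of [q], the vanishing Wronskian reads
    [2 PI i (A1 - A0) G0 G1 = G1 dG0 - G0 dG1]. High on the imaginary axis [G0] and [G1] approach
    the leading coefficients while the derivatives tend to 0. *)
Lemma leading_coefs : (2 * t + 3 < 3 * (A0 + A1))%Z -> A0 <> A1 ->
  fcoef (even_part f) A0 = RtoC 0 \/ fcoef (odd_part f) A1 = RtoC 0.
Proof.
  intros HA NA. apply NNPP. intros N. apply not_or_and in N. destruct N as [N0 N1].
  assert (PP := PI_RGT_0). assert (P3 := PI2_3_2).
  set (c0 := fcoef (even_part f) A0) in *. set (c1 := fcoef (odd_part f) A1) in *.
  assert (p0 := proj1 (Cmod_gt_0 _) N0). assert (p1 := proj1 (Cmod_gt_0 _) N1).
  destruct (qexp_bounds (even_part f) A0 even_part_holo even_part_per 1 ltac:(lra)) as [K0 [k0 B0]].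
  destruct (qexp_bounds (odd_part f) A1 odd_part_holo odd_part_per 1 ltac:(lra)) as [K1 [k1 B1]].
  fold c0 in B0. fold c1 in B1.
  set (m0 := Cmod c0) in *. set (m1 := Cmod c1) in *.
  (* With errors and derivatives at most [del], [|G0|] and [|G1|] stay within a factor [1/2] to
     [3/2] of [m0] and [m1]. The left side is then at least [6 m0 m1 / 4], the right side at most
     [3/2 del (m0 + m1)], which is at most [3/4 m0 m1]. *)
  set (del := Rmin (Rmin (m0 / 2) (m1 / 2)) (m0 * m1 / (2 * (m0 + m1)))).
  assert (Hdel : 0 < del).
  { unfold del. repeat apply Rmin_pos; try lra. apply Rdiv_lt_0_compat; nra. }
  assert (D0 : del <= m0 / 2) by (unfold del; eapply Rle_trans; [apply Rmin_l|apply Rmin_l]).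
  assert (D1 : del <= m1 / 2) by (unfold del; eapply Rle_trans; [apply Rmin_l|apply Rmin_r]).
  assert (D2 : del * (2 * (m0 + m1)) <= m0 * m1).
  { apply Rle_trans with (m0 * m1 / (2 * (m0 + m1)) * (2 * (m0 + m1))).
    - apply Rmult_le_compat_r; [lra|]. apply Rmin_r.
    - right. field. lra. }
  set (y := 1 + (K0 + K1) / del).
  assert (Hy : (K0 + K1) <= del * y).
  { unfold y. replace (del * (1 + (K0 + K1) / del)) with (del + (K0 + K1)) by (field; lra). lra. }
  assert (Hy1 : 1 <= y).
  { unfold y. assert (0 <= (K0 + K1) / del); [|lra]. apply Rmult_le_pos; [lra|]. left. apply Rinv_0_lt_compat. auto. }
  set (z := ((0, y) : C)). assert (Hz : 1 <= Im z) by auto.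
  destruct (B0 z Hz) as [g0 dg0]. destruct (B1 z Hz) as [g1 dg1].
  change (Im z) with y in *.
  assert (He : forall K, 0 <= K <= K0 + K1 -> K * exp (- (2 * PI * y)) <= del).
  { intros K HK. assert (Q : exp (- (2 * PI * y)) <= / y).
    { rewrite exp_Ropp. apply Rinv_le_contravar; [lra|]. assert (h := exp_ge_1x (2 * PI * y)). nra. }
    assert (q := exp_pos (- (2 * PI * y))).
    apply Rle_trans with ((K0 + K1) * / y).
    - apply Rmult_le_compat; lra.
    - apply Rmult_le_reg_r with y; [lra|]. rewrite Rmult_assoc, Rinv_l by lra. lra. }
  assert (e0 := He K0 ltac:(lra)). assert (e1' := He K1 ltac:(lra)).
  set (G0 := qexp_g (even_part f) A0 z) in *. set (G1 := qexp_g (odd_part f) A1 z) in *.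
  set (dG0 := qexp_dg (even_part f) A0 z) in *. set (dG1 := qexp_dg (odd_part f) A1 z) in *.
  assert (E : (RtoC (2 * PI * IZR (A1 - A0)) * Ci * (G0 * G1))%C = (G1 * dG0 - G0 * dG1)%C).
  { assert (Hz4 : 0 < Im (RtoC 4 * z)) by (simpl; lra).
    assert (W := wronskian_zero HA _ Hz4). unfold wronskian in W.
    replace (q4 (RtoC 4 * z)) with z in W by (unfold q4; rewrite RtoC_inv by lra; field).
    unfold wronskian_tau, qder in W.
    rewrite (qexp_g_eq (even_part f) A0 even_part_holo even_part_per HA0 z), (qexp_g_eq (odd_part f) A1 odd_part_holo odd_part_per HA1 z) in W
      by (change (Im z) with y; lra).
    fold G0 G1 dG0 dG1 in W.
    assert (NQ := Cmult_neq_0 _ _ (qpow_neq_0 z A0) (qpow_neq_0 z A1)).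
    set (Q := (qpow z A0 * qpow z A1)%C) in *.
    assert (W' : (Q * ((RtoC (2 * PI * IZR (A1 - A0)) * Ci * (G0 * G1)) - (G1 * dG0 - G0 * dG1)))%C = RtoC 0).
    { rewrite <- W. unfold Q. rewrite minus_IZR.
      replace (RtoC (2 * PI * (IZR A1 - IZR A0))) with (RtoC (2 * PI * IZR A1) - RtoC (2 * PI * IZR A0))%C
        by (rewrite <- RtoC_minus; f_equal; ring). ring. }
    apply Ceq_minus. apply NNPP. intros NE. apply (Cmult_neq_0 _ _ NQ NE). auto. }
  assert (EM := f_equal Cmod E). rewrite !Cmod_mult, Cmod_Ci, Cmod_R in EM.
  assert (T := Cmod_minus_le (G1 * dG0) (G0 * dG1)). rewrite !Cmod_mult in T.
  assert (HAA : 6 <= Rabs (2 * PI * IZR (A1 - A0))).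
  { rewrite Rabs_mult, (Rabs_pos_eq (2 * PI)) by lra. rewrite <- abs_IZR.
    assert (1 <= IZR (Z.abs (A1 - A0))) by (apply IZR_le; lia). nra. }
  assert (l0 := Cmod_sub_rev c0 G0). rewrite Cmod_minus_sym in l0. fold m0 in l0.
  assert (l1 := Cmod_sub_rev c1 G1). rewrite Cmod_minus_sym in l1. fold m1 in l1.
  assert (u0 := Cmod_sub_rev G0 c0). fold m0 in u0. assert (u1 := Cmod_sub_rev G1 c1). fold m1 in u1.
  set (x0 := Cmod G0) in *. set (x1 := Cmod G1) in *.
  assert (h0 : m0 / 2 <= x0 <= 3 / 2 * m0) by lra. assert (h1 : m1 / 2 <= x1 <= 3 / 2 * m1) by lra.
  assert (Q1 : x1 * Cmod dG0 <= 3 / 2 * m1 * del) by (apply Rmult_le_compat; try lra; apply Cmod_ge_0).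
  assert (Q2 : x0 * Cmod dG1 <= 3 / 2 * m0 * del) by (apply Rmult_le_compat; try lra; apply Cmod_ge_0).
  assert (Q3 : m0 / 2 * (m1 / 2) <= x0 * x1) by (apply Rmult_le_compat; lra).
  assert (Q4 : 6 * (m0 / 2 * (m1 / 2)) <= Rabs (2 * PI * IZR (A1 - A0)) * (x0 * x1)) by (apply Rmult_le_compat; nra).
  nra.
Qed.

End Wronskian.

End PlusForm.

Lemma Z_least (P : Z -> Prop) (b : Z) : (forall n, (n < b)%Z -> ~ P n) -> (exists n, P n) ->
  exists n, P n /\ forall k, (k < n)%Z -> ~ P k.
Proof.
  intros Hb [n Hn]. assert (Hbn : (b <= n)%Z) by (destruct (Z_lt_le_dec n b); auto; exfalso; eapply Hb; eauto).
  remember (Z.to_nat (n - b)) as k eqn:Ek. revert n Hn Hbn Ek.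
  induction k as [k IH] using lt_wf_ind. intros n Hn Hbn Ek.
  destruct (classic (exists m, (m < n)%Z /\ P m)) as [[m [Hm Pm]]|N].
  - assert (b <= m)%Z by (destruct (Z_lt_le_dec m b); auto; exfalso; eapply Hb; eauto).
    apply (IH (Z.to_nat (m - b)) ltac:(lia) m); auto.
  - exists n. split; auto. intros m Hm Pm. apply N. eauto.
Qed.

(** * The zero estimate *)

(** If [f] is nonzero, neither part vanishes identically, so both have lowest exponents [A0 >= B0]
    and [A1 >= B1]. These are distinct because their residues modulo 4 differ, and [leading_coefs]
    contradicts the choice of one of them. *)
Theorem plus_form_zero (t : Z) (f : C -> C) (B0 B1 : Z) : plus_form t f ->
  (forall n, (n mod 4 = 0)%Z -> (n < B0)%Z -> fcoef f n = RtoC 0) ->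
  (forall n, ((n - eps_t t) mod 4 = 0)%Z -> (n < B1)%Z -> fcoef f n = RtoC 0) ->
  (2 * t + 3 < 3 * (B0 + B1))%Z -> forall n, fcoef f n = RtoC 0.
Proof.
  intros Hf HB0 HB1 HB.
  assert (Hh := proj1 Hf). assert (Hp := plus_form_per t f Hf). assert (Hpl := proj2 (proj2 Hf)).
  assert (F0 : forall n, fcoef (even_part f) n <> RtoC 0 -> (n mod 4 = 0)%Z /\ fcoef f n <> RtoC 0).
  { intros n. rewrite (fcoef_even_part t f Hf). intros N.
    destruct (plus_cases t f n Hpl) as [E|[E|E]].
    - exfalso. apply N. rewrite E. ring.
    - split; auto. intros E0. apply N. rewrite E0. ring.
    - exfalso. apply N. rewrite (proj2 (e1_div4_eps t n E)). ring. }
  assert (F1 : forall n, fcoef (odd_part f) n <> RtoC 0 -> ((n - eps_t t) mod 4 = 0)%Z /\ fcoef f n <> RtoC 0).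
  { intros n. rewrite (fcoef_odd_part t f Hf). intros N.
    destruct (plus_cases t f n Hpl) as [E|[E|E]].
    - exfalso. apply N. rewrite E. ring.
    - exfalso. apply N. rewrite (proj2 (e1_div4_0 n E)). ring.
    - split; auto. intros E0. apply N. rewrite E0. ring. }
  assert (Fin : (forall z, 0 < Im z -> f z = RtoC 0) -> forall n, fcoef f n = RtoC 0).
  { intros E n. rewrite fcoef_at_1. unfold fcoef_at.
    rewrite (CInt_ext _ (fun _ => RtoC 0)).
    - rewrite CInt_const. ring.
    - intros x _. rewrite E by (simpl; lra). ring. }
  apply NNPP. intros N.
  assert (X0 : exists n, fcoef (even_part f) n <> RtoC 0).
  { apply NNPP. intros M. apply N. apply Fin. apply (plus_form_zero_of_part t f Hf). left.
    apply fcoef_zero_all; [apply (even_part_holo t f Hf)|apply (even_part_per t f Hf)|].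
    intros n. apply NNPP. intros M'. apply M. exists n. auto. }
  assert (X1 : exists n, fcoef (odd_part f) n <> RtoC 0).
  { apply NNPP. intros M. apply N. apply Fin. apply (plus_form_zero_of_part t f Hf). right.
    apply fcoef_zero_all; [apply (odd_part_holo t f Hf)|apply (odd_part_per t f Hf)|].
    intros n. apply NNPP. intros M'. apply M. exists n. auto. }
  destruct (Z_least (fun n => fcoef (even_part f) n <> RtoC 0) B0) with (2 := X0) as [A0 [N0 L0]].
  { intros n Hn M. destruct (F0 n M) as [m1 m2]. apply m2. apply HB0; auto. }
  destruct (Z_least (fun n => fcoef (odd_part f) n <> RtoC 0) B1) with (2 := X1) as [A1 [N1 L1]].
  { intros n Hn M. destruct (F1 n M) as [m1 m2]. apply m2. apply HB1; auto. }
  destruct (F0 A0 N0) as [a0 a0']. destruct (F1 A1 N1) as [a1 a1'].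
  assert (G0 : (B0 <= A0)%Z) by (destruct (Z_lt_le_dec A0 B0); auto; exfalso; apply a0'; auto).
  assert (G1 : (B1 <= A1)%Z) by (destruct (Z_lt_le_dec A1 B1); auto; exfalso; apply a1'; auto).
  destruct (leading_coefs t f Hf A0 A1) as [E|E]; auto.
  - intros n Hn. apply NNPP. apply L0. auto.
  - intros n Hn. apply NNPP. apply L1. auto.
  - lia.
  - intros E. subst A1. unfold eps_t in a1. destruct (Z.even t); Z.div_mod_to_equations; lia.
Qed.

(** * Homogeneous linear systems *)

Definition skip (p j : nat) : nat := if (j <? p)%nat then j else S j.

Lemma csum_skip (u : nat -> C) (p N : nat) : (p <= N)%nat ->
  csum u (S N) = (u p + csum (fun j => u (skip p j)) N)%C.
Proof.
  revert p. induction N as [|N IH]; intros p Hp.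
  - replace p with O by lia. simpl. ring.
  - change (csum u (S (S N))) with (csum u (S N) + u (S N))%C.
    change (csum (fun j => u (skip p j)) (S N)) with (csum (fun j => u (skip p j)) N + u (skip p N))%C.
    destruct (Nat.eq_dec p (S N)) as [->|Hn].
    + rewrite (csum_ext (fun j => u (skip (S N) j)) u N).
      * unfold skip. replace (N <? S N)%nat with true by (symmetry; apply Nat.ltb_lt; lia). simpl. ring.
      * intros k Hk. unfold skip. replace (k <? S N)%nat with true by (symmetry; apply Nat.ltb_lt; lia). auto.
    + rewrite (IH p) by lia. unfold skip at 3.
      replace (N <? p)%nat with false by (symmetry; apply Nat.ltb_ge; lia). ring.
Qed.

Lemma csum_scal (c : C) (u : nat -> C) (N : nat) : csum (fun j => c * u j)%C N = (c * csum u N)%C.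
Proof. induction N as [|N IH]; simpl; [ring|rewrite IH; ring]. Qed.

Lemma csum_plus (u v : nat -> C) (N : nat) : csum (fun j => u j + v j)%C N = (csum u N + csum v N)%C.
Proof. induction N as [|N IH]; simpl; [ring|rewrite IH; ring]. Qed.

(** Gaussian elimination: a nonzero entry of the last row serves as pivot, its unknown is eliminated
    from the other equations by induction and recovered from the last one. *)
Lemma underdetermined_system (n : nat) : forall A : nat -> nat -> C,
  exists c : nat -> C, (exists j, (j <= n)%nat /\ c j <> RtoC 0) /\
    forall i, (i < n)%nat -> csum (fun j => A i j * c j)%C (S n) = RtoC 0.
Proof.
  induction n as [|n IH]; intros A.
  - exists (fun _ => RtoC 1). split; [exists O; split; auto; apply C1_nz|]. intros i Hi. lia.
  - destruct (classic (exists p, (p <= S n)%nat /\ A n p <> RtoC 0)) as [[p [Hp HA]]|HA].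
    + destruct (IH (fun i j => A i (skip p j) - A i p * A n (skip p j) / A n p)%C) as [d [[j0 [Hj0 Hd]] Hs]].
      set (cp := (- csum (fun j => A n (skip p j) * d j)%C (S n) / A n p)%C).
      set (c := fun k => if (k <? p)%nat then d k else if (k =? p)%nat then cp else d (pred k)).
      assert (Cs : forall j, c (skip p j) = d j).
      { intros j. unfold c, skip. destruct (j <? p)%nat eqn:E.
        - rewrite E. auto.
        - apply Nat.ltb_ge in E. replace (S j <? p)%nat with false by (symmetry; apply Nat.ltb_ge; lia).
          replace (S j =? p)%nat with false by (symmetry; apply Nat.eqb_neq; lia). auto. }
      assert (Cp : c p = cp).
      { unfold c. rewrite Nat.ltb_irrefl, Nat.eqb_refl. auto. }
      exists c. split.
      * exists (skip p j0). rewrite Cs. split; auto. unfold skip. destruct (j0 <? p)%nat; lia.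
      * intros i Hi. rewrite (csum_skip _ p) by auto. rewrite Cp.
        rewrite (csum_ext _ (fun j => A i (skip p j) * d j)%C) by (intros; rewrite Cs; auto).
        destruct (Nat.eq_dec i n) as [->|Hn].
        -- unfold cp. field. auto.
        -- specialize (Hs i ltac:(lia)). rewrite <- Hs.
           rewrite (csum_ext (fun j => (A i (skip p j) - A i p * A n (skip p j) / A n p) * d j)%C
             (fun j => A i (skip p j) * d j + (- (A i p / A n p)) * (A n (skip p j) * d j))%C)
             by (intros; field; auto).
           rewrite csum_plus, csum_scal. unfold cp. field. auto.
    (* The last row is zero in all the relevant columns: the other equations are solved in one
       unknown less, and that unknown is set to 0. *)
    + destruct (IH A) as [d [[j0 [Hj0 Hd]] Hs]].
      exists (fun k => if (k <=? n)%nat then d k else RtoC 0). split.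
      * exists j0. split; [lia|]. replace (j0 <=? n)%nat with true by (symmetry; apply Nat.leb_le; auto). auto.
      * intros i Hi.
        match goal with |- csum ?g (S (S n)) = _ => change (csum g (S (S n))) with (csum g (S n) + g (S n))%C end.
        cbv beta. replace (S n <=? n)%nat with false by (symmetry; apply Nat.leb_gt; lia).
        rewrite (csum_ext _ (fun j => A i j * d j)%C).
        -- destruct (Nat.eq_dec i n) as [->|Hn]; [|rewrite Hs by lia; ring].
           rewrite csum_zero; [ring|]. intros k Hk.
           replace (A n k) with (RtoC 0); [ring|]. symmetry. apply NNPP. intros N. apply HA. exists k. split; auto; lia.
        -- intros k Hk. replace (k <=? n)%nat with true by (symmetry; apply Nat.leb_le; lia). auto.
Qed.

(** * Linear combinations of plus forms *)

Lemma plus_form_csum (t : Z) (F : nat -> C -> C) (c : nat -> C) (M : nat) :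
  (forall j, (j < M)%nat -> plus_form t (F j)) ->
  plus_form t (fun z => csum (fun j => c j * F j z)%C M) /\
  forall n, fcoef (fun z => csum (fun j => c j * F j z)%C M) n = csum (fun j => c j * fcoef (F j) n)%C M.
Proof.
  induction M as [|M IH]; intros HF.
  - assert (Ez : forall n, fcoef (fun _ => RtoC 0) n = RtoC 0).
    { intros n. rewrite fcoef_at_1. unfold fcoef_at.
      rewrite (CInt_ext _ (fun _ => RtoC 0)) by (intros; ring). rewrite CInt_const. ring. }
    simpl. split; [|auto]. split; [|split].
    + intros z _. exists (RtoC 0). apply Cder_const.
    + intros a b c' d _ z _. ring.
    + intros n _. auto.
  - destruct IH as [[h1 [h2 h3]] IH]; [intros; apply HF; lia|].
    destruct (HF M ltac:(lia)) as [g1 [g2 g3]].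
    set (u := fun z => csum (fun j => c j * F j z)%C M) in *.
    assert (E : forall n, fcoef (fun z => u z + c M * F M z)%C n = (fcoef u n + c M * fcoef (F M) n)%C)
      by (intros; apply fcoef_lin; auto).
    change (fun z => csum (fun j => c j * F j z)%C (S M)) with (fun z => (u z + c M * F M z)%C).
    split; [split; [|split]|].
    + apply holoH_lin; auto.
    + intros a b c' d Hg z Hz. rewrite (h2 a b c' d Hg z Hz), (g2 a b c' d Hg z Hz). ring.
    + intros n Hn. rewrite E, (h3 n Hn), (g3 n Hn). ring.
    + intros n. rewrite E, IH. reflexivity.
Qed.

Lemma in_Mshriek_plus_form (t : Z) (f : C -> C) : in_Mshriek t f -> plus_form t f.
Proof.
  intros [h1 [h2 [_ h4]]]. split; [apply holoH_iff; auto|]. split; auto.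
Qed.

Lemma csum_single (u : nat -> C) (N j : nat) : (j < N)%nat ->
  (forall k, (k < N)%nat -> k <> j -> u k = RtoC 0) -> csum u N = u j.
Proof.
  induction N as [|N IH]; intros Hj H; [lia|]. simpl. destruct (Nat.eq_dec j N) as [->|Hn].
  - rewrite csum_zero; [ring|]. intros k Hk. apply H; lia.
  - rewrite IH, (H N) by (auto; lia). ring.
Qed.

(** * Counting indices *)

Lemma length_filter_windows (p : nat -> bool) :
  (forall s, (length (filter p (seq s 4)) <= 2)%nat) ->
  forall L s, (length (filter p (seq s L)) <= 2 * (L / 4 + 1))%nat.
Proof.
  intros H4 L s.
  assert (Hq : forall q s, (length (filter p (seq s (4 * q))) <= 2 * q)%nat).
  { induction q as [|q IH]; intros s0; [simpl; auto|].
    replace (4 * S q)%nat with (4 + 4 * q)%nat by lia.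
    rewrite seq_app, filter_app, length_app. specialize (H4 s0). specialize (IH (s0 + 4)%nat). lia. }
  assert (E : (4 * (L / 4 + 1) = L + (4 * (L / 4 + 1) - L))%nat).
  { assert (h := Nat.div_mod L 4 ltac:(lia)). assert (h' := Nat.mod_upper_bound L 4 ltac:(lia)). lia. }
  specialize (Hq (L / 4 + 1)%nat s). rewrite E, seq_app, filter_app, length_app in Hq. lia.
Qed.

Lemma plus_okb_add2 (t x : Z) : plus_okb t x = true -> plus_okb t (x + 2) = false.
Proof.
  unfold plus_okb. intros H. apply Bool.orb_true_iff in H. apply Bool.orb_false_iff.
  destruct (Z.even t); destruct H as [H|H]; apply Z.eqb_eq in H; split; apply Z.eqb_neq;
    Z.div_mod_to_equations; lia.
Qed.

(** Of [k] and [k + 2] at most one is admissible, so any four consecutive integers contain at most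
    two qualifying indices. For odd [m] both admissible classes differ from that of [m], and two in
    four is the true density. *)
Lemma rank_bound (t m i : Z) : (- Nk t <= i)%Z -> (Z.of_nat (rank t m i) <= (i + Nk t) / 2 + 2)%Z.
Proof.
  intros Hi. unfold rank. set (p := fun k : nat => qualb t m (- Nk t + Z.of_nat k)%Z).
  assert (H4 : forall s, (length (filter p (seq s 4)) <= 2)%nat).
  { intros s.
    assert (Hp : forall k, p k = true -> p (S (S k)) = false).
    { intros k Hk. unfold p, qualb, admissibleb in *.
      apply andb_prop in Hk. destruct Hk as [Hk _]. apply andb_prop in Hk. destruct Hk as [_ Hk].
      apply plus_okb_add2 in Hk.
      replace (- Nk t + Z.of_nat (S (S k)))%Z with (- Nk t + Z.of_nat k + 2)%Z by lia.
      rewrite Hk. rewrite Bool.andb_false_r. auto. }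
    simpl. destruct (p s) eqn:E0; destruct (p (S s)) eqn:E1;
      rewrite ?(Hp _ E0), ?(Hp _ E1); simpl; destruct (p (S (S s))); destruct (p (S (S (S s)))); simpl; lia. }
  assert (B := length_filter_windows p H4 (Z.to_nat (i + Nk t)) 0).
  set (L := Z.to_nat (i + Nk t)) in *.
  assert (EL : (i + Nk t)%Z = Z.of_nat L) by (unfold L; lia). rewrite EL.
  apply Nat2Z.inj_le in B. rewrite Nat2Z.inj_mul, Nat2Z.inj_add, Nat2Z.inj_div in B.
  Z.div_mod_to_equations. lia.
Qed.

(** * Reduction of the weight modulo 12 *)

(** Leaves only the twelve weights given by [b] to be examined, with [a] entering linearly. *)
Lemma Nk_shift (t a : Z) : Nk (t - 12 * a) = (Nk t - 4 * a)%Z.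
Proof.
  assert (Em : ((t - 12 * a) mod 6 = t mod 6)%Z).
  { replace (t - 12 * a)%Z with (t + (- 2 * a) * 6)%Z by ring. apply Z_mod_plus_full. }
  assert (Ek : kp_half (t - 12 * a) = kp_half t) by (unfold kp_half; rewrite Em; auto).
  assert (El : ell (t - 12 * a) = (ell t - 2 * a)%Z).
  { unfold ell. rewrite Ek. replace (t - 12 * a - kp_half t)%Z with (t - kp_half t + (- 2 * a) * 6)%Z by ring.
    rewrite Z_div_plus_full by lia. ring. }
  unfold Nk. rewrite El.
  replace (Z.even (ell t - 2 * a)) with (Z.even (ell t)).
  - replace (Z.even (t - 12 * a)) with (Z.even t).
    + destruct (Z.even (ell t)); ring.
    + replace (t - 12 * a)%Z with (t + 2 * (- 6 * a))%Z by ring. rewrite Z.even_add_mul_2. auto.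
  - replace (ell t - 2 * a)%Z with (ell t + 2 * (- a))%Z by ring. rewrite Z.even_add_mul_2. auto.
Qed.

Lemma eps_t_shift (t a : Z) : eps_t (t - 12 * a) = eps_t t.
Proof.
  unfold eps_t. replace (t - 12 * a)%Z with (t + 2 * (- 6 * a))%Z by ring. rewrite Z.even_add_mul_2. auto.
Qed.

Lemma plus_okb_pred (t i : Z) : (i mod 4 = 0)%Z \/ ((i + eps_t t) mod 4 = 0)%Z -> plus_okb (t - 1) i = true.
Proof.
  intros H. unfold plus_okb, eps_t in *. replace (t - 1)%Z with (Z.pred t) by lia.
  rewrite Z.even_pred, <- Z.negb_even. apply Bool.orb_true_iff.
  destruct (Z.even t); simpl; rewrite !Z.eqb_eq; Z.div_mod_to_equations; lia.
Qed.

(* [r] is the residue class of the indices that are used and [m] lies in the other exponent class;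
   [n1] is the first exponent above [Nk t] congruent to [m] and [i1] the first index congruent to [r]. *)
Lemma vanishing_impossible (t m r : Z) (f : Z -> C -> C) (n1 i1 : Z) (M : nat) :
  (forall i, admissibleb t i = true -> canonical t i (f i)) ->
  ((m mod 4 = 0 /\ (r + eps_t t) mod 4 = 0) \/ ((m - eps_t t) mod 4 = 0 /\ r mod 4 = 0))%Z ->
  (Nk t < n1 <= Nk t + 4)%Z -> ((m - n1) mod 4 = 0)%Z ->
  (- Nk t <= i1)%Z -> ((i1 - r) mod 4 = 0)%Z ->
  m = (n1 + 4 * Z.of_nat M)%Z -> (2 * t + 3 < 3 * (n1 - i1 + 4))%Z ->
  ~ (forall j : nat, (j <= M)%nat -> fcoef (f (i1 + 4 * Z.of_nat j)%Z) m = RtoC 0).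
Proof.
  intros Hf Hcl Hn1 Hmn Hi1 Hir Hm HD Hall.
  set (idx := fun j : nat => (i1 + 4 * Z.of_nat j)%Z).
  assert (Hadm : forall j, admissibleb t (idx j) = true).
  { intros j. unfold admissibleb. apply andb_true_intro. split.
    - apply Z.leb_le. unfold idx. lia.
    - apply plus_okb_pred. unfold idx, eps_t in *. destruct (Z.even t); Z.div_mod_to_equations; lia. }
  assert (Hcan : forall j, canonical t (idx j) (f (idx j))) by (intros; apply Hf; auto).
  (* There are [M + 1] unknowns but only the [M] exponents [n1 + 4 l] with [l < M]; the next
     exponent, [l = M], is [m], where the coefficients vanish by hypothesis. *)
  destruct (underdetermined_system M (fun l j => fcoef (f (idx j)) (n1 + 4 * Z.of_nat l))) as [c [[j0 [Hj0 Nc]] Hc]].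
  set (h := fun z => csum (fun j => c j * f (idx j) z)%C (S M)).
  destruct (plus_form_csum t (fun j => f (idx j)) c (S M)) as [Hh Eh].
  { intros j _. apply in_Mshriek_plus_form. apply Hcan. }
  fold h in Hh, Eh.
  assert (Hlow : forall n, (n <= Nk t)%Z -> (forall j, (j <= M)%nat -> n <> (- idx j)%Z) -> fcoef h n = RtoC 0).
  { intros n Hn Hne. rewrite Eh. apply csum_zero. intros j Hj.
    destruct (Hcan j) as [_ [_ Hz]]. rewrite Hz; auto; [ring|]. apply Hne. lia. }
  assert (Hown : forall n, ((n - m) mod 4 = 0)%Z -> (n < n1 + 4 * Z.of_nat (S M))%Z -> fcoef h n = RtoC 0).
  { intros n Hn Hlt. destruct (Z_le_gt_dec n (Nk t)) as [h1|h1].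
    - apply Hlow; auto. intros j Hj E. unfold idx, eps_t in *.
      destruct (Z.even t); Z.div_mod_to_equations; lia.
    - assert (El : exists l : nat, (l <= M)%nat /\ n = (n1 + 4 * Z.of_nat l)%Z).
      { exists (Z.to_nat ((n - n1) / 4)). Z.div_mod_to_equations. lia. }
      destruct El as [l [Hl ->]]. destruct (Nat.eq_dec l M) as [->|Hlm].
      + rewrite <- Hm. rewrite Eh. apply csum_zero. intros j Hj. unfold idx. rewrite Hall by lia. ring.
      + rewrite Eh. rewrite <- (Hc l) by lia. apply csum_ext. intros; ring. }
  assert (Hoth : forall n, ((n + r) mod 4 = 0)%Z -> (n < - idx M)%Z -> fcoef h n = RtoC 0).
  { intros n Hn Hlt. apply Hlow.
    - unfold idx in *. lia.
    - intros j Hj. unfold idx in *. lia. }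
  (* The bounds for the two classes add up to [n1 + 4 (M + 1) - (i1 + 4 M) = n1 - i1 + 4]. Thus [M]
     cancels, and the summand 4 is the gain from the coefficient at [m]. *)
  assert (Hz : forall n, fcoef h n = RtoC 0).
  { destruct Hcl as [[c1 c2]|[c1 c2]].
    - apply (plus_form_zero t h (n1 + 4 * Z.of_nat (S M)) (- idx M)); auto.
      + intros n Hn Hlt. apply Hown; auto. Z.div_mod_to_equations; lia.
      + intros n Hn Hlt. apply Hoth; auto. unfold eps_t in *. destruct (Z.even t); Z.div_mod_to_equations; lia.
      + unfold idx. lia.
    - apply (plus_form_zero t h (- idx M) (n1 + 4 * Z.of_nat (S M))); auto.
      + intros n Hn Hlt. apply Hoth; auto. Z.div_mod_to_equations; lia.
      + intros n Hn Hlt. apply Hown; auto. unfold eps_t in *. destruct (Z.even t); Z.div_mod_to_equations; lia.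
      + unfold idx. lia. }
  (* The exponent [- idx j0] occurs in the basis element of index [idx j0] alone, with coefficient
     1, so the combination has coefficient [c j0] there. *)
  apply Nc. rewrite <- (Hz (- idx j0)%Z), Eh. rewrite (csum_single _ (S M) j0).
  - destruct (Hcan j0) as [_ [E1 _]]. rewrite E1. ring.
  - lia.
  - intros k Hk Hne. destruct (Hcan k) as [_ [_ Hz']]. rewrite Hz'; [ring|unfold idx; lia|unfold idx; lia].
Qed.

Theorem theorem1p4 :
  exists A B : R, 0 < A /\ A <= 9 /\ 0 < B /\ B <= 109 /\
  forall s a b : Z, s = (12 * a + b)%Z -> In b b_range ->
  forall m : Z, A * IZR (Z.abs a) + B <= IZR m ->
    ((m mod 4 = 0)%Z \/ (m mod 4 = if Z.even (s - 1) then 1 else 3)%Z) ->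
  forall f : Z -> C -> C,
    (forall i : Z, admissibleb (1 - s) i = true -> canonical (1 - s) i (f i)) ->
  forall M : Z,
    3 * IZR a + 3 * IZR m / 4 + IZR b / 2 - Cconst m b < IZR M ->
    ~ (forall i : Z, qualb (1 - s) m i = true ->
         (Z.of_nat (rank (1 - s) m i) < M)%Z ->
         fcoef (f i) m = RtoC 0).
Proof.
  (* The largest values that the statement admits; the comparison of ranks at the end holds with
     room to spare. *)
  exists 9, 109. repeat (split; [lra|]).
  intros s a b Hs Hb m Hm Hmod f Hf M HM Hall.
  assert (Hm' : (9 * Z.abs a + 109 <= m)%Z).
  { apply le_IZR. rewrite plus_IZR, mult_IZR. auto. }
  (* In every case [Cconst] is at most [7 / 4]; multiplying by 4 makes the bound on [M] integral. *)
  assert (HMz : (12 * a + 3 * m + 2 * b - 7 < 4 * M)%Z).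
  { apply lt_IZR. rewrite minus_IZR, !plus_IZR, !mult_IZR.
    assert (Hc : Cconst m b <= 7 / 4).
    { unfold Cconst. destruct (Z.even m); [destruct (Z.even b)|destruct (existsb (Z.eqb b) _)]; lra. }
    lra. }
  clear Hm HM.
  set (t := (1 - s)%Z) in *.
  assert (Et : t = (1 - b - 12 * a)%Z) by (unfold t; lia).
  assert (EN : Nk t = (Nk (1 - b) - 4 * a)%Z) by (rewrite Et; apply Nk_shift).
  assert (Ee : eps_t t = eps_t (1 - b)) by (rewrite Et; apply eps_t_shift).
  assert (Hmod' : (m mod 4 = 0)%Z \/ ((m - eps_t t) mod 4 = 0)%Z).
  { destruct Hmod as [h|h]; [left; auto|right].
    unfold eps_t. replace (Z.even t) with (Z.even (s - 1)).
    - destruct (Z.even (s - 1)); Z.div_mod_to_equations; lia.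
    - unfold t. replace (1 - s)%Z with (- (s - 1))%Z by ring. rewrite Z.even_opp. auto. }
  (* Index [i] has principal part in the exponent class of [-i], which must differ from that of [m].
     So class [- eps_t t] serves for [m] divisible by 4, and class 0 for odd [m]. *)
  set (r := if (m mod 4 =? 0)%Z then (- eps_t t)%Z else 0%Z).
  set (n1 := (Nk t + 1 + (m - Nk t - 1) mod 4)%Z).
  set (i1 := (- Nk t + (r + Nk t) mod 4)%Z).
  assert (Heps : (eps_t t = 1 \/ eps_t t = -1)%Z) by (unfold eps_t; destruct (Z.even t); auto).
  (* Both sides of the inequality change by [-24 a] with [a]: the left through [2 t], the right
     because [n1 - i1] moves with [2 Nk t]. What remains is a check over the twelve values of [b]
     and the two classes of [m]. *)
  assert (HN : (- 8 - 4 * a <= Nk t <= - 4 * a)%Z /\ (2 * t + 3 < 3 * (n1 - i1 + 4))%Z).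
  { unfold n1, i1, r. rewrite Ee in *. rewrite EN, Et. clear - Hb Hmod'. unfold b_range in Hb. simpl in Hb.
    repeat (destruct Hb as [Hb|Hb]; [subst b; match goal with |- context [Nk ?x] =>
      let v := eval vm_compute in (Nk x) in change (Nk x) with v in * end;
      match type of Hmod' with context [eps_t ?x] =>
      let v := eval vm_compute in (eps_t x) in change (eps_t x) with v in * end;
      destruct (m mod 4 =? 0)%Z eqn:Em; [apply Z.eqb_eq in Em|apply Z.eqb_neq in Em];
      Z.div_mod_to_equations; lia|]). contradiction. }
  destruct HN as [HN HD].
  assert (Hn1 : (Nk t < n1 <= Nk t + 4)%Z) by (unfold n1; Z.div_mod_to_equations; lia).
  assert (Hi1 : (- Nk t <= i1 <= - Nk t + 3)%Z) by (unfold i1; Z.div_mod_to_equations; lia).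
  assert (Hmn : ((m - n1) mod 4 = 0)%Z) by (unfold n1; Z.div_mod_to_equations; lia).
  assert (Hir : ((i1 - r) mod 4 = 0)%Z) by (unfold i1; Z.div_mod_to_equations; lia).
  assert (Hcl : ((m mod 4 = 0 /\ (r + eps_t t) mod 4 = 0) \/ ((m - eps_t t) mod 4 = 0 /\ r mod 4 = 0))%Z).
  { unfold r. destruct (m mod 4 =? 0)%Z eqn:Em; [apply Z.eqb_eq in Em|apply Z.eqb_neq in Em].
    - left. split; auto. rewrite Z.add_opp_diag_l. auto.
    - right. destruct Hmod'; [contradiction|]. auto. }
  set (L := Z.to_nat ((m - n1) / 4)).
  assert (HL : m = (n1 + 4 * Z.of_nat L)%Z) by (unfold L; Z.div_mod_to_equations; lia).
  apply (vanishing_impossible t m r f n1 i1 L Hf Hcl Hn1 Hmn (proj1 Hi1) Hir HL HD).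
  intros j Hj. apply Hall.
  - unfold qualb, admissibleb. apply andb_true_intro. split; [apply andb_true_intro; split|].
    + apply Z.leb_le. lia.
    + apply plus_okb_pred. clear HD HN Hn1 HL. clearbody r. clear - Hcl Hir Heps. Z.div_mod_to_equations. lia.
    + apply Bool.negb_true_iff, Z.eqb_neq. clearbody r. clear - Hcl Hir Heps. Z.div_mod_to_equations. lia.
  (* The indices used go up to [i1 + 4 L], so their ranks are at most [2 L + 3], hence at most
     [m / 2 + 2 a + 13 / 2]. On the other side [M] exceeds [3 m / 4 + 3 a + 5 / 4] because [b >= 6],
     and the lower bound on [m] in terms of [|a|] separates the two. *)
  - assert (B := rank_bound t m (i1 + 4 * Z.of_nat j) ltac:(lia)).
    assert (Hb6 : (6 <= b)%Z).
    { clear - Hb. unfold b_range in Hb. simpl in Hb. lia. }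
    clearbody n1 i1 r L t. clear - B Hj HL Hi1 Hn1 HN HMz Hm' Hb6. Z.div_mod_to_equations. lia.
Qed.
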